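(* Let $n\ge 2$ and consider the polynomial differential system $\dot x=P(x)$, $x\in\mathbb C^n$, where $P=(P_1,\ldots,P_n)$ with $P_i\in\mathbb C[x]$. If this system is Liouvillian integrable, i.e. it has $n-1$ functionally independent Liouvillian first integrals, then it has a Darboux Jacobian multiplier.
   Context: Write $\partial_i=\partial/\partial x_i$ and $\mathcal X_P=\sum_{i=1}^n P_i\partial_i$. A first integral is a non-constant function $H$, defined on a full Lebesgue measure subset of $\mathbb C^n$, with $\mathcal X_P(H)\equiv 0$ there. A Jacobian multiplier is a smooth function $J$ with $\partial_1(JP_1)+\cdots+\partial_n(JP_n)=0$. A Darboux function is a function of the form $\exp(g/h)f_1^{l_1}\cdots f_r^{l_r}$ with $g,h,f_i\in\mathbb C[x]$, $l_i\in\mathbb C$ (the $f_i$ irreducible and pairwise distinct, $g,h$ coprime); a Darboux Jacobian multiplier is a Jacobian multiplier that is a Darboux function. Functions are functionally independent if their gradients are linearly independent on a full Lebesgue measure subset. A differential field extension $L/K$ (fields of characteristic $0$ with commuting derivations extending those of $K$) is Liouvillian if there is a tower $K=K_0\subset K_1\subset\cdots\subset K_r=L$ where each $K_{i+1}$ is either a finite algebraic extension of $K_i$, or $K_{i+1}=K_i(t)$ with $t$ transcendental over $K_i$ and $\delta t/t\in K_i$ for every derivation $\delta$, or $K_{i+1}=K_i(t)$ with $t$ transcendental over $K_i$ and $\delta t\in K_i$ for every derivation $\delta$. A Liouvillian function is an element of a Liouvillian extension of $(\mathbb C(x),\{\partial_1,\ldots,\partial_n\})$; a Liouvillian first integral is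 a first integral that is a Liouvillian function. *)

(* Defs.v *)
From HB Require Import structures.
From mathcomp Require Import all_boot all_algebra.
From mathcomp Require Import reals complex.
From mathcomp Require Import mpoly.

Set Implicit Arguments.
Unset Strict Implicit.
Unset Printing Implicit Defensive.

Import GRing.Theory.
Local Open Scope ring_scope.

(* A differential field with n commuting derivations d_0,...,d_{n-1}
   extending (C(x), {partial_1,...,partial_n}), with C = complex R:
   iota is an injective ring morphism C[x_1..x_n] -> L (hence extends to an
   embedding of C(x)) with d_i (iota p) = iota (partial_i p). *)
Record diff_ext (R : realType) (n : nat) := DiffExt {
  de_L :> fieldType;
  de_d : 'I_n -> de_L -> de_L;
  de_iota : {rmorphism {mpoly (complex R)[n]} -> de_L};
  de_dD : forall i (x y : de_L), de_d i (x + y) = de_d i x + de_d i y;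
  de_dM : forall i (x y : de_L), de_d i (x * y) = de_d i x * y + x * de_d i y;
  de_comm : forall i j (x : de_L), de_d i (de_d j x) = de_d j (de_d i x);
  de_iota_inj : injective de_iota;
  de_iota_d : forall i p, de_d i (de_iota p) = de_iota (mderiv i p)
}.

Section Liouville.
Variables (R : realType) (n : nat) (E : diff_ext R n).
Local Notation L := (de_L E).
Local Notation d := (@de_d _ _ E).
Local Notation iota := (@de_iota _ _ E).

Definition base_field (y : L) : Prop :=
  exists p q : {mpoly (complex R)[n]}, q != 0 /\ y * iota q = iota p.

Definition poly_over (K : L -> Prop) (a : {poly L}) : Prop :=
  forall k, K a`_k.

Definition adjoin (K : L -> Prop) (t : L) (y : L) : Prop :=
  exists a b : {poly L}, [/\ poly_over K a, poly_over K b, b.[t] != 0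
                            & y = a.[t] / b.[t]].

Definition algebraic_over (K : L -> Prop) (t : L) : Prop :=
  exists a : {poly L}, [/\ poly_over K a, a != 0 & root a t].

Definition transcendental_over (K : L -> Prop) (t : L) : Prop :=
  ~ algebraic_over K t.

Inductive liouville_tower_field : (L -> Prop) -> Prop :=
  | LT_base : liouville_tower_field base_field
  | LT_alg K t : liouville_tower_field K -> algebraic_over K t ->
      liouville_tower_field (adjoin K t)
  | LT_exp K t : liouville_tower_field K -> transcendental_over K t ->
      (forall i, K (d i t / t)) -> liouville_tower_field (adjoin K t)
  | LT_prim K t : liouville_tower_field K -> transcendental_over K t ->
      (forall i, K (d i t)) -> liouville_tower_field (adjoin K t).

Definition liouvillian (y : L) : Prop :=
  exists K, liouville_tower_field K /\ K y.

Definition XP (P : 'I_n -> {mpoly (complex R)[n]}) (H : L) : L :=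
  \sum_(i < n) iota (P i) * d i H.

Definition first_integral (P : 'I_n -> {mpoly (complex R)[n]}) (H : L) : Prop :=
  (exists i, d i H != 0) /\ XP P H = 0.

Definition functionally_independent (m : nat) (H : 'I_m -> L) : Prop :=
  \rank (\matrix_(j < m, i < n) d i (H j)) = m.

End Liouville.

Definition liouvillian_integrable (R : realType) (n : nat)
    (P : 'I_n -> {mpoly (complex R)[n]}) : Prop :=
  exists (E : diff_ext R n) (H : 'I_n.-1 -> de_L E),
    [/\ forall j, liouvillian (H j),
        forall j, first_integral P (H j)
      & functionally_independent H].

Definition mconst (R : realType) (n : nat) (p : {mpoly (complex R)[n]}) : Prop :=
  (msize p <= 1)%N.

Definition mirreducible (R : realType) (n : nat) (p : {mpoly (complex R)[n]}) : Prop :=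
  ~ mconst p /\ forall a b, p = a * b -> mconst a \/ mconst b.

Definition mcoprime (R : realType) (n : nat) (g h : {mpoly (complex R)[n]}) : Prop :=
  forall c a b, g = c * a -> h = c * b -> mconst c.

(* J is a Darboux function exp(g/h) f_1^{l_1} ... f_r^{l_r} in the differential
   field E: Ex is exp(g/h) (d_k Ex = Ex d_k(g/h)) and F i is f_i^{l_i}
   (d_k F_i = l_i F_i d_k f_i / f_i). *)
Definition darboux_function (R : realType) (n : nat) (E : diff_ext R n) (J : de_L E) : Prop :=
  exists (g h : {mpoly (complex R)[n]}) (r : nat)
         (f : 'I_r -> {mpoly (complex R)[n]}) (l : 'I_r -> complex R)
         (Ex : de_L E) (F : 'I_r -> de_L E),
  [/\ h != 0, mcoprime g h, forall i, mirreducible (f i) & injective f] /\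
  [/\ Ex != 0 /\ (forall k, @de_d _ _ E k Ex
                   = Ex * @de_d _ _ E k (@de_iota _ _ E g / @de_iota _ _ E h)),
      (forall i, F i != 0 /\ (forall k, @de_d _ _ E k (F i)
                   = @de_iota _ _ E (l i)%:MP * F i * @de_d _ _ E k (@de_iota _ _ E (f i))
                     / @de_iota _ _ E (f i)))
    & J = Ex * \prod_(i < r) F i].

Definition jacobian_multiplier (R : realType) (n : nat) (E : diff_ext R n)
    (P : 'I_n -> {mpoly (complex R)[n]}) (J : de_L E) : Prop :=
  \sum_(k < n) @de_d _ _ E k (J * @de_iota _ _ E (P k)) = 0.

Definition has_darboux_jacobian_multiplier (R : realType) (n : nat)
    (P : 'I_n -> {mpoly (complex R)[n]}) : Prop :=
  exists (E : diff_ext R n) (J : de_L E),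
    darboux_function J /\ jacobian_multiplier P J.

(* Main.v *)
(** Write X for the vector field and P for its coefficients; assume P <> 0.
    The n-1 integrals lie in a Liouvillian tower, which embeds (Newton-Puiseux)
    into an iterated field of Laurent series k((z)) over an algebraic extension
    of C(x), with d_i z = a_i z^(m+1): z = t (m = 0) for an exponential t and
    z = 1/t (m = 1) for a primitive t.  There the 1-forms dH_j annihilate
    exactly the multiples of P.  More generally we consider 1-forms annihilating
    P that come in triangular families closed for a flat connection.  The
    property that such families annihilate only multiples of P passes from
    k((z)) to k: irregular parts of the connection can be gauged away, and the
    regular part is replaced by finitely many Laurent coefficients.  At the
    bottom the families form a flag of 1-forms stable under the Lie derivative
    along X, and the logarithmic derivative of its determinant, corrected by a
    closed form, is a closed 1-form u with u(P) = - div P.  A trace brings u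
    down to C(x), where a closed rational 1-form is dR plus a sum of l dlog f
    with constant l (Hermite reduction and constancy of residues).  Then
    exp(R) times the product of the f^l is the multiplier. *)

Require Import Defs.
From HB Require Import structures.
From mathcomp Require Import all_boot all_order all_algebra all_field.
From mathcomp Require Import boolp reals complex.
From mathcomp Require Import mpoly.
From mathcomp Require Import fraction ring zify.

Set Implicit Arguments.
Unset Strict Implicit.
Unset Printing Implicit Defensive.

Import GRing.Theory.
Local Open Scope ring_scope.

(** * Derivations and fraction fields *)

(** The obstacle is that the Laurent coefficients of a closed form over k((z)) are not closed over
    k: since d_i z = a_i z^(m+1), differentiation mixes the coefficients of degrees q and q - m.
    They are closed only for a triangular connection, and this is why the property that descends
    concerns families with a connection and not single closed forms. A connection with poles in z
    cannot be truncated to finitely many coefficients; its irregular diagonal entries must go first,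
    and they can because d - delta is bijective on Laurent series when delta has a pole. Algebraic
    steps of the tower would spoil the shape k((z)) of the field. Newton-Puiseux pushes each of them
    down to the coefficients at the price of z |-> z^e, so that only the bottom field grows
    algebraically and a single kind of descent remains above it. At the bottom only the trace of the
    Lie derivative on the span of the forms matters, and triangularity makes this trace the value at
    P of a closed form. *)

Definition derivation (R : comNzRingType) (d : R -> R) : Prop :=
  (forall x y, d (x + y) = d x + d y) /\ (forall x y, d (x * y) = d x * y + x * d y).

Section Derivation.
Variables (R : comNzRingType) (d : R -> R).
Hypothesis dP : derivation d.

Lemma derD x y : d (x + y) = d x + d y. Proof. by case: dP. Qed.
Lemma derM x y : d (x * y) = d x * y + x * d y. Proof. by case: dP. Qed.
Lemma der0 : d 0 = 0.
Proof. by apply: (addrI (d 0)); rewrite -derD !addr0. Qed.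
Lemma derN x : d (- x) = - d x.
Proof. by apply/eqP; rewrite -addr_eq0 -derD addNr der0. Qed.
Lemma derB x y : d (x - y) = d x - d y.
Proof. by rewrite derD derN. Qed.
Lemma der_sum I (r : seq I) (P : pred I) F :
  d (\sum_(i <- r | P i) F i) = \sum_(i <- r | P i) d (F i).
Proof. by apply: (big_morph d derD der0). Qed.
Lemma der1 : d 1 = 0.
Proof. by apply: (addrI (d 1)); rewrite addr0 -{3}[1]mulr1 derM mulr1 mul1r. Qed.
Lemma der_nat m : d m%:R = 0.
Proof. by elim: m => [|m IH]; rewrite ?der0 // -natr1 derD IH der1 addr0. Qed.
Lemma derX x m : d (x ^+ m.+1) = m.+1%:R * x ^+ m * d x.
Proof.
elim: m => [|m IH]; first by rewrite expr1 expr0 mul1r mul1r.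
by rewrite exprS derM IH [m.+2%:R]mulrSr [x ^+ m.+1]exprS; ring.
Qed.
Lemma der_mulrn x m : d (x *+ m) = d x *+ m.
Proof. by elim: m => [|m IH]; rewrite ?mulr0n ?der0 // !mulrS derD IH. Qed.
End Derivation.

Section DerivationField.
Variables (K : fieldType) (d : K -> K).
Hypothesis dP : derivation d.
Lemma derV x : d x^-1 = - d x / x ^+ 2.
Proof.
have [->|x0] := eqVneq x 0; first by rewrite invr0 (der0 dP) expr0n /= invr0 mulr0.
have := der1 dP; rewrite -(mulfV x0) (derM dP) => /eqP; rewrite addrC addr_eq0 => /eqP H.
by apply: (mulfI x0); rewrite H; field.
Qed.
Lemma der_div x y : d (x / y) = d x / y - x * d y / y ^+ 2.
Proof. by rewrite (derM dP) derV; ring. Qed.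
Lemma dlogM x y : x != 0 -> y != 0 -> d (x * y) / (x * y) = d x / x + d y / y.
Proof. by move=> x0 y0; rewrite (derM dP); field; rewrite x0 y0. Qed.
End DerivationField.

Lemma derivation_comm (R : comNzRingType) (d e : R -> R) :
  derivation d -> derivation e -> derivation (fun x => d (e x) - e (d x)).
Proof.
move=> dP eP; split=> x y; first by rewrite !(derD dP, derD eP); ring.
by rewrite !(derM dP, derM eP, derD dP, derD eP); ring.
Qed.

Lemma mk_rmorphism (R S : nzRingType) (f : R -> S) :
  (forall x y, f (x - y) = f x - f y) -> (forall x y, f (x * y) = f x * f y) -> f 1 = 1 ->
  {F : {rmorphism R -> S} | F =1 f}.
Proof.
move=> fB fM f1.
pose F : {rmorphism R -> S} := HB.pack f (GRing.isZmodMorphism.Build R S f fB)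
  (GRing.isMonoidMorphism.Build R S f (conj f1 fM)).
by exists F.
Qed.

Section FieldIdentities.
Variable K : fieldType.
Implicit Types a b c n q : K.
Lemma frac_cross a b n q : b != 0 -> q != 0 -> a / b = n / q -> a * q = n * b.
Proof. by move=> b0 q0 e; rewrite -[a](divfK b0) e; field. Qed.
Lemma frac_sum a b c q : b != 0 -> q != 0 -> a / b + c / q = (a * q + c * b) / (b * q).
Proof. by move=> b0 q0; field; rewrite b0 q0. Qed.
Lemma frac_dif a b c q : b != 0 -> q != 0 -> a / b - c / q = (a * q - c * b) / (b * q).
Proof. by move=> b0 q0; field; rewrite b0 q0. Qed.
Lemma frac_prod a b c q : b != 0 -> q != 0 -> a / b * (c / q) = (a * c) / (b * q).
Proof. by move=> b0 q0; field; rewrite b0 q0. Qed.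
Lemma frac_der_eq a b n q a' b' n' q' : b != 0 -> q != 0 -> a * q = n * b ->
  a' * q + a * q' = n' * b + n * b' ->
  n' / q - n * q' / q ^+ 2 = a' / b - a * b' / b ^+ 2.
Proof.
move=> b0 q0 e1 e2.
have -> : a' = (n' * b + n * b' - a * q') / q by rewrite -e2 addrK mulfK.
have -> : a = n * b / q by rewrite -e1 mulfK.
by field; rewrite b0 q0.
Qed.
Lemma frac_der_sum a b c q a' b' c' q' : b != 0 -> q != 0 ->
  (a' * q + a * q' + (c' * b + c * b')) / (b * q) - (a * q + c * b) * (b' * q + b * q') / (b * q) ^+ 2
  = a' / b - a * b' / b ^+ 2 + (c' / q - c * q' / q ^+ 2).
Proof. by move=> b0 q0; field; rewrite b0 q0. Qed.
Lemma frac_der_prod a b c q a' b' c' q' : b != 0 -> q != 0 ->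
  (a' * c + a * c') / (b * q) - a * c * (b' * q + b * q') / (b * q) ^+ 2
  = (a' / b - a * b' / b ^+ 2) * (c / q) + a / b * (c' / q - c * q' / q ^+ 2).
Proof. by move=> b0 q0; field; rewrite b0 q0. Qed.
End FieldIdentities.

Section Fractions.
Variable R : idomainType.
Notation F := {fraction R}.
Notation fr := (@tofrac R).

Lemma frac_ex (x : F) : exists ab : R * R, ab.2 != 0 /\ x = fr ab.1 / fr ab.2.
Proof.
elim/quotW: x => r; exists (\n_r, \d_r) => /=.
have r0 : \d_r != 0 by rewrite denom_ratioP.
split=> //; apply: (canRL (mulfK _)); first by rewrite tofrac_eq0.
apply/eqP; rewrite /GRing.mul /= !piE FracField.equivfE.
by rewrite /FracField.mulf !numden_Ratio ?mulf_neq0 ?oner_eq0 ?mulr1 //= mulrC.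
Qed.
Definition fnum (x : F) := (projT1 (cid (frac_ex x))).1.
Definition fden (x : F) := (projT1 (cid (frac_ex x))).2.
Lemma fden_neq0 x : fden x != 0.
Proof. by rewrite /fden; case: cid => ? []. Qed.
Lemma fracE x : x = fr (fnum x) / fr (fden x).
Proof. by rewrite /fden /fnum; case: cid => ? []. Qed.
Lemma fr0 a : a != 0 -> fr a != 0. Proof. by rewrite tofrac_eq0. Qed.
Lemma frac_ind (Q : F -> Prop) :
  (forall a b, b != 0 -> Q (fr a / fr b)) -> forall x, Q x.
Proof. by move=> H x; rewrite (fracE x); apply: H; apply: fden_neq0. Qed.

(** The quotient rule on one chosen representative; [fderE] removes the dependence on the choice. *)
Definition fder (d : R -> R) (x : F) : F :=
  fr (d (fnum x)) / fr (fden x) - fr (fnum x) * fr (d (fden x)) / fr (fden x) ^+ 2.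

Section Der.
Variables (d : R -> R) (dP : derivation d).
Lemma fderE a b : b != 0 ->
  fder d (fr a / fr b) = fr (d a) / fr b - fr a * fr (d b) / fr b ^+ 2.
Proof.
move=> b0; set x := fr a / fr b; rewrite /fder.
have q0 := fden_neq0 x; move: (fracE x); rewrite {1}/x.
move: (fnum x) (fden x) q0 => n q q0 /(frac_cross (fr0 b0) (fr0 q0)) e.
apply: frac_der_eq => //; try exact: fr0.
have /eqP : a * q = n * b by apply/eqP; rewrite -tofrac_eq !tofracM e.
by rewrite -!tofracM -!tofracD -!(derM dP) => /eqP ->.
Qed.
Lemma fder_tofrac a : fder d (fr a) = fr (d a).
Proof.
have := fderE a (oner_neq0 R); rewrite (der1 dP) tofrac0 mulr0 mul0r subr0.
by rewrite tofrac1 !divr1.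
Qed.
Lemma fderP : derivation (fder d).
Proof.
split; apply: frac_ind => a b b0; apply: frac_ind => a' b' b'0;
  have [B0 B'0] := (fr0 b0, fr0 b'0); have bb : b * b' != 0 by rewrite mulf_neq0.
  rewrite (frac_sum _ _ B0 B'0) -!tofracM -tofracD !fderE // !(derM dP, derD dP).
  by rewrite !tofracD !tofracM frac_der_sum.
rewrite (frac_prod _ _ B0 B'0) -!tofracM !fderE // !(derM dP, derD dP).
by rewrite !tofracD !tofracM frac_der_prod.
Qed.
End Der.

Lemma derivation_frac_eq (K : fieldType) (h : {rmorphism F -> K})
    (d : R -> R) (e : K -> K) : derivation d -> derivation e ->
  (forall a, e (h (fr a)) = h (fr (d a))) -> forall x, e (h x) = h (fder d x).
Proof.
move=> dP eP H; apply: frac_ind => a b b0; rewrite fderE //.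
by rewrite rmorphB !fmorph_div rmorphXn !(rmorphM h) -!H (der_div eP).
Qed.

(** The commutator of two derivations is a derivation, so it vanishes on fractions once it vanishes
    on numerators and denominators. *)
Lemma fder_comm (d e : R -> R) : derivation d -> derivation e ->
  (forall a, d (e a) = e (d a)) -> forall x, fder d (fder e x) = fder e (fder d x).
Proof.
move=> dP eP H; have [DP EP] := (fderP dP, fderP eP).
apply: frac_ind => a b b0; apply/eqP; rewrite -subr_eq0.
have cP := derivation_comm DP EP.
have c0 c : fder d (fder e (fr c)) - fder e (fder d (fr c)) = 0.
  by rewrite !(fder_tofrac dP, fder_tofrac eP) H subrr.
by rewrite (der_div cP) !c0 mulr0 !mul0r subrr.
Qed.

Lemma frac_lift (K : fieldType) (f : {rmorphism R -> K}) : injective f ->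
  {G : {rmorphism F -> K} | forall a, G (fr a) = f a}.
Proof.
move=> fI; have f0 a : a != 0 -> f a != 0.
  by move=> a0; apply: contraNneq a0; rewrite -(rmorph0 f) => /fI ->.
pose g (x : F) := f (fnum x) / f (fden x).
have gE a b : b != 0 -> g (fr a / fr b) = f a / f b.
  move=> b0; set x := fr a / fr b; rewrite /g.
  have q0 := fden_neq0 x; move: (fracE x); rewrite {1}/x.
  move: (fnum x) (fden x) q0 => n q q0 /(frac_cross (fr0 b0) (fr0 q0)) e.
  have e1 : a * q = n * b by apply/eqP; rewrite -tofrac_eq !tofracM e.
  by apply/eqP; rewrite eq_sym eqr_div ?f0 // -!rmorphM e1.
have gB x y : g (x - y) = g x - g y.
  move: x y; apply: frac_ind => a b b0; apply: frac_ind => a' b' b'0.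
  have [B0 B'0] := (fr0 b0, fr0 b'0); have bb : b * b' != 0 by rewrite mulf_neq0.
  rewrite (frac_dif _ _ B0 B'0) -!tofracM -tofracB !gE // rmorphB !rmorphM.
  by rewrite frac_dif ?f0.
have gM x y : g (x * y) = g x * g y.
  move: x y; apply: frac_ind => a b b0; apply: frac_ind => a' b' b'0.
  have [B0 B'0] := (fr0 b0, fr0 b'0); have bb : b * b' != 0 by rewrite mulf_neq0.
  by rewrite (frac_prod _ _ B0 B'0) -!tofracM !gE // !rmorphM frac_prod ?f0.
have g1 a : g (fr a) = f a.
  by have := gE a _ (oner_neq0 R); rewrite tofrac1 rmorph1 !divr1.
have g11 : g 1 = 1 by rewrite -tofrac1 g1 rmorph1.
have [G GE] := mk_rmorphism gB gM g11.
by exists G => a; rewrite GE g1.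
Qed.
End Fractions.

(** * Power series and Laurent series *)

Record pser (k : Type) := PSer { pco :> nat -> k }.

HB.instance Definition _ k := gen_eqMixin (pser k).
HB.instance Definition _ k := gen_choiceMixin (pser k).

Lemma pserP k (f g : pser k) : f =1 g -> f = g.
Proof. by case: f g => f [g] /= /funext ->. Qed.

Section PowerSeries.
Variable k : fieldType.
Implicit Types f g h : pser k.

Definition ps0 := PSer (fun=> 0 : k).
Definition ps_add f g := PSer (fun i => f i + g i).
Definition ps_opp f := PSer (fun i => - f i).
Definition psC (c : k) := PSer (fun i => if i == 0%N then c else 0).
Definition ps_mul f g := PSer (fun q => \sum_(i < q.+1) f i * g (q - i)%N).

Lemma ps_addA : associative ps_add.
Proof. by move=> f g h; apply: pserP => i /=; rewrite addrA. Qed.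
Lemma ps_addC : commutative ps_add.
Proof. by move=> f g; apply: pserP => i /=; rewrite addrC. Qed.
Lemma ps_add0 : left_id ps0 ps_add.
Proof. by move=> f; apply: pserP => i /=; rewrite add0r. Qed.
Lemma ps_addN : left_inverse ps0 ps_opp ps_add.
Proof. by move=> f; apply: pserP => i /=; rewrite addNr. Qed.
HB.instance Definition _ :=
  GRing.isZmodule.Build (pser k) ps_addA ps_addC ps_add0 ps_addN.

Definition ps_trunc N f : {poly k} := \poly_(i < N.+1) f i.
(** Lets associativity and commutativity be inherited from polynomials, degree by degree. *)
Lemma ps_mul_trunc N f g q : (q <= N)%N ->
  ps_mul f g q = (ps_trunc N f * ps_trunc N g)`_q.
Proof.
move=> qN; rewrite coefM /=; apply: eq_bigr => -[i /= iq] _.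
by rewrite !coef_poly !ltnS (leq_trans (leq_subr _ _) qN) (leq_trans _ qN).
Qed.
Lemma ps_mulA : associative ps_mul.
Proof.
move=> f g h; apply: pserP => q; rewrite !(@ps_mul_trunc q) //.
have E u v : ps_trunc q (ps_mul u v) = ps_trunc q (PSer (fun i => (ps_trunc q u * ps_trunc q v)`_i)).
  by apply/polyP => i; rewrite !coef_poly; case: ltnP => // iq; rewrite (@ps_mul_trunc q).
have E2 u (p : {poly k}) : (ps_trunc q u * ps_trunc q (PSer (fun i => p`_i)))`_q = (ps_trunc q u * p)`_q.
  rewrite !coefM; apply: eq_bigr => -[i /= iq] _; congr (_ * _).
  by rewrite !coef_poly ltnS leq_subr.
have E3 u (p : {poly k}) : (ps_trunc q (PSer (fun i => p`_i)) * ps_trunc q u)`_q = (p * ps_trunc q u)`_q.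
  by rewrite ![_ * ps_trunc q u]mulrC E2.
by rewrite !E E2 E3 mulrA.
Qed.
Lemma ps_mulC : commutative ps_mul.
Proof. by move=> f g; apply: pserP => q; rewrite !(@ps_mul_trunc q) // mulrC. Qed.
Lemma ps_mul1 : left_id (psC 1) ps_mul.
Proof.
move=> f; apply: pserP => q /=; rewrite big_ord_recl /= mul1r subn0 big1 ?addr0 // => i _.
by rewrite mul0r.
Qed.
Lemma ps_mulDl : left_distributive ps_mul ps_add.
Proof.
move=> f g h; apply: pserP => q /=; rewrite -big_split /=; apply: eq_bigr => i _.
by rewrite mulrDl.
Qed.
Lemma ps_1neq0 : psC 1 != 0.
Proof. by apply/eqP => /(congr1 (fun f : pser k => f 0%N)) /= /eqP; rewrite oner_eq0. Qed.
HB.instance Definition _ :=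
  GRing.Zmodule_isComNzRing.Build (pser k) ps_mulA ps_mulC ps_mul1 ps_mulDl ps_1neq0.

Lemma psD f g i : (f + g) i = f i + g i. Proof. by []. Qed.
Lemma psB f g i : (f - g) i = f i - g i. Proof. by []. Qed.
Lemma ps0E i : (0 : pser k) i = 0. Proof. by []. Qed.
Lemma psM f g q : (f * g) q = \sum_(i < q.+1) f i * g (q - i)%N. Proof. by []. Qed.
Lemma ps1E i : (1 : pser k) i = (i == 0%N)%:R. Proof. by rewrite /=; case: eqP. Qed.
Lemma ps_sum (I : Type) (r : seq I) (P : pred I) (F : I -> pser k) i :
  (\sum_(j <- r | P j) F j) i = \sum_(j <- r | P j) F j i.
Proof. by elim/big_rec2: _ => [|j x y _ <-]; rewrite ?psD. Qed.
Lemma psM0 f g : (f * g) 0%N = f 0%N * g 0%N.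
Proof. by rewrite psM big_ord1. Qed.
Lemma psCM c f i : (psC c * f) i = c * f i.
Proof.
rewrite psM big_ord_recl /= subn0 big1 ?addr0 // => j _.
by rewrite mul0r.
Qed.

(* [T] is contracting for the z-adic topology: the coefficient of z^q in [T u]
   only involves the coefficients of lower degree of [u]. *)
Lemma ps_fixpoint (J : Type) (T : (J -> pser k) -> J -> pser k) :
  (forall q (u v : J -> pser k), (forall j i, (i < q)%N -> u j i = v j i) -> forall j, T u j q = T v j q) ->
  exists u, forall j, T u j = u j.
Proof.
move=> HT; pose z (_ : J) : pser k := 0.
have H q : forall M N j, (q < M)%N -> (q < N)%N -> iter M T z j q = iter N T z j q.
  elim/ltn_ind: q => q IH [//|M] [//|N] j; rewrite !ltnS => qM qN /=.
  apply: HT => j' i iq; apply: IH => //; exact: leq_trans qM || exact: leq_trans qN.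
(* Diagonal limit: the coefficient of degree q is stable from iterate q + 1 on. *)
exists (fun j => PSer (fun q => iter q.+1 T z j q)) => j; apply: pserP => q /=.
apply: HT => j' i iq; exact: (H i i.+1 q j' (ltnSn i) iq).
Qed.

Lemma ps_inv_ex f : f 0%N != 0 -> exists g, g * f = 1.
Proof.
move=> f0.
pose T (u : unit -> pser k) (_ : unit) := PSer (fun q =>
  ((q == 0%N)%:R - \sum_(i < q) f i.+1 * u tt (q - i.+1)%N) / f 0%N).
have [|u uE] := @ps_fixpoint _ T.
  move=> q u v H j /=; congr ((_ - _) / _); apply: eq_bigr => -[i /= iq] _.
  by rewrite H // ltn_subrL; case: (q) iq.
exists (u tt); rewrite mulrC; apply: pserP => q.
rewrite psM ps1E big_ord_recl /= subn0 -{1}(uE tt) /= mulrC divfK //.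
by rewrite subrK.
Qed.
Definition ps_unit f := f 0%N != 0.
Definition ps_inv f := if pselect (exists g, g * f = 1) is left H then projT1 (cid H) else f.
Lemma ps_mulV : {in ps_unit, left_inverse 1 ps_inv *%R}.
Proof.
move=> f; rewrite unfold_in => /ps_inv_ex H; rewrite /ps_inv.
by case: pselect => // H'; case: cid.
Qed.
Lemma ps_unitP : forall f g, g * f = 1 -> f \in ps_unit.
Proof.
move=> f g /(congr1 (fun h : pser k => h 0%N)); rewrite psM0 ps1E /= => H.
by rewrite unfold_in; apply: contra_eq_neq H => ->; rewrite mulr0 eq_sym oner_eq0.
Qed.
Lemma ps_inv_out : {in [predC ps_unit], ps_inv =1 id}.
Proof.
move=> f /=; rewrite inE => H; rewrite /ps_inv; case: pselect => // -[g Hg].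
by move: H; rewrite (ps_unitP Hg).
Qed.
HB.instance Definition _ :=
  GRing.ComNzRing_hasMulInverse.Build (pser k) ps_mulV ps_unitP ps_inv_out.

Definition psX : pser k := PSer (fun i => (i == 1%N)%:R).
Definition ps_shift (m : nat) f := PSer (fun i => if (m <= i)%N then f (i - m)%N else 0).
Lemma psX1 f i : (psX * f) i = if i is j.+1 then f j else 0.
Proof.
rewrite psM; case: i => [|i]; first by rewrite big_ord1 /= mul0r.
rewrite !big_ord_recl /= mul0r add0r mul1r subSS subn0 big1 ?addr0 // => j _.
by rewrite mul0r.
Qed.
Lemma psXn m f : psX ^+ m * f = ps_shift m f.
Proof.
elim: m f => [|m IH] f; first by rewrite expr0 mul1r; apply: pserP => i; rewrite /= subn0.
rewrite exprS -mulrA IH; apply: pserP => -[|i]; rewrite psX1 //=.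
Qed.
Lemma psXnE m f i : (psX ^+ m * f) i = if (m <= i)%N then f (i - m)%N else 0.
Proof. by rewrite psXn. Qed.

Lemma ps_order f : f != 0 -> exists m u, f = psX ^+ m * u /\ u 0%N != 0.
Proof.
move=> f0; have : exists i, f i != 0.
  apply: contrapT => H; move/eqP: f0; apply; apply: pserP => i; rewrite ps0E.
  by apply: contrapT => /eqP Hi; apply: H; exists i.
case/ex_minnP => m fm minm; exists m, (PSer (fun i => f (i + m)%N)); split; last by rewrite /= add0n.
apply: pserP => i; rewrite psXnE /=; case: leqP => [mi|im]; first by rewrite subnK.
by apply: contraTeq im => /minm; rewrite leqNgt.
Qed.
Lemma ps_integral : forall f g, f * g = 0 -> (f == 0) || (g == 0).
Proof.
move=> f g fg; case: (eqVneq f 0) => //= f0; case: (eqVneq g 0) => // g0.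
have [m [u [Ef u0]]] := ps_order f0; have [p [v [Eg v0]]] := ps_order g0.
move: fg; rewrite Ef Eg mulrACA -exprD => /(congr1 (fun h : pser k => h (m + p)%N)).
rewrite psXnE leqnn subnn psM0 ps0E => /eqP.
by rewrite mulf_eq0 (negPf u0) (negPf v0).
Qed.
HB.instance Definition _ := GRing.ComUnitRing_isIntegral.Build (pser k) ps_integral.

Lemma psX_neq0 : psX != 0.
Proof. by apply/eqP => /(congr1 (fun f : pser k => f 1%N)) /eqP; rewrite /= oner_eq0. Qed.

Lemma psC_sub a b : psC (a - b) = psC a - psC b.
Proof. by apply: pserP => i; rewrite psB /=; case: eqP; rewrite ?subr0. Qed.
Lemma psC_mul a b : psC (a * b) = psC a * psC b.
Proof. by apply: pserP => i; rewrite psCM /=; case: eqP; rewrite ?mulr0. Qed.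
HB.instance Definition _ := GRing.isZmodMorphism.Build k (pser k) psC psC_sub.
HB.instance Definition _ := GRing.isMonoidMorphism.Build k (pser k) psC
  (conj (erefl : psC 1 = 1) psC_mul).
Lemma psC_inj : injective psC.
Proof. by move=> a b /(congr1 (fun f : pser k => f 0%N)). Qed.

Section Derivations.
Variable d : k -> k.
Hypothesis dP : derivation d.
Definition ps_map f := PSer (fun i => d (f i)).
Lemma ps_mapP : derivation ps_map.
Proof.
split=> f g; apply: pserP => q; rewrite psD /= ?(derD dP) // (der_sum dP).
rewrite -big_split /=; apply: eq_bigr => i _; exact: derM.
Qed.
Lemma ps_mapC c : ps_map (psC c) = psC (d c).
Proof. by apply: pserP => i /=; case: eqP; rewrite ?(der0 dP). Qed.
Definition ps_euler f := PSer (fun i => i%:R * f i).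
Lemma ps_eulerP : derivation ps_euler.
Proof.
split=> f g; apply: pserP => q; rewrite psD /= ?mulrDr // mulr_sumr.
rewrite -big_split /=; apply: eq_bigr => -[i /= iq] _.
have -> : q%:R = i%:R + (q - i)%:R :> k by rewrite -natrD subnKC.
by ring.
Qed.
Lemma ps_eulerC c : ps_euler (psC c) = 0.
Proof. by apply: pserP => -[|i] /=; rewrite ?mul0r ?mulr0. Qed.
Lemma ps_eulerX m : ps_euler (psX ^+ m) = m%:R * psX ^+ m.
Proof.
have E : ps_euler psX = psX.
  by apply: pserP => -[|[|i]] /=; rewrite ?mul0r ?mulr1 ?mulr0.
case: m => [|m]; first by rewrite expr0 (der1 ps_eulerP) mul0r.
by rewrite (derX ps_eulerP) E exprSr mulrA.
Qed.

Variables (a : k) (m : nat).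
(* The derivation extending [d] with z |-> a z^(m+1). *)
Definition dps f := ps_map f + psC a * psX ^+ m * ps_euler f.
Lemma dpsP : derivation dps.
Proof.
split=> f g; rewrite /dps ?(derD ps_mapP, derD ps_eulerP) ?(derM ps_mapP, derM ps_eulerP); ring.
Qed.
Lemma dpsE f q : dps f q = d (f q) + (if (m <= q)%N then (q - m)%:R * a * f (q - m)%N else 0).
Proof.
rewrite /dps psD -mulrA psCM psXnE; congr (_ + _).
by case: ifP; rewrite ?mulr0 //= => _; ring.
Qed.
Lemma dpsC c : dps (psC c) = psC (d c).
Proof. by rewrite /dps ps_mapC ps_eulerC mulr0 addr0. Qed.
Lemma dpsX : dps psX = psC a * psX ^+ m.+1.
Proof.
rewrite /dps -[X in ps_euler X]expr1 ps_eulerX expr1 mul1r.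
rewrite [ps_map _](_ : _ = 0) ?add0r ?exprSr ?mulrA //.
by apply: pserP => i /=; case: (i == 1%N); rewrite ?(der0 dP) ?(der1 dP).
Qed.
End Derivations.

(** On z the commutator is (d b - e a) z^(m+1), the terms in a b cancelling; so commutation amounts
    to closedness of the form with entries a, b. *)
Lemma dps_comm (d e : k -> k) (a b : k) m : derivation d -> derivation e ->
  (forall x, d (e x) = e (d x)) -> d b = e a ->
  forall f, dps d a m (dps e b m f) = dps e b m (dps d a m f).
Proof.
move=> dP eP H E f.
have mm : ps_map d (ps_map e f) = ps_map e (ps_map d f) by apply: pserP => i /=; rewrite H.
have ME d' : derivation d' -> ps_map d' (ps_euler f) = ps_euler (ps_map d' f).
  by move=> d'P; apply: pserP => i /=; rewrite (derM d'P) (der_nat d'P) mul0r add0r.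
have MX d' : derivation d' -> ps_map d' (psX ^+ m) = 0.
  move=> d'P; rewrite -[_ ^+ m]mulr1 psXn; apply: pserP => i /=.
  by case: ifP => _; rewrite ?(der0 d'P) //; case: ifP => _; rewrite ?(der0 d'P) ?(der1 d'P).
rewrite /dps !(derD (ps_mapP dP), derD (ps_mapP eP), derD ps_eulerP).
rewrite !(derM (ps_mapP dP), derM (ps_mapP eP), derM ps_eulerP).
by rewrite mm !ME // !MX // !ps_mapC // !ps_eulerC !ps_eulerX E; ring.
Qed.
End PowerSeries.
Arguments ps_mul : simpl never.
Arguments ps_add : simpl never.
Arguments ps_opp : simpl never.
Arguments dps : simpl never.

Section MonomialIdentities.
Variable K : fieldType.
Lemma frac_der_monomial (x x' c w : K) : w != 0 -> x' / w - x * (c * w) / w ^+ 2 = (x' - c * x) / w.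
Proof. by move=> w0; field. Qed.
Lemma dlog_inv_monomial (c w : K) : w != 0 -> - (c * w) / w ^+ 2 / w^-1 = - c.
Proof. by move=> w0; rewrite invrK !mulNr expr2 invfM !mulrA mulfK // divfK. Qed.
End MonomialIdentities.

(** * Laurent series: valuation ring and derivations *)

Section LaurentField.
Variable k : fieldType.
Notation L := {fraction (pser k)}.
Notation fr := (@tofrac (pser k)).
Notation zz := (fr (psX k)).
Implicit Types (x y h : L) (f g u : pser k).

Lemma zz_neq0 : zz != 0. Proof. by rewrite tofrac_eq0 psX_neq0. Qed.
Lemma zzX_neq0 N : zz ^+ N != 0. Proof. by rewrite expf_neq0 // zz_neq0. Qed.
Lemma fr_inj : injective fr.
Proof. by move=> a b /eqP; rewrite tofrac_eq => /eqP. Qed.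

(* The valuation ring k[[z]] of L. *)
Definition integral x : Prop := exists f, x = fr f.
Lemma integralD x y : integral x -> integral y -> integral (x + y).
Proof. by move=> [f ->] [g ->]; exists (f + g); rewrite tofracD. Qed.
Lemma integralN x : integral x -> integral (- x).
Proof. by move=> [f ->]; exists (- f); rewrite tofracN. Qed.
Lemma integralB x y : integral x -> integral y -> integral (x - y).
Proof. by move=> ix iy; apply: integralD => //; apply: integralN. Qed.
Lemma integralM x y : integral x -> integral y -> integral (x * y).
Proof. by move=> [f ->] [g ->]; exists (f * g); rewrite tofracM. Qed.
Lemma integral0 : integral 0. Proof. by exists 0; rewrite tofrac0. Qed.
Lemma integral_fr f : integral (fr f). Proof. by exists f. Qed.
Lemma integral_zz N : integral (zz ^+ N). Proof. by exists (psX k ^+ N); rewrite tofracXn. Qed.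

Lemma fr_unit u : u 0%N != 0 -> (fr u)^-1 = fr u^-1.
Proof.
move=> u0; have uu : u \is a GRing.unit by [].
have U0 : fr u != 0 by rewrite tofrac_eq0; apply: contraTneq uu => ->; rewrite unitr0.
by apply: (mulfI U0); rewrite mulfV // -tofracM mulrV.
Qed.

Lemma laur_dec x : exists N f, x = fr f / zz ^+ N.
Proof.
elim/frac_ind: x => a b b0; have [N [u [-> u0]]] := ps_order b0.
exists N, (a * u^-1); rewrite !tofracM tofracXn invfM fr_unit //.
by rewrite mulrAC mulrA.
Qed.
Lemma laur_order x : x != 0 -> exists (v : int) u, x = zz ^ v * fr u /\ u 0%N != 0.
Proof.
have [N [f ->]] := laur_dec x; move=> x0.
have f0 : f != 0 by apply: contraNneq x0 => ->; rewrite tofrac0 mul0r.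
have [M [u [-> u0]]] := ps_order f0; exists (M%:Z - N%:Z), u; split=> //.
by rewrite expfzDr ?zz_neq0 // -exprnN -exprnP tofracM tofracXn mulrAC.
Qed.
Lemma integral_clear x : exists N, forall M, (N <= M)%N -> integral (zz ^+ M * x).
Proof.
have [N [f ->]] := laur_dec x; exists N => M NM.
exists (psX k ^+ (M - N) * f); rewrite tofracM tofracXn -{1}(subnK NM) exprD.
by rewrite mulrACA mulfV ?zzX_neq0 // mulr1.
Qed.
(** The factor z gained here is what makes delta^-1 D contracting in [irregular_surj]. *)
Lemma nonintegral_inv x : ~ integral x -> exists g, x^-1 = zz * fr g.
Proof.
move=> Hx; have x0 : x != 0 by apply: contra_notN Hx => /eqP ->; apply: integral0.
have [[v|v] [u [E u0]]] := laur_order x0.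
  by case: Hx; rewrite E; apply: integralM (integral_zz _) (integral_fr _).
exists (psX k ^+ v * u^-1); rewrite E NegzE -exprnN invfM invrK fr_unit //.
by rewrite exprS tofracM tofracXn mulrA.
Qed.

Variables (d : k -> k) (a : k) (m : nat).
Hypothesis dP : derivation d.
Notation dp := (dps d a m).
Notation D := (fder dp).
Let dpP : derivation dp := dpsP dP a m.
Let DP : derivation D := fderP dpP.

Lemma D_fr f : D (fr f) = fr (dp f). Proof. exact: fder_tofrac. Qed.
Definition dlogz := fr (psC a * psX k ^+ m).
Lemma D_zz : D zz = dlogz * zz.
Proof. by rewrite D_fr (dpsX dP) exprSr mulrA tofracM. Qed.
Lemma D_zzX N : D (zz ^+ N) = N%:R * dlogz * zz ^+ N.
Proof.
case: N => [|N]; first by rewrite expr0 (der1 DP) !mul0r.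
rewrite (derX DP) D_zz exprS -!mulrA; congr (_ * _); rewrite mulrCA; congr (_ * _).
exact: mulrC.
Qed.
Lemma integral_dlogz : integral dlogz. Proof. exact: integral_fr. Qed.
Lemma integral_nat N : integral N%:R.
Proof. by exists N%:R; rewrite rmorph_nat. Qed.

Lemma D_zzM N x : D (x / zz ^+ N) = (D x - N%:R * dlogz * x) / zz ^+ N.
Proof.
by rewrite (der_div DP) D_zzX frac_der_monomial ?zzX_neq0.
Qed.
Lemma D_zzz (v : int) : D (zz ^ v) / zz ^ v = v%:~R * dlogz.
Proof.
case: v => N; first by rewrite -exprnP D_zzX mulfK ?zzX_neq0 // pmulrn.
rewrite NegzE -exprnN (derV DP) D_zzX dlog_inv_monomial ?zzX_neq0 //.
by rewrite mulrNz mulNr pmulrn.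
Qed.
(** For h = z^v u with u a unit, D h / h is v [dlogz] plus D u / u, and D preserves k[[z]]. *)
Lemma integral_dlog h : h != 0 -> integral (D h / h).
Proof.
move=> /laur_order [v [u [-> u0]]].
have U0 : fr u != 0.
  rewrite tofrac_eq0; apply: contraNneq u0 => ->; exact: eqxx.
rewrite (dlogM DP) ?expfz_neq0 ?zz_neq0 // D_zzz D_fr fr_unit //.
apply: integralD; last by apply: integralM; apply: integral_fr.
apply: integralM integral_dlogz; case: v => N; rewrite ?NegzE ?mulrNz -?pmulrn.
  exact: integral_nat.
by apply: integralN; exact: integral_nat.
Qed.

(* For [delta] with a pole the operator D - delta is bijective on Laurent series,
   being - delta (1 - delta^-1 D) with delta^-1 D contracting. *)
Lemma irregular_inj delta h : ~ integral delta -> D h = delta * h -> h = 0.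
Proof.
move=> Hd E; apply/eqP; apply: contra_notT Hd => h0.
by have := integral_dlog h0; rewrite E mulfK.
Qed.
Lemma irregular_surj delta nu : ~ integral delta -> exists h, D h - delta * h = nu.
Proof.
move=> Hd; have [g Eg] := nonintegral_inv Hd; have [N [f Ef]] := laur_dec nu.
have d0 : delta != 0 by apply: contra_notN Hd => /eqP ->; apply: integral0.
(* With nu = f / z^N, delta^-1 = z g and h = u / z^N, the equation h = delta^-1 (D h - nu) becomes u
   = T u. *)
pose T (u : unit -> pser k) (_ : unit) :=
  psX k * (g * (dp (u tt) - N%:R * (psC a * psX k ^+ m) * u tt - f)).
have [|u uE] := @ps_fixpoint _ _ T.
  move=> q u v H []; rewrite /T !psX1; case: q H => // q H.
  rewrite !psM; apply: eq_bigr => i _; congr (_ * _); have := ltn_ord i; rewrite ltnS => iq.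
  have agr j : (j <= q)%N -> u tt j = v tt j by move=> jq; apply: H.
  have qiq : (q - i <= q)%N by rewrite leq_subr.
  rewrite !psB; congr (_ - _ - _).
    rewrite !dpsE // agr //; congr (_ + _); case: ifP => // _.
    by rewrite agr // (leq_trans (leq_subr _ _)).
  rewrite !psM; apply: eq_bigr => l _; congr (_ * _); have := ltn_ord l; rewrite ltnS => lq.
  by apply: agr; rewrite (leq_trans (leq_subr _ _)).
exists (fr (u tt) / zz ^+ N); set h := _ / _.
have Eh : h = delta^-1 * (D h - nu).
  rewrite Eg Ef {2}/h D_zzM D_fr -mulrBl mulrA /h; congr (_ / _).
  have -> : N%:R * dlogz * fr (u tt) = fr (N%:R * (psC a * psX k ^+ m) * u tt).
    by rewrite /dlogz !tofracM rmorph_nat.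
  by rewrite -!tofracB -!tofracM -{1}(uE tt) /T mulrA.
by rewrite {2}Eh mulrA mulfV // mul1r opprB addrC subrK.
Qed.
End LaurentField.

(** * Families of 1-forms closed for a triangular flat connection *)

Section ConnectionData.
Variables (K : fieldType) (n : nat) (d : 'I_n -> K -> K) (P : 'I_n -> K).
Hypothesis dP : forall i, derivation (d i).
Hypothesis dC : forall i j x, d i (d j x) = d j (d i x).

Definition cov (I : finType) (A : 'I_n -> I -> I -> K) i (v : I -> K) b : K :=
  d i (v b) - \sum_c A i b c * v c.

(* The row [b] of [w] is the 1-form (w_i b)_i.  The connection d - A is flat, the
   vector of forms [w] is closed for it, and every row annihilates the vector [P].
   The first integrals give A = 0 and w = dH. *)
Record conn_data (I : finType) (rk : I -> nat) (A : 'I_n -> I -> I -> K) (w : 'I_n -> I -> K) : Prop :=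
  ConnData {
  cd_tri : forall i b c, b != c -> (rk b <= rk c)%N -> A i b c = 0;
  cd_flat : forall i j v b, cov A i (cov A j v) b = cov A j (cov A i v) b;
  cd_tors : forall i j b, cov A i (w j) b = cov A j (w i) b;
  cd_W : forall b, \sum_j P j * w j b = 0 }.

Definition killed (I : finType) (w : 'I_n -> I -> K) (v : 'I_n -> K) : Prop :=
  forall b, \sum_j w j b * v j = 0.

(** Dually, the rows of all these families span the annihilator of [P]; the formulation by common
    kernels avoids choosing a basis. *)
Definition solvable_forms_span : Prop := forall v : 'I_n -> K,
  (forall (I : finType) (rk : I -> nat) A w, conn_data rk A w -> killed w v) ->
  exists c, forall j, v j = c * P j.

Section Basic.
Variables (I : finType) (rk : I -> nat) (A : 'I_n -> I -> I -> K) (w : 'I_n -> I -> K).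
Lemma cov_ext i u v b : u =1 v -> cov A i u b = cov A i v b.
Proof. by move=> E; rewrite /cov E; congr (_ - _); apply: eq_bigr => c _; rewrite E. Qed.
Lemma covB i u v b : cov A i (fun x => u x - v x) b = cov A i u b - cov A i v b.
Proof.
rewrite /cov (derB (dP i)); under eq_bigr => c _ do rewrite mulrBr.
by rewrite sumrB; ring.
Qed.
Hypothesis H : conn_data rk A w.

(** Flatness tested on the constant basis vector at [c], whose derivatives vanish. *)
Lemma flat_entry i j b c :
  d i (A j b c) - d j (A i b c) = \sum_e (A i b e * A j e c - A j b e * A i e c).
Proof.
have E k e : cov A k (fun x => (x == c)%:R) e = - A k e c.
  rewrite /cov (der_nat (dP k)) sub0r (bigD1 c) //= eqxx mulr1 big1 ?addr0 // => f /negPf ->.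
  by rewrite mulr0.
have := cd_flat H i j (fun x => (x == c)%:R) b.
rewrite (cov_ext _ _ (E j)) (cov_ext _ _ (E i)) /cov !(derN (dP _)).
under eq_bigr => e _ do rewrite mulrN; under [in RHS]eq_bigr => e _ do rewrite mulrN.
rewrite !sumrN !opprK sumrB.
have aux (p q s t : K) : - p + s = - q + t -> p - q = s - t.
  by move=> /(canRL (addKr _)) ->; ring.
exact: aux.
Qed.
(** In a product of the entries (b, e) and (e, b) with e different from b, one factor vanishes by
    triangularity; the term e = b cancels. *)
Lemma diag_closed i j b : d i (A j b b) = d j (A i b b).
Proof.
apply/eqP; rewrite -subr_eq0 flat_entry; apply/eqP; apply: big1 => e _.
have [->|eb] := eqVneq e b; first by rewrite mulrC subrr.
case: (leqP (rk e) (rk b)) => r.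
  by rewrite !(cd_tri H _ eb r) ?mulr0 subrr.
by rewrite ![A _ b e](cd_tri H) ?mul0r ?subrr // 1?eq_sym // ltnW.
Qed.
End Basic.

(* Change of basis by 1 + h E, with E the elementary matrix at (b0, c0). *)
Section Gauge.
Variables (I : finType) (rk : I -> nat) (A : 'I_n -> I -> I -> K) (w : 'I_n -> I -> K).
Hypothesis H : conn_data rk A w.
Variables (b0 c0 : I) (h : K).
Hypothesis r0 : (rk c0 < rk b0)%N.
Let bc : b0 != c0. Proof. by apply: contraTneq r0 => ->; rewrite ltnn. Qed.
Let A0 i : A i c0 b0 = 0. Proof. by apply: (cd_tri H); rewrite 1?eq_sym // ltnW. Qed.
Definition gauge_act (v : I -> K) x := v x + (x == b0)%:R * (h * v c0).
(** g A g^-1 + dg g^-1 for g = 1 + h E. The part quadratic in h has the factor A_i c0 b0, zero by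
    triangularity, and E^2 = 0. *)
Definition gauge_conn i x y := A i x y + (x == b0)%:R * (h * A i c0 y)
  - (y == c0)%:R * (A i x b0 * h) + (x == b0)%:R * ((y == c0)%:R * d i h).

Lemma cov_gauge i v x : cov gauge_conn i (gauge_act v) x = gauge_act (cov A i v) x.
Proof.
have S (F : I -> K) c : \sum_y (y == c)%:R * F y = F c.
  rewrite (bigD1 c) //= eqxx mul1r big1 ?addr0 // => y /negPf ->; exact: mul0r.
have -> : cov gauge_conn i (gauge_act v) x = d i (gauge_act v x) - (\sum_y A i x y * v y
   + (x == b0)%:R * h * (\sum_y A i c0 y * v y) - \sum_y (y == c0)%:R * (A i x b0 * h * v y)
   + (x == b0)%:R * d i h * (\sum_y (y == c0)%:R * v y)
   + \sum_y (y == b0)%:R * (gauge_conn i x y * (h * v c0))).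
  rewrite /cov; congr (_ - _); rewrite !mulr_sumr -sumrN -!big_split /=.
  by apply: eq_bigr => y _; rewrite /gauge_act /gauge_conn; ring.
rewrite !S /gauge_act /gauge_conn /cov A0 (negPf bc).
case: (x == b0); rewrite /= ?mul1r ?mul0r ?addr0 ?(derD (dP i)) ?(derM (dP i)); ring.
Qed.
Lemma gauge_data : conn_data rk gauge_conn (fun j => gauge_act (w j)).
Proof.
have inv v x : gauge_act (fun y => v y - (y == b0)%:R * (h * v c0)) x = v x.
  by rewrite /gauge_act (eq_sym c0) (negPf bc) mul0r subr0 subrK.
split=> [i b c bc' r|i j v b|i j b|b].
- rewrite /gauge_conn (cd_tri H) // add0r.
  have [E|bb] := eqVneq b b0; last first.
    have [E'|_] := eqVneq c c0; rewrite ?mul0r ?subr0 ?addr0 //.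
    rewrite (cd_tri H) ?mul0r ?mulr0 ?add0r ?oppr0 ?addr0 //.
    by rewrite (leq_trans r) // E' ltnW.
  have rc : (rk c0 < rk c)%N by rewrite (leq_trans r0) // -E.
  have cc : c0 != c by apply: contraTneq rc => ->; rewrite ltnn.
  by rewrite (cd_tri H _ cc (ltnW rc)) eq_sym (negPf cc) !mul0r !mulr0 subr0 addr0.
- have C k u x : cov gauge_conn k u x =
     gauge_act (cov A k (fun y => u y - (y == b0)%:R * (h * u c0))) x.
    by rewrite -cov_gauge; apply: cov_ext => y; rewrite inv.
  set v' := fun y => v y - (y == b0)%:R * (h * v c0).
  have E k l : cov gauge_conn k (cov gauge_conn l v) b = gauge_act (cov A k (cov A l v')) b.
    by rewrite -cov_gauge; apply: cov_ext => y; rewrite C.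
  by rewrite !E /gauge_act !(cd_flat H i j).
- by rewrite !cov_gauge /gauge_act !(cd_tors H i j).
rewrite /gauge_act; under eq_bigr => j _ do rewrite mulrDr mulrCA [P j * (h * _)]mulrCA.
by rewrite big_split /= -!mulr_sumr !(cd_W H) !mulr0 addr0.
Qed.
Lemma gauge_killed v : killed (fun j => gauge_act (w j)) v -> killed w v.
Proof.
move=> Hk b; have Hc : \sum_j w j c0 * v j = 0.
  apply: etrans (Hk c0); apply: eq_bigr => j _; rewrite /gauge_act (eq_sym c0) (negPf bc).
  by rewrite mul0r addr0.
have := Hk b; rewrite /gauge_act; under eq_bigr => j _ do rewrite mulrDl -!mulrA.
by rewrite big_split /= -!mulr_sumr Hc !mulr0 addr0.
Qed.
Lemma gauge_diag i b : gauge_conn i b b = A i b b.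
Proof.
rewrite /gauge_conn; have [->|bb] := eqVneq b b0.
  by rewrite A0 (negPf bc) !mulr0 !mul0r subr0 !mulr0 !addr0.
have [->|bb'] := eqVneq b c0; rewrite ?A0 !mul0r ?mulr0 ?subr0 ?addr0 //.
Qed.
End Gauge.

(** Solve in one direction i0 where delta is irregular. By closedness the defect r in any other
    direction satisfies d_i0 r = delta_i0 r, hence is zero. *)
Lemma irregular_exact (O : K -> Prop) :
  (forall i delta nu, ~ O delta -> exists h, d i h - delta * h = nu) ->
  (forall i delta h, ~ O delta -> d i h = delta * h -> h = 0) ->
  forall (delta nu : 'I_n -> K), (forall i j, d i (delta j) = d j (delta i)) ->
  (exists i, ~ O (delta i)) ->
  (forall i j, d i (nu j) - d j (nu i) = delta i * nu j - delta j * nu i) ->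
  exists h, forall j, nu j = d j h - delta j * h.
Proof.
move=> surj inj delta nu dcl [i0 Hi] E; have [h Eh] := surj i0 _ (nu i0) Hi.
exists h => j; apply/eqP; rewrite -subr_eq0; apply/eqP; apply: (inj i0 _ _ Hi).
rewrite !(derB (dP _)) (derM (dP _)) (dC i0 j h) (dcl i0 j).
have -> : d i0 (nu j) = d j (nu i0) + (delta i0 * nu j - delta j * nu i0).
  by rewrite -E addrC subrK.
by rewrite -Eh (derB (dP _)) (derM (dP _)); ring.
Qed.

(** * Gauging away the irregular entries *)

Section Irregular.
Variable O : K -> Prop.
Hypothesis O0 : O 0.
Hypothesis OB : forall x y, O x -> O y -> O (x - y).
Hypothesis Odlog : forall i h, h != 0 -> O (d i h / h).
Hypothesis irr_surj : forall i delta nu, ~ O delta -> exists h, d i h - delta * h = nu.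
Hypothesis irr_inj : forall i delta h, ~ O delta -> d i h = delta * h -> h = 0.

Let ON x : O x -> O (- x). Proof. by move=> Ox; rewrite -sub0r; apply: OB. Qed.
Let OD x y : O x -> O y -> O (x + y).
Proof. by move=> Ox Oy; rewrite -[y]opprK; apply: OB => //; apply: ON. Qed.

(* [O] is the valuation ring.  Two indices are in the same class when the
   difference of their diagonal entries is regular; entries of the connection
   between different classes can be gauged away. *)
Definition same_class (I : finType) (A : 'I_n -> I -> I -> K) b c :=
  forall i, O (A i b b - A i c c).

Section OneClass.
Variables (I : finType) (rk : I -> nat) (A : 'I_n -> I -> I -> K) (w : 'I_n -> I -> K).
Hypothesis H : conn_data rk A w.
Hypothesis Hcl : forall b c, same_class A b c.
Variables (i0 : 'I_n) (b0 : I).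
Hypothesis Hirr : ~ O (A i0 b0 b0).

Let irr b : ~ O (A i0 b b).
Proof. by move=> Ob; apply: Hirr; have := OD (Hcl b0 b i0) Ob; rewrite subrK. Qed.
Let covE i v b : cov A i v b = d i (v b) - A i b b * v b - \sum_(c | (rk c < rk b)%N) A i b c * v c.
Proof.
rewrite /cov (bigD1 b) //= opprD addrA; congr (_ - _).
rewrite [RHS]big_mkcond [LHS]big_mkcond; apply: eq_bigr => c _.
have [->|cb] := eqVneq c b; first by rewrite ltnn.
by case: ltnP => // r; rewrite (cd_tri H) ?mul0r // eq_sym.
Qed.

(** A triangular system solved by increasing rank: each row is an equation d h - delta h = nu with
    delta irregular. *)
Lemma class_solve (nu : I -> K) : exists h, forall b, cov A i0 h b = nu b.
Proof.
suff [h Hh] : exists h, forall b, (rk b < (\max_b rk b).+1)%N -> cov A i0 h b = nu b.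
  by exists h => b; apply: Hh; rewrite ltnS; apply: leq_bigmax.
elim: (\max_b rk b).+1 => [|t [h Hh]]; first by exists (fun=> 0).
have /choice [x xP] : forall b, exists x, d i0 x - A i0 b b * x =
    nu b + \sum_(c | (rk c < rk b)%N) A i0 b c * h c.
  by move=> b; apply: irr_surj; apply: irr.
exists (fun b => if rk b == t then x b else h b) => b.
rewrite ltnS leq_eqVlt covE => /orP[/eqP bt|bt].
  rewrite bt eqxx xP bt -addrA -sumrB big1 ?addr0 // => c ct.
  by rewrite ltn_eqF // subrr.
rewrite (ltn_eqF bt) -[RHS](Hh b bt) covE; congr (_ - _); apply: eq_bigr => c cb.
by rewrite ltn_eqF // (ltn_trans cb).
Qed.
Lemma class_inj h : (forall b, cov A i0 h b = 0) -> forall b, h b = 0.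
Proof.
move=> E b; move: {2}(rk b) (leqnn (rk b)) => t; elim/ltn_ind: t b => t IH b bt.
apply: (@irr_inj i0 _ _ (@irr b)); apply/eqP; rewrite -subr_eq0; apply/eqP.
move: (E b); rewrite covE big1 ?subr0 // => c cb.
by rewrite (IH (rk c)) ?mulr0 // (leq_trans cb).
Qed.

(* In an irregular class [w] is exact for the connection, [w = (d - A) h].  Twisting
   the connection by the closed form [chi] makes it regular; both [chi] and
   [w + chi h] annihilate [P]. *)
Lemma class_killed v :
  (forall (J : finType) (rk' : J -> nat) A' w', conn_data rk' A' w' ->
     (forall b i, O (A' i b b)) -> killed w' v) -> killed w v.
Proof.
move=> Hreg; have [h Eh] := class_solve (w i0).
have Ew j b : w j b = cov A j h b.
  apply/eqP; rewrite -subr_eq0; apply/eqP; move: b; apply: class_inj => b.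
  rewrite covB (cd_tors H) (cd_flat H) (cov_ext _ _ _ Eh) subrr //.
have [h0|/existsNP [b1' /eqP h1']] := pselect (forall b, h b = 0).
  move=> b; apply: big1 => j _; rewrite Ew /cov h0 (der0 (dP j)) big1 ?subrr ?mul0r //.
  by move=> c _; rewrite h0 mulr0.
(* In a row of least rank with h nonzero the lower terms vanish, so w there is d h - A h with the
   diagonal entry alone. Dividing by - h gives [chi], closed and annihilating P. *)
case: (@arg_minnP _ b1' (fun b => h b != 0) rk h1') => b1 h1 min1.
have low c : (rk c < rk b1)%N -> h c = 0.
  by move=> r; apply: contraTeq r => /min1; rewrite leqNgt.
have Eb j : w j b1 = d j (h b1) - A j b1 b1 * h b1.
  rewrite Ew covE big1 ?subr0 // => c /low ->; exact: mulr0.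
pose chi j := A j b1 b1 - d j (h b1) / h b1.
have chi_closed i j : d i (chi j) = d j (chi i).
  rewrite /chi !(derB (dP _)) (diag_closed H) !(der_div (dP _)) (dC i j); congr (_ - (_ - _ / _)).
  exact: mulrC.
have chiP : \sum_j P j * chi j = 0.
  apply: (mulIf h1); rewrite mul0r mulr_suml.
  transitivity (- \sum_j P j * w j b1); last by rewrite (cd_W H) oppr0.
  rewrite -sumrN; by apply: eq_bigr => j _; rewrite Eb /chi -!mulrA mulrBl divfK // -mulrN opprB.
(* The twist keeps exactness, w1 = (d - A1) h, hence closedness. The diagonal of A1 becomes A b b -
   A b1 b1 + dlog (h b1), which is regular. *)
pose A1 j x y := A j x y + (x == y)%:R * - chi j.
pose w1 j x := w j x + chi j * h x.
have cov1 j u x : cov A1 j u x = cov A j u x + chi j * u x.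
  rewrite /cov -addrA; congr (_ + _); under eq_bigr => c _ do rewrite /A1 mulrDl.
  rewrite big_split /= opprD; congr (_ + _).
  rewrite (bigD1 x) //= eqxx big1 ?addr0; first by rewrite mul1r mulNr opprK.
  by move=> c cx; rewrite eq_sym (negPf cx) !mul0r.
have w1E j x : w1 j x = cov A1 j h x by rewrite cov1 /w1 Ew.
have flat1 i j u b : cov A1 i (cov A1 j u) b = cov A1 j (cov A1 i u) b.
  have E k l : cov A1 k (cov A1 l u) b = cov A k (cov A l u) b + chi l * cov A k u b
      + d k (chi l) * u b + chi k * cov A l u b + chi k * chi l * u b.
    rewrite cov1 cov1 mulrDr !addrA mulrA; congr (_ + _ + _).
    have -> : cov A k (cov A1 l u) b = cov A k (fun x => cov A l u x - (- chi l * u x)) b.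
      by apply: cov_ext => x; rewrite cov1 mulNr opprK.
    have S : \sum_c A k b c * (- chi l * u c) = - chi l * \sum_c A k b c * u c.
      by rewrite mulr_sumr; apply: eq_bigr => c _; rewrite mulrCA.
    rewrite covB -!addrA; congr (_ + _); rewrite /cov (derM (dP k)) (derN (dP k)) S; ring.
  rewrite !E (cd_flat H) (chi_closed i j); ring.
have D1 : conn_data rk A1 w1.
  split=> [i b c bc r|i j u b|i j b|b].
  - by rewrite /A1 (cd_tri H) // (negPf bc) mul0r addr0.
  - exact: flat1.
  - by rewrite (cov_ext _ _ _ (w1E j)) (cov_ext _ _ _ (w1E i)) flat1.
  rewrite /w1; under eq_bigr => j _ do rewrite mulrDr mulrA.
  by rewrite big_split /= (cd_W H) -mulr_suml chiP mul0r addr0.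
(* The form [chi] alone is a family with one row and zero connection, so v kills it; subtracting chi
   h from w1 then recovers w. *)
pose A2 (_ : 'I_n) (_ _ : unit) : K := 0.
have D2 : conn_data (fun=> 0%N) A2 (fun j _ => chi j).
  have E i u b : cov A2 i u b = d i (u b) by rewrite /cov big1 ?subr0 // => c _; rewrite mul0r.
  by split=> [//|i j u b|i j b|_ //]; rewrite !E.
have k1 : killed w1 v.
  apply: (Hreg _ _ _ _ D1) => b i; rewrite /A1 eqxx mul1r /chi opprB addrCA.
  by apply: OD; [exact: Odlog | exact: (Hcl b b1 i)].
have k2 := Hreg _ _ _ _ D2 (fun _ _ => O0).
move=> b; have := k1 b; rewrite /w1; under eq_bigr => j _ do rewrite mulrDl mulrAC.
by rewrite big_split /= -mulr_suml (k2 tt) mul0r addr0.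
Qed.
End OneClass.

Section Split.
Variables (I : finType) (rk : I -> nat).
Let T := #|{: I * I}|.
(* Pairs are treated by increasing gap of rank, so that eliminating the entry at
   one pair does not disturb those already eliminated. *)
Let code (b c : I) := ((rk b - rk c) * T + enum_rank (b, c))%N.
Let T_gt (b c : I) : (enum_rank (b, c) < T)%N. Proof. exact: ltn_ord. Qed.
Let code_gap (b c x y : I) : (rk b - rk c < rk x - rk y)%N -> (code b c < code x y)%N.
Proof.
move=> g; have := T_gt b c; rewrite /code => t.
apply: (@leq_trans ((rk b - rk c).+1 * T)); last by rewrite (leq_trans (leq_mul g (leqnn T))) // leq_addr.
by rewrite mulSn addnC ltn_add2r.
Qed.
Let code_inj (b c x y : I) : code b c = code x y -> (b, c) = (x, y).
Proof.
have T0 : (0 < T)%N by apply: leq_trans (T_gt b c).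
move=> E; apply: enum_rank_inj; apply: val_inj => /=.
by have := congr1 (modn^~ T) E; rewrite /code !modnMDl !modn_small.
Qed.

(** Each step removes one entry between two classes. With delta the difference of the two diagonal
    entries, flatness makes the entry closed for d - delta, and delta is irregular, so
    [irregular_exact] supplies the gauge. *)
Lemma split_data A w v : conn_data rk A w -> forall N, exists A' w',
  [/\ conn_data rk A' w', killed w' v -> killed w v, forall i b, A' i b b = A i b b &
   forall b c i, ~ same_class A b c -> (rk c < rk b)%N -> (code b c < N)%N -> A' i b c = 0].
Proof.
move=> H; elim=> [|N [A' [w' [H' kk dg z]]]]; first by exists A, w.
have [[b0 [c0 [cross r0 cN]]]|none] := pselect (exists b c,
    [/\ ~ same_class A b c, (rk c < rk b)%N & code b c = N]); last first.
  exists A', w'; split=> // b c i cr r; rewrite ltnS leq_eqVlt => /orP[/eqP e|]; last exact: z.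
  by case: none; exists b, c.
pose delta i := A' i b0 b0 - A' i c0 c0.
have Hd : exists i, ~ O (delta i).
  apply/existsNP => Od; apply: cross => i; have := Od i; by rewrite /delta !dg.
have dcl i j : d i (delta j) = d j (delta i).
  by rewrite /delta !(derB (dP _)) !(diag_closed H' i j).
have bc0 : b0 != c0 by apply: contraTneq r0 => ->; rewrite ltnn.
(* By triangularity only ranks strictly between matter. Were e in the class of both b0 and c0, these
   would share a class; otherwise one factor crosses classes with a smaller gap and is already
   zero. *)
have mid e : e != b0 -> e != c0 -> forall i j, A' i b0 e * A' j e c0 = 0.
  move=> eb ec i j.
  case: (leqP (rk b0) (rk e)) => re; first by rewrite (cd_tri H') ?mul0r // eq_sym.
  case: (leqP (rk e) (rk c0)) => rc; first by rewrite [X in _ * X](cd_tri H') ?mulr0.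
  have [cl|cl] := pselect (same_class A b0 e); last first.
    rewrite z ?mul0r //; rewrite -cN code_gap // ltn_sub2l //.
  rewrite [X in _ * X]z ?mulr0 //; last by rewrite -cN code_gap // ltn_sub2r.
  move=> cl'; apply: cross => l; have := OD (cl l) (cl' l).
  by rewrite addrA subrK.
have Enu i j : d i (A' j b0 c0) - d j (A' i b0 c0) =
    delta i * A' j b0 c0 - delta j * A' i b0 c0.
  rewrite (flat_entry H') (bigD1 b0) //= (bigD1 c0) /=; last by rewrite eq_sym.
  rewrite big1 ?addr0; first by rewrite /delta; ring.
  by move=> e /andP[eb ec]; rewrite !mid // subrr.
have [h0 Eh] := irregular_exact irr_surj irr_inj dcl Hd Enu.
exists (gauge_conn A' b0 c0 (- h0)), (fun j => gauge_act b0 c0 (- h0) (w' j)).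
split.
- exact: gauge_data.
- by move=> k; apply: kk; exact: (gauge_killed r0 k).
- by move=> i b; rewrite (gauge_diag H').
move=> x y i cr r; rewrite ltnS leq_eqVlt => /orP[/eqP e|lt].
  have [-> ->] := code_inj (etrans e (esym cN)).
  rewrite /gauge_conn Eh !eqxx (derN (dP i)) /delta.
  move: (A' i b0 b0) (A' i c0 c0) (d i h0) => p q s; rewrite !mul1r; ring.
(* The gauge alters only row b0 and column c0, and a nonzero change away from (b0, c0) needs a rank
   gap exceeding that of (b0, c0), hence a code above N. *)
rewrite /gauge_conn z // add0r.
have xy : ~~ ((x == b0) && (y == c0)).
  by apply: contraTN lt => /andP[/eqP -> /eqP ->]; rewrite cN ltnn.
have -> : (x == b0)%:R * ((y == c0)%:R * d i (- h0)) = 0.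
  by case: eqP xy => [_ /= /negPf ->|_ _]; rewrite ?mul0r ?mulr0.
have [E|_] := eqVneq x b0.
  rewrite E eqxx /= in xy; rewrite (negPf xy) mul0r subr0 addr0.
  have [ry|ry] := leqP (rk c0) (rk y); first by rewrite (cd_tri H') ?mulr0 // eq_sym.
  suff : (N < N)%N by rewrite ltnn.
  by rewrite -{1}cN (leq_trans (code_gap _) (ltnW lt)) // E ltn_sub2l // (ltn_trans ry).
rewrite mul0r add0r addr0; have [E|_] := eqVneq y c0; last by rewrite mul0r oppr0.
have [rx|rx] := leqP (rk x) (rk b0).
  by rewrite (cd_tri H') ?mul0r ?mulr0 ?oppr0 //; apply: contraNneq xy => ->; rewrite E !eqxx.
suff : (N < N)%N by rewrite ltnn.
by rewrite -{1}cN (leq_trans (code_gap _) (ltnW lt)) // E ltn_sub2r // (ltn_trans r0).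
Qed.
End Split.

Lemma regular_killed v :
  (forall (I : finType) (rk : I -> nat) A w, conn_data rk A w ->
     (forall b i, O (A i b b)) -> killed w v) ->
  forall (I : finType) (rk : I -> nat) A w, conn_data rk A w -> killed w v.
Proof.
move=> Hreg I rk A0 w0 H0.
(* Exceeds the code of every pair, so that all entries between classes are eliminated. *)
pose N := ((\max_b rk b).+1 * #|{: I * I}|)%N.
have [A [w [H kk dg z]]] := split_data v H0 N.
apply: kk => b0.
have {}z b c i : ~ same_class A b c -> (rk c < rk b)%N -> A i b c = 0.
  move=> cr r; apply: z => //; first by move=> cl; apply: cr => l; rewrite !dg; apply: cl.
  apply: (@leq_trans ((rk b - rk c).+1 * #|{: I * I}|)).
    by rewrite mulSn addnC ltn_add2r.
  by rewrite leq_mul2r ltnS (leq_trans (leq_subr _ _)) ?orbT // leq_bigmax.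
have zc b c i : ~ same_class A b c -> A i b c = 0.
  move=> cr; case: (leqP (rk b) (rk c)) => r; last exact: z.
  apply: (cd_tri H) r; apply/eqP => E; apply: cr => l; rewrite E subrr; exact: O0.
(* Isolate the class of b0: the other rows get zero forms and the diagonal entry of b0, so the new
   family on the same index type is a single class. *)
pose S x := `[< same_class A b0 x >].
pose A' i x y := if S x then A i x y else (x == y)%:R * A i b0 b0.
pose w' j x := if S x then w j x else 0.
have SS i x y : S x -> ~~ S y -> A i x y = 0.
  move=> /asboolP sx /asboolP sy; apply: zc => sxy; apply: sy => l.
  by have := OD (sx l) (sxy l); rewrite addrA subrK.
have covS i u x : S x -> cov A' i u x = cov A i u x.
  by move=> sx; rewrite /cov /A'; under eq_bigr => c _ do rewrite sx.
have covN i u x : ~~ S x -> cov A' i u x = d i (u x) - A i b0 b0 * u x.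
  move=> sx; rewrite /cov /A' (bigD1 x) //= (negPf sx) eqxx mul1r big1 ?addr0 // => c cx.
  by rewrite eq_sym (negPf cx) !mul0r.
have covS2 i u u' x : S x -> (forall y, S y -> u y = u' y) -> cov A i u x = cov A i u' x.
  move=> sx E; rewrite /cov E //; congr (_ - _); apply: eq_bigr => c _.
  by case: (boolP (S c)) => sc; [rewrite E | rewrite SS // !mul0r].
have H' : conn_data rk A' w'.
  split=> [i b c bc r|i j u b|i j b|b].
  - by rewrite /A'; case: ifP => _; [apply: (cd_tri H) | rewrite (negPf bc) mul0r].
  - case: (boolP (S b)) => sb.
      have C k l : cov A' k (cov A' l u) b = cov A k (cov A l u) b.
        by rewrite covS //; apply: covS2 => // y sy; rewrite covS.
      by rewrite !C (cd_flat H).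
    rewrite !covN // !(derB (dP _)) !(derM (dP _)) (dC i j) (diag_closed H i j); ring.
  - case: (boolP (S b)) => sb.
      have C k l : cov A' k (w' l) b = cov A k (w l) b.
        by rewrite covS //; apply: covS2 => // y sy; rewrite /w' sy.
      by rewrite !C (cd_tors H).
    by rewrite !covN // /w' (negPf sb) !(der0 (dP _)) !mulr0.
  rewrite /w'; case: (S b); first exact: (cd_W H).
  by apply: big1 => j _; rewrite mulr0.
have Sb0 : S b0 by apply/asboolP => l; rewrite subrr; exact: O0.
have dS x : exists y, S y /\ forall i, A' i x x = A i y y.
  case: (boolP (S x)) => sx; first by exists x; split=> // i; rewrite /A' sx.
  by exists b0; split=> // i; rewrite /A' (negPf sx) eqxx mul1r.
have cl' b c : same_class A' b c.
  move=> l; have [y [/asboolP sy ->]] := dS b; have [y' [/asboolP sy' ->]] := dS c.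
  by have := OB (sy' l) (sy l); rewrite opprB addrC addrA subrK.
have -> : \sum_j w j b0 * v j = \sum_j w' j b0 * v j by rewrite /w' Sb0.
suff : killed w' v by apply.
have [[i Hi]|reg] := pselect (exists i, ~ O (A' i b0 b0)).
  exact: (class_killed H' cl' Hi).
apply: (Hreg _ _ _ _ H') => b i.
have Ob0 : O (A' i b0 b0) by apply: contrapT => Hn; apply: reg; exists i.
by have := OD (cl' b b0 i) Ob0; rewrite subrK.
Qed.
End Irregular.
End ConnectionData.

(** * Descent from Laurent series to their coefficients *)

Section LaurentDescent.
Variables (k : fieldType) (n : nat) (d : 'I_n -> k -> k) (a : 'I_n -> k) (m : nat).
Hypothesis dP : forall i, derivation (d i).
Hypothesis dC : forall i j x, d i (d j x) = d j (d i x).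
Hypothesis aC : forall i j, d i (a j) = d j (a i).
Notation L := {fraction (pser k)}.
Notation fr := (@tofrac (pser k)).
Notation zz := (fr (psX k)).
Notation dp i := (dps (d i) (a i) m).
Definition laur_der i : L -> L := fder (dp i).
Lemma laur_derP i : derivation (laur_der i).
Proof. exact: fderP (dpsP (dP i) _ _). Qed.
Lemma laur_derC i j x : laur_der i (laur_der j x) = laur_der j (laur_der i x).
Proof.
apply: fder_comm; [exact: dpsP (dP i) _ _ | exact: dpsP (dP j) _ _ |].
exact: dps_comm (dP i) (dP j) (dC i j) (aC i j).
Qed.
Lemma laur_der_fr i f : laur_der i (fr f) = fr (dp i f).
Proof. exact: D_fr. Qed.

Lemma laur_der_zzX i N : laur_der i (zz ^+ N) = N%:R * dlogz (a i) m * zz ^+ N.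
Proof. exact: D_zzX. Qed.

Section Pser.
Variables (I : finType) (rk : I -> nat) (A : 'I_n -> I -> I -> pser k) (w : 'I_n -> I -> pser k).
Definition pcov i (V : I -> pser k) b : pser k := dp i (V b) - \sum_c A i b c * V c.
Hypothesis tri : forall i b c, b != c -> (rk b <= rk c)%N -> A i b c = 0.
Hypothesis flat : forall i j V b, pcov i (pcov j V) b = pcov j (pcov i V) b.
Hypothesis tors : forall i j b, pcov i (w j) b = pcov j (w i) b.
Variable P : 'I_n -> k.
Hypothesis wP : forall b, \sum_j psC (P j) * w j b = 0.

Lemma pcovE i V b q : pcov i V b q = d i (V b q) +
  (if (m <= q)%N then (q - m)%:R * a i * V b (q - m)%N else 0) -
  \sum_c \sum_(s < q.+1) A i b c s * V c (q - s)%N.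
Proof. by rewrite /pcov psB dpsE ps_sum. Qed.
Lemma pcov_agree i (V V' : I -> pser k) b N q : (q < N)%N ->
  (forall b q, (q < N)%N -> V b q = V' b q) -> pcov i V b q = pcov i V' b q.
Proof.
move=> qN E; rewrite !pcovE E //; congr (_ + _ - _).
  by case: ifP => // _; rewrite E // (leq_ltn_trans (leq_subr _ _)).
apply: eq_bigr => c _; apply: eq_bigr => s _; rewrite E //.
by rewrite (leq_ltn_trans (leq_subr _ _)).
Qed.

Variable N : nat.
(* Restriction of scalars to k of the connection modulo z^N. *)
Let J := ('I_N * I)%type.
Let rkJ (x : J) := (x.1 * (\max_b rk b).+1 + rk x.2)%N.
(** The subtracted term comes from the derivative of z: the coefficient of z^p contributes p a_i to
    degree p + m. It is diagonal for m = 0 and strictly triangular for m > 0. *)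
Let AJ i (x y : J) : k := (if (y.1 <= x.1)%N then A i x.2 y.2 (x.1 - y.1)%N else 0)
  - (x.2 == y.2)%:R * ((y.1 + m == x.1)%N%:R * ((nat_of_ord y.1)%:R * a i)).
Let wJ j (x : J) : k := w j x.2 x.1.
Let lift (U : J -> k) b : pser k := PSer (fun q => if insub q is Some o then U (o, b) else 0).
Let liftE U b (o : 'I_N) : lift U b o = U (o, b).
Proof. by rewrite /= valK. Qed.

Let covJ i U (q : 'I_N) b : cov d AJ i U (q, b) = pcov i (lift U) b q.
Proof.
rewrite pcovE /cov liftE -addrA; congr (_ + _).
have -> : \sum_c AJ i (q, b) c * U c = \sum_(p < N) \sum_c AJ i (q, b) (p, c) * U (p, c).
  by rewrite pair_bigA; apply: eq_bigr => -[].
rewrite exchange_big /=.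
have S c : \sum_(s < q.+1) A i b c s * lift U c (q - s)%N
   = \sum_(p < N) (if (p <= q)%N then A i b c (q - p)%N else 0) * U (p, c).
  rewrite (reindex_inj rev_ord_inj) /= (big_ord_widen_cond N xpredT
    (fun s => A i b c (q.+1 - s.+1)%N * lift U c (q - (q.+1 - s.+1))%N)) ?ltn_ord //.
  rewrite big_mkcond /=; apply: eq_bigr => p _; rewrite ltnS subSS.
  case: leqP => pq; last by rewrite mul0r.
  by rewrite subKn // -liftE.
rewrite /AJ /=; under eq_bigr => c _.
  under eq_bigr => p _ do rewrite mulrBl.
  rewrite sumrB -S; over.
rewrite sumrB opprB; congr (_ - _).
rewrite (bigD1 b) //= [X in _ + X]big1 ?addr0; last first.
  by move=> c cb; apply: big1 => p _; rewrite eq_sym (negPf cb) !mul0r.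
rewrite eqxx; case: leqP => mq.
  have pN : (q - m < N)%N by rewrite (leq_ltn_trans (leq_subr _ _)).
  rewrite (bigD1 (Ordinal pN)) //= subnK // eqxx !mul1r insubT big1 ?addr0 // => p pq.
  suff -> : (p + m == q)%N = false by rewrite !(mul0r, mulr0).
  apply: contraNF pq => /eqP E; apply/eqP/val_inj; by rewrite /= -E addnK.
apply: big1 => p _; suff -> : (p + m == q)%N = false by rewrite !(mul0r, mulr0).
by apply: contraTF mq => /eqP <-; rewrite -leqNgt leq_addl.
Qed.

(** Truncation respects the structure because the connection is integral: below degree N, covariant
    derivatives depend only on coefficients below degree N. *)
Lemma coef_data : conn_data d P rkJ AJ wJ.
Proof.
have S0 b : (rk b < (\max_b rk b).+1)%N by rewrite ltnS; apply: leq_bigmax.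
split=> [i [q b] [p c] bc r|i j U [q b]|i j [q b]|[q b]].
- have qp : (q <= p)%N.
    rewrite leqNgt; apply: contraTN r; rewrite /rkJ /= -ltnNge => pq.
    apply: (@leq_trans (p.+1 * (\max_b rk b).+1)).
      by rewrite mulSn addnC ltn_add2r.
    by rewrite (leq_trans (leq_mul pq (leqnn _))) // leq_addr.
  rewrite /AJ /=; move: qp; rewrite leq_eqVlt => /orP[/eqP qp|qp]; last first.
    rewrite leqNgt qp /= gtn_eqF ?mul0r ?mulr0 ?subrr //.
    by rewrite (leq_trans qp) // leq_addr.
  have {}qp : q = p by apply: val_inj.
  subst p; have bc' : b != c by apply: contraNneq bc => ->.
  rewrite leqnn (negPf bc') mul0r subr0 tri // -(leq_add2l (q * (\max_b rk b).+1)) //.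
- have E x y : cov d AJ x (cov d AJ y U) (q, b) = pcov x (pcov y (lift U)) b q.
    rewrite covJ; apply: (@pcov_agree _ _ _ _ N) => // c s sN.
    by have := liftE (cov d AJ y U) c (Ordinal sN); rewrite covJ.
  by rewrite !E flat.
- have E x y : cov d AJ x (wJ y) (q, b) = pcov x (w y) b q.
    rewrite covJ; apply: (@pcov_agree _ _ _ _ N) => // c s sN.
    by have := liftE (wJ y) c (Ordinal sN).
  by rewrite !E tors.
have := congr1 (fun f : pser k => f q) (wP b); rewrite ps_sum => E.
by apply: etrans E; apply: eq_bigr => j _; rewrite psCM.
Qed.
Lemma coef_killed v b (q : 'I_N) : killed wJ v -> \sum_j w j b q * v j = 0.
Proof. by move=> H; apply: (H (q, b)). Qed.
End Pser.

Lemma integral_all (X : finType) (F : X -> L) :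
  exists N, forall x M, (N <= M)%N -> integral (zz ^+ M * F x).
Proof.
have /choice [f fP] : forall x, exists N, forall M, (N <= M)%N -> integral (zz ^+ M * F x).
  by move=> x; apply: integral_clear.
exists (\max_x f x)%N => x M H; apply: fP; apply: leq_trans H; exact: leq_bigmax.
Qed.

(** A diagonal rescaling by powers of z changes diagonal entries only by integral multiples of dlog
    z, while the entries below the diagonal gain arbitrarily large powers of z. Hence regularity of
    the diagonal suffices. *)
Lemma regular_data_killed (P v : 'I_n -> k) :
  (forall (I : finType) (rk : I -> nat) A w, conn_data d P rk A w -> killed w v) ->
  forall (I : finType) (rk : I -> nat) A w,
  conn_data laur_der (fun j => fr (psC (P j))) rk A w -> (forall b i, integral (A i b b)) ->
  killed w (fun j => fr (psC (v j))).
Proof.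
move=> Hk I rk A w H Hd.
have [N1 HA] := integral_all (fun x : 'I_n * (I * I) => A x.1 x.2.1 x.2.2).
have [N2 Hw] := integral_all (fun x : 'I_n * I => w x.1 x.2).
(* Rescaling the row [b] by z^(g b) makes both the connection and [w] integral. *)
pose N := (N1 + N2)%N; pose g b := (N * (rk b).+1)%N.
pose G (V : I -> L) b := zz ^+ g b * V b.
pose dl i := dlogz (a i) m.
pose A' i b c := zz ^+ g b * A i b c / zz ^+ g c + (b == c)%:R * ((g b)%:R * dl i).
have zn M := zzX_neq0 k M.
have covG i V b : cov laur_der A' i (G V) b = G (cov laur_der A i V) b.
  rewrite /cov /A' /G (derM (laur_derP i)) laur_der_zzX [RHS]mulrBr [X in _ = _ - X]mulr_sumr.
  have -> : \sum_c (zz ^+ g b * A i b c / zz ^+ g c + (b == c)%:R * ((g b)%:R * dl i)) *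
      (zz ^+ g c * V c) = \sum_c zz ^+ g b * (A i b c * V c) + (g b)%:R * dl i * (zz ^+ g b * V b).
    under eq_bigr => c _ do rewrite mulrDl.
    rewrite big_split /=; congr (_ + _).
      by apply: eq_bigr => c _; rewrite mulrA mulfVK ?zn // -mulrA.
    rewrite (bigD1 b) //= eqxx mul1r big1 ?addr0 // => c cb.
    by rewrite eq_sym (negPf cb) !mul0r.
  rewrite -/(dl i) -!mulrA; set s := \sum_c _; set t := (g b)%:R * _.
  by rewrite [t + _]addrC [s + _]addrC addrKA.
pose w' j := G (w j).
have GK V b : G (fun c => V c / zz ^+ g c) b = V b by rewrite /G mulrC divfK ?zn.
have iA i b c : integral (A' i b c).
  have [<-|bc] := eqVneq b c.
    rewrite /A' eqxx mul1r mulrAC mulfV ?zn // mul1r; apply: integralD (Hd b i) _.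
    by apply: integralM (integral_nat _ _) (integral_dlogz _ _).
  rewrite /A' (negPf bc) mul0r addr0.
  case: (leqP (rk b) (rk c)) => r; first by rewrite (cd_tri H) // mulr0 mul0r; apply: integral0.
  have gg : (g c + N <= g b)%N by rewrite /g -mulnSr leq_mul2l ltnS r orbT.
  have -> : zz ^+ g b * A i b c / zz ^+ g c = zz ^+ (g b - g c) * A i b c.
    rewrite -{1}(@subnK (g c) (g b)); last by rewrite (leq_trans _ gg) // leq_addr.
    by rewrite exprD mulrAC mulfK ?zn.
  apply: (HA (i, (b, c))); rewrite /= (@leq_trans N) ?leq_addr //.
  by rewrite leq_subRL // (leq_trans _ gg) // leq_addr.
have iw j b : integral (w' j b).
  by apply: (Hw (j, b)); rewrite (@leq_trans N) ?leq_addl // /g mulnS leq_addr.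
have /choice [Ah HAh] : forall x : 'I_n * (I * I), exists f, A' x.1 x.2.1 x.2.2 = fr f.
  by move=> x; apply: iA.
have /choice [wh Hwh] : forall x : 'I_n * I, exists f, w' x.1 x.2 = fr f.
  by move=> x; apply: iw.
pose A2 i b c := Ah (i, (b, c)); pose w2 j b := wh (j, b).
have EA i b c : A' i b c = fr (A2 i b c) by apply: (HAh (i, (b, c))).
have Ew j b : w' j b = fr (w2 j b) by apply: (Hwh (j, b)).
have Ecov i V b : fr (pcov A2 i V b) = cov laur_der A' i (fun c => fr (V c)) b.
  rewrite /pcov /cov tofracB laur_der_fr rmorph_sum /=; congr (_ - _).
  by apply: eq_bigr => c _; rewrite EA -tofracM.
have flat2 i j V b : pcov A2 i (pcov A2 j V) b = pcov A2 j (pcov A2 i V) b.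
  apply: fr_inj; rewrite !Ecov.
  pose V' b := fr (V b) / zz ^+ g b.
  have E x y : cov laur_der A' x (fun c => fr (pcov A2 y V c)) b =
      G (cov laur_der A x (cov laur_der A y V')) b.
    rewrite -covG; apply: cov_ext => c; rewrite Ecov -covG; apply: cov_ext => e.
    by rewrite GK.
  by rewrite !E /G (cd_flat H).
have tors2 i j b : pcov A2 i (w2 j) b = pcov A2 j (w2 i) b.
  apply: fr_inj; rewrite !Ecov.
  have E x y : cov laur_der A' x (fun c => fr (w2 y c)) b = G (cov laur_der A x (w y)) b.
    by rewrite -covG; apply: cov_ext => c; rewrite -Ew.
  by rewrite !E /G (cd_tors H).
have tri2 i b c : b != c -> (rk b <= rk c)%N -> A2 i b c = 0.
  move=> bc r; apply: fr_inj; rewrite -EA tofrac0 /A' (cd_tri H) // (negPf bc).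
  by rewrite mulr0 !mul0r addr0.
have W2 b : \sum_j psC (P j) * w2 j b = 0.
  apply: fr_inj; rewrite tofrac0 rmorph_sum /=.
  under eq_bigr => j _ do rewrite tofracM -Ew /w' /G mulrCA.
  by rewrite -mulr_sumr (cd_W H) mulr0.
move=> b; apply: (mulfI (zn (g b))); rewrite mulr0 mulr_sumr.
transitivity (fr (\sum_j w2 j b * psC (v j))).
  rewrite rmorph_sum; apply: eq_bigr => j _ /=.
  by rewrite tofracM -Ew mulrA.
(* The entries of v lie in k, so the pairing is computed coefficientwise; truncating at q + 1 makes
   q the last degree. *)
rewrite -tofrac0; congr (fr _); apply: pserP => q; rewrite ps_sum ps0E.
have D := coef_data tri2 flat2 tors2 W2 q.+1.
have E : \sum_j w2 j b q * v j = 0 := coef_killed b ord_max (Hk _ _ _ _ D).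
apply: etrans E.
by apply: eq_bigr => j _; rewrite [w2 j b * _]mulrC psCM mulrC.
Qed.

Theorem solvable_forms_span_laurent (P : 'I_n -> k) : (exists j, P j != 0) ->
  solvable_forms_span laur_der (fun j => fr (psC (P j))) -> solvable_forms_span d P.
Proof.
move=> [j0 P0] HL v Hk.
have [|c Hc] := HL (fun j => fr (psC (v j))).
  apply: (regular_killed laur_derP laur_derC (O := @integral k)).
  - exact: integral0.
  - exact: integralB.
  - by move=> i h; apply: integral_dlog.
  - by move=> i delta nu; apply: irregular_surj.
  - by move=> i delta h; apply: irregular_inj.
  exact: regular_data_killed Hk.
have e (x y : k) : fr (psC x) = fr (psC y) -> x = y by move=> /fr_inj /psC_inj.
(* The factor c is a Laurent series, but the coordinate j0 forces it to be v j0 / P j0, an element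
   of k. *)
exists (v j0 / P j0) => j; apply: (mulIf P0); rewrite mulrAC divfK //; apply: e.
by rewrite !rmorphM /= !Hc mulrAC.
Qed.
End LaurentDescent.

(** * From a flag of 1-forms to a closed 1-form *)

Section DerivationDet.
Variables (K : fieldType) (D : K -> K).
Hypothesis DP : derivation D.
Lemma der_prod_seq (I : eqType) (r : seq I) (F : I -> K) : uniq r ->
  D (\prod_(i <- r) F i) = \sum_(i <- r) D (F i) * \prod_(j <- r | j != i) F j.
Proof.
elim: r => [|x r IH] /=; first by rewrite !big_nil (der1 DP).
case/andP => xr ur; rewrite !big_cons (derM DP) IH // eqxx /=; congr (_ * _ + _).
  rewrite big_seq [RHS]big_seq_cond; apply: eq_bigl => j.
  by rewrite andb_idr // => jr; apply: contraNneq xr => <-.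
rewrite mulr_sumr [LHS]big_seq [RHS]big_seq; apply: eq_bigr => i ir.
rewrite big_cons; case: eqP => [E|_]; first by rewrite E ir in xr.
by rewrite /= mulrCA.
Qed.
Lemma der_prod (I : finType) (F : I -> K) :
  D (\prod_i F i) = \sum_i D (F i) * \prod_(j | j != i) F j.
Proof. by rewrite (der_prod_seq _ (index_enum_uniq I)). Qed.

(** Jacobi's formula: differentiate one row at a time and expand along that row. *)
Lemma der_det m (N : 'M[K]_m) : D (\det N) = \tr (map_mx D N *m \adj N).
Proof.
pose Ni i := \matrix_(x, y) (if x == i then D (N x y) else N x y) : 'M[K]_m.
have -> : \tr (map_mx D N *m \adj N) = \sum_i \det (Ni i).
  apply: eq_bigr => i _; rewrite mxE (expand_det_row _ i); apply: eq_bigr => j _.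
  rewrite !mxE eqxx; congr (_ * _); rewrite /cofactor; congr (_ * \det _).
  by apply/matrixP => x y; rewrite !mxE [lift i x == i]eq_sym (negPf (neq_lift i x)).
rewrite /determinant (der_sum DP) exchange_big /=; apply: eq_bigr => s _.
rewrite (derM DP) [D (_ ^+ _)](_ : _ = 0) ?mul0r ?add0r; last first.
  by case: (perm.odd_perm s); rewrite ?expr0 ?expr1 ?(derN DP) (der1 DP) ?oppr0.
rewrite der_prod mulr_sumr; apply: eq_bigr => i _; congr (_ * _).
rewrite [RHS](bigD1 i) //= mxE eqxx; congr (_ * _); apply: eq_bigr => j ji.
by rewrite mxE (negPf ji).
Qed.
End DerivationDet.

Section Flags.
Variables (K : fieldType) (n : nat) (d : 'I_n -> K -> K) (P : 'I_n -> K).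
Hypothesis dP : forall i, derivation (d i).
Hypothesis dC : forall i j x, d i (d j x) = d j (d i x).

Definition Xder (x : K) : K := \sum_i P i * d i x.
Lemma XderP : derivation Xder.
Proof.
split=> x y; rewrite /Xder.
  by rewrite -big_split; apply: eq_bigr => i _; rewrite (derD (dP i)) mulrDr.
rewrite mulr_suml mulr_sumr -big_split; apply: eq_bigr => i _.
by rewrite (derM (dP i)) /=; ring.
Qed.
Definition DPmx : 'M[K]_n := \matrix_(i, j) d j (P i).
Definition Pcol : 'cV[K]_n := \col_i P i.
Definition closed_form (u : 'I_n -> K) := forall i j, d i (u j) = d j (u i).
Definition diverg : K := \sum_i d i (P i).

(* The rows of [R] are independent 1-forms annihilating [P], and their span is
   stable under the Lie derivative along [P]. *)
Definition flag m (R : 'M[K]_(m, n)) : Prop := exists (C : 'M[K]_m) (chi : 'I_n -> K),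
  [/\ row_free R, R *m Pcol = 0, map_mx Xder R + R *m DPmx = C *m R, closed_form chi
    & \tr C = \sum_j P j * chi j].

(** Cartan's formula: w(P) = 0 leaves only the contraction of dw with P. Closedness gives dw = A ^
    w, and its contraction is A(P) w, again since w(P) = 0. *)
Lemma data_row_lie (I : finType) (rk : I -> nat) A w : conn_data d P rk A w -> forall b,
  map_mx Xder (\row_j w j b) + (\row_j w j b) *m DPmx =
  \sum_c (\sum_i P i * A i b c) *: (\row_j w j c).
Proof.
move=> H b; apply/rowP => j; rewrite summxE !mxE.
under [RHS]eq_bigr => c _ do rewrite !mxE.
transitivity (\sum_i P i * cov d A i (w j) b - \sum_i P i * d j (w i b) + \sum_i P i * \sum_c A i b c * w j c
   + d j (\sum_i P i * w i b)).
  rewrite (der_sum (dP j)) -sumrB -!big_split /=; apply: eq_bigr => i _.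
  rewrite !mxE (derM (dP j)) /cov.
  move: (\sum_c _) (d i _) (d j (w i b)) (d j (P i)) => s x y z; ring.
rewrite (cd_W H) (der0 (dP j)) addr0.
have -> : \sum_i P i * cov d A i (w j) b = \sum_i P i * d j (w i b).
  apply/eqP; rewrite -subr_eq0 -sumrB; apply/eqP.
  transitivity (\sum_i - (P i * \sum_c A j b c * w i c)).
    apply: eq_bigr => i _; rewrite (cd_tors H) /cov.
    by move: (\sum_c _) (d j _) => s x; ring.
  rewrite sumrN; apply/eqP; rewrite oppr_eq0; apply/eqP.
  under eq_bigr => i _ do rewrite mulr_sumr.
  rewrite exchange_big big1 //= => c _; under eq_bigr => i _ do rewrite mulrCA.
  by rewrite -mulr_sumr (cd_W H) mulr0.
rewrite subrr add0r; under [LHS]eq_bigr => i _ do rewrite mulr_sumr.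
rewrite exchange_big; apply: eq_bigr => c _; rewrite mulr_suml.
by apply: eq_bigr => i _; rewrite mulrA.
Qed.

(** Modulo R the new row is an eigenvector with eigenvalue chi(P). The matrix becomes block
    triangular, so its trace stays the value at P of a closed form. *)
Lemma flag_extend m (R : 'M[K]_(m, n)) (w : 'rV[K]_n) (chi : 'I_n -> K) :
  flag R -> ~~ (w <= R)%MS -> w *m Pcol = 0 -> closed_form chi ->
  (map_mx Xder w + w *m DPmx - (\sum_j P j * chi j) *: w <= R)%MS ->
  flag (col_mx R w).
Proof.
move=> [C [chi0 [fR RP XR cl tr]]] wR wP cl1 /submxP [c Ec].
exists (block_mx C 0 c (\sum_j P j * chi j)%:M), (fun j => chi0 j + chi j); split.
- rewrite -kermx_eq0; apply/rowV0P => z /sub_kermxP.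
  rewrite -[z]hsubmxK mul_row_col; set y := lsubmx z; set s := rsubmx z => E.
  have [s0|s0] := eqVneq s 0.
    move: E; rewrite s0 mul0mx addr0 => /eqP; rewrite mulmx_free_eq0 // => /eqP ->.
    exact: row_mx0.
  case/negP: wR; have ss : s 0 0 != 0.
    by apply: contraNneq s0 => E0; apply/eqP/rowP => i; rewrite !ord1 E0 mxE.
  have Es : s = (s 0 0)%:M by rewrite {1}[s]mx11_scalar.
  have : s *m w = - (y *m R) by apply/eqP; rewrite -addr_eq0 addrC E.
  rewrite Es mul_scalar_mx => /(congr1 (fun M => (s 0 0)^-1 *: M)).
  rewrite scalerA mulVf // scale1r => ->.
  by rewrite scalemx_sub // eqmx_opp submxMl.
- by rewrite mul_col_mx RP wP col_mx0.
- rewrite map_col_mx mul_col_mx add_col_mx XR mul_block_col mul0mx addr0; congr col_mx.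
  by rewrite mul_scalar_mx -Ec subrK.
- by move=> i j; rewrite !(derD (dP _)) cl cl1.
rewrite mxtrace_block tr mxtrace_scalar mulr1n -big_split; apply: eq_bigr => j _.
by rewrite mulrDr.
Qed.

(** Take a flag of maximal size. A missing row of least rank would have all lower rows in the flag,
    and could be adjoined with chi its diagonal entry. *)
Lemma max_flag : exists m (R : 'M[K]_(m, n)), flag R /\
  forall (I : finType) (rk : I -> nat) A w, conn_data d P rk A w ->
  forall b, (\row_j w j b <= R)%MS.
Proof.
have flag0 : flag (0 : 'M[K]_(0, n)).
  exists 0, (fun=> 0); split.
  - by rewrite /row_free mxrank0.
  - by rewrite mul0mx.
  - by apply/matrixP => -[].
  - by move=> i j; rewrite !(der0 (dP _)).
  by rewrite mxtrace0 big1 // => j _; rewrite mulr0.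
pose Q m := `[< exists R : 'M[K]_(m, n), flag R >].
have exQ : exists m, Q m by exists 0%N; apply/asboolP; exists 0.
have bd m : Q m -> (m <= n)%N.
  by move=> /asboolP [R [C [chi [/eqP rkR _ _ _ _]]]]; rewrite -[m]rkR; apply: rank_leq_col.
case: (ex_maxnP exQ bd) => m /asboolP [R FR] maxm; exists m, R; split=> // I rk A w H b.
apply/negPn/negP => bR.
case: (@arg_minnP _ b (fun b => ~~ (\row_j w j b <= R)%MS) rk bR) => b1 b1R min1.
suff : Q (m + 1)%N by move/maxm; rewrite addn1 ltnn.
apply/asboolP; exists (col_mx R (\row_j w j b1)).
apply: (@flag_extend _ _ _ (fun i => A i b1 b1)) => //.
- apply/rowP => i; rewrite !mxE; apply: etrans (cd_W H b1).
  by apply: eq_bigr => j _; rewrite !mxE mulrC.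
- by move=> i j; apply: diag_closed H _ _ _.
rewrite (data_row_lie H) (bigD1 b1) //= addrAC subrr add0r.
apply: summx_sub => c cb; case: (ltnP (rk c) (rk b1)) => r.
  apply: scalemx_sub; apply: contraTT r => /min1; by rewrite -leqNgt.
rewrite big1 ?scale0r ?sub0mx // => i _.
by rewrite (cd_tri H) ?mulr0 // eq_sym.
Qed.
End Flags.

(** If the Lie derivative of a coframe N is B N, Jacobi's formula gives X(det N) / det N = tr B -
    div P. Here tr B = tr C = chi(P), so u = dlog (det N) - chi. *)
Lemma flag_multiplier (K : fieldType) m (d : 'I_(m + 1) -> K -> K) (P : 'I_(m + 1) -> K)
   (R : 'M[K]_(m, m + 1)) :
  (forall i, derivation (d i)) -> (forall i j x, d i (d j x) = d j (d i x)) ->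
  (exists j, P j != 0) -> flag d P R ->
  exists u, closed_form d u /\ \sum_j P j * u j = - diverg d P.
Proof.
move=> dP dC [j0 P0] [C [chi [fR RP XR cl tr]]].
pose X := Xder d P; have XP : derivation X := XderP P dP.
(* [rho] is a 1-form with rho(P) = 1, completing the flag into a coframe [N]. *)
pose rho : 'rV[K]_(m + 1) := (P j0)^-1 *: delta_mx 0 j0.
have rhoP : rho *m Pcol P = 1%:M.
  rewrite -scalemxAl; apply/matrixP => i j; rewrite !ord1 !mxE.
  rewrite (bigD1 j0) //= !mxE !eqxx mul1r big1 ?addr0 ?mulVf // => j' j'j.
  by rewrite !mxE (negPf j'j) andbF mul0r.
pose N := col_mx R rho.
have NU : N \in unitmx.
  rewrite -row_free_unit -kermx_eq0; apply/rowV0P => z /sub_kermxP.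
  rewrite -[z]hsubmxK mul_row_col; set y := lsubmx z; set s := rsubmx z => E.
  have s0 : s = 0.
    by move/(congr1 (mulmx^~ (Pcol P))): E; rewrite mulmxDl -!mulmxA RP mulmx0 add0r rhoP mulmx1 mul0mx.
  move: E; rewrite s0 mul0mx addr0 => /eqP; rewrite mulmx_free_eq0 // => /eqP ->.
  exact: row_mx0.
have inR (y : 'rV[K]_(m + 1)) : y *m Pcol P = 0 -> exists c, y = c *m R.
  move=> yP; pose z := y *m invmx N; have Ey : y = z *m N by rewrite mulmxKV.
  exists (lsubmx z); move: yP; rewrite Ey -{1 2}[z]hsubmxK mul_row_col mulmxDl -!mulmxA RP.
  by rewrite mulmx0 add0r rhoP mulmx1 => ->; rewrite mul0mx addr0.
have XPc : map_mx X (Pcol P) = DPmx d P *m Pcol P.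
  by apply/colP => i; rewrite !mxE /X /Xder; apply: eq_bigr => j _; rewrite !mxE mulrC.
have XM p q r (M1 : 'M[K]_(p, q)) (M2 : 'M[K]_(q, r)) :
    map_mx X (M1 *m M2) = map_mx X M1 *m M2 + M1 *m map_mx X M2.
  apply/matrixP => i j; rewrite !mxE (der_sum XP) -big_split; apply: eq_bigr => l _.
  by rewrite !mxE (derM XP).
have [c Ec] : exists c, map_mx X rho + rho *m DPmx d P = c *m R.
  apply: inR; rewrite mulmxDl -mulmxA -XPc -XM rhoP.
  by apply/matrixP => i j; rewrite !mxE (der_nat XP).
have XN : map_mx X N + N *m DPmx d P = block_mx C 0 c 0 *m N.
  by rewrite map_col_mx mul_col_mx add_col_mx XR Ec mul_block_col !mul0mx !addr0.
have N0 : \det N != 0 by rewrite -unitfE -unitmxE.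
have EX : X (\det N) / \det N = \sum_j P j * chi j - diverg d P.
  have -> : diverg d P = \tr (DPmx d P) by apply: eq_bigr => i _; rewrite mxE.
  have -> : \sum_j P j * chi j = \tr (block_mx C 0 c (0 : 'M_1)).
    by rewrite mxtrace_block mxtrace0 addr0.
  apply: (mulIf N0); rewrite divfK // (der_det XP).
  have -> : map_mx X N = block_mx C 0 c 0 *m N - N *m DPmx d P by rewrite -XN addrK.
  rewrite mulmxBl -mulmxA mul_mx_adj -mulmxA raddfB /= [\tr (N *m _)]mxtrace_mulC -mulmxA mul_adj_mx.
  by rewrite !mul_mx_scalar !mxtraceZ; ring.
exists (fun j => d j (\det N) / \det N - chi j); split.
  move=> i j; rewrite !(derB (dP _)) !(der_div (dP _)) cl dC.
  by congr (_ - _ - _); congr (_ / _); rewrite mulrC.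
under eq_bigr => j _ do rewrite mulrBr mulrA.
by rewrite sumrB -mulr_suml -/(Xder d P _) EX addrAC subrr add0r.
Qed.

(** [u] stands for dJ / J: the multiplier equation div (J P) = 0 reads (dJ / J)(P) = - div P. *)
Definition has_dlog_multiplier (K : fieldType) n (d : 'I_n -> K -> K) (P : 'I_n -> K) : Prop :=
  exists u, closed_form d u /\ \sum_j P j * u j = - diverg d P.

(** The maximal flag has exactly n - 1 rows: its kernel contains P, which is nonzero, and by
    hypothesis only multiples of P. *)
Lemma solvable_forms_span_multiplier (K : fieldType) n (d : 'I_n -> K -> K) (P : 'I_n -> K) :
  (forall i, derivation (d i)) -> (forall i j x, d i (d j x) = d j (d i x)) ->
  (exists j, P j != 0) -> solvable_forms_span d P -> has_dlog_multiplier d P.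
Proof.
move=> dP dC P0 span; have [m [R [FR maxR]]] := max_flag P dP.
have Pc0 : Pcol P != 0.
  by case: P0 => j; apply: contraNneq => /matrixP/(_ j 0); rewrite !mxE => ->.
have [C [chi [/eqP rkR RP _ _ _]]] := FR.
have lt : (m < n)%N.
  rewrite ltn_neqAle -{2}rkR rank_leq_col andbT; apply: contraNneq Pc0 => e.
  subst m; have RU : R \in unitmx by rewrite -row_free_unit /row_free rkR.
  by rewrite -(mulKmx RU (Pcol P)) RP mulmx0.
have dim : (n <= m + 1)%N.
  have kle : (kermx R^T <= (Pcol P)^T)%MS.
    apply/rV_subP => v /sub_kermxP vR.
    have [|c Hc] := span (fun j => v 0 j).
      move=> I rk A w H b; have /submxP [y Ey] := maxR _ _ _ _ H b.
      have : v *m (\row_j w j b)^T = 0 by rewrite Ey trmx_mul mulmxA vR mul0mx.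
      move/matrixP/(_ 0 0); rewrite !mxE => E; apply: etrans E.
      by apply: eq_bigr => j _; rewrite !mxE mulrC.
    have -> : v = c *: (Pcol P)^T by apply/rowP => j; rewrite !mxE Hc.
    exact: scalemx_sub.
  have := mxrankS kle; rewrite mxrank_ker mxrank_tr rkR.
  move/leq_trans/(_ (rank_leq_row _)); lia.
have e : n = (m + 1)%N by lia.
by subst n; apply: flag_multiplier FR.
Qed.

(** * Algebraic extensions and traces *)

Section PolyDerivation.
Variables (F : fieldType) (d : F -> F).
Hypothesis dP : derivation d.
Lemma coef_map_der (p : {poly F}) i : (map_poly d p)`_i = d p`_i.
Proof. by rewrite coef_map_id0 ?(der0 dP). Qed.
Lemma map_der_derivation : derivation (map_poly d).
Proof.
split=> p q; apply/polyP => i; rewrite coefD !coef_map_der ?coefD ?(derD dP) //.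
rewrite !coefM (der_sum dP) -big_split; apply: eq_bigr => j _.
by rewrite (derM dP) !coef_map_der.
Qed.
Lemma map_derC c : map_poly d c%:P = (d c)%:P.
Proof. by apply/polyP => i; rewrite coef_map_der !coefC; case: eqP; rewrite ?(der0 dP). Qed.
Lemma map_derX : map_poly d 'X = 0.
Proof. by apply/polyP => i; rewrite coef_map_der coefX coef0 (der_nat dP). Qed.
Lemma map_der_deriv (p : {poly F}) : map_poly d p^`() = (map_poly d p)^`().
Proof. by apply/polyP => i; rewrite !(coef_map_der, coef_deriv) (der_mulrn dP). Qed.

Definition pder (c p : {poly F}) := map_poly d p + c * p^`().
Lemma pderP c : derivation (pder c).
Proof.
split=> p q; rewrite /pder ?(derD map_der_derivation) ?(derM map_der_derivation) ?derivD ?derivM; ring.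
Qed.
Lemma pderC c x : pder c x%:P = (d x)%:P.
Proof. by rewrite /pder map_derC derivC mulr0 addr0. Qed.
Lemma pderX c : pder c 'X = c.
Proof. by rewrite /pder map_derX derivX add0r mulr1. Qed.
End PolyDerivation.

Lemma derivation_horner (F L : fieldType) (iota : {rmorphism F -> L}) (d : F -> F) (D : L -> L)
    (p : {poly F}) z : derivation d -> derivation D -> (forall x, D (iota x) = iota (d x)) ->
  D (map_poly iota p).[z] = (map_poly iota (map_poly d p)).[z] + (map_poly iota p^`()).[z] * D z.
Proof.
move=> dP DP H; have mP := map_der_derivation dP.
elim/poly_ind: p => [|p c IH].
  by rewrite (der0 mP) deriv0 !rmorph0 !horner0 (der0 DP) mul0r addr0.
rewrite (derD mP) (derM mP) (map_derX dP) (map_derC dP) mulr0 addr0.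
rewrite derivD derivM derivX mulr1 derivC addr0 !(rmorphD, rmorphM) /= !map_polyX !map_polyC /=.
rewrite !hornerE (derD DP) (derM DP) IH H /=; ring.
Qed.

Section AlgebraicAdjunction.
Variables (F L : fieldType) (iota : {rmorphism F -> L}) (z : L) (p : {poly F}).
Notation ev q := (map_poly iota q).[z].
Hypothesis gen : forall y, exists q, y = ev q.
Hypothesis ker : forall q, ev q = 0 -> p %| q.
Hypothesis pz : ev p = 0.
Hypothesis sep : ev p^`() != 0.
Let evD q r : ev (q + r) = ev q + ev r. Proof. by rewrite rmorphD hornerD. Qed.
Let evM q r : ev (q * r) = ev q * ev r. Proof. by rewrite rmorphM hornerM. Qed.

(** From p(z) = 0 one gets p'(z) e(z) = 0, and p'(z) is nonzero. *)
Lemma alg_der_uniq (e : L -> L) : derivation e -> (forall x, e (iota x) = 0) -> forall y, e y = 0.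
Proof.
move=> eP e0.
have zP : derivation (fun _ : F => 0 : F) by split=> *; rewrite ?mulr0 ?mul0r addr0.
have H q : e (ev q) = ev q^`() * e z.
  rewrite (derivation_horner q z zP eP) => [|x]; last by rewrite e0 rmorph0.
  rewrite [map_poly _ q](_ : _ = 0) ?rmorph0 ?horner0 ?add0r //.
  by apply/polyP => i; rewrite coef_map_id0 // coef0.
move=> y; have [q ->] := gen y; rewrite H.
have /eqP := H p; rewrite pz (der0 eP) eq_sym mulf_eq0 (negPf sep) => /eqP ->.
by rewrite mulr0.
Qed.

(** Differentiating p(z) = 0 dictates the value [w] of D at z. Two polynomials with the same value
    at z differ by a multiple of p, which D sends to 0. *)
Lemma alg_der_ext (d : F -> F) : derivation d ->
  {D : L -> L | derivation D & forall x, D (iota x) = iota (d x)}.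
Proof.
move=> dP; have mP := map_der_derivation dP.
pose w := - ev (map_poly d p) / ev p^`().
pose D q := ev (map_poly d q) + ev q^`() * w.
have DD q r : D (q + r) = D q + D r.
  by rewrite /D (derD mP) derivD !evD; ring.
have DM q r : D (q * r) = D q * ev r + ev q * D r.
  by rewrite /D (derM mP) derivM !evD !evM; ring.
have Dp : D p = 0 by rewrite /D /w mulrCA mulfV // mulr1 subrr.
have D0 q : ev q = 0 -> D q = 0.
  by move=> /ker /dvdpP [r ->]; rewrite DM Dp pz !mulr0 addr0.
pose pk y := projT1 (cid (gen y)).
have pkE y : ev (pk y) = y by rewrite /pk; case: cid.
have DE y q : ev q = y -> D (pk y) = D q.
  move=> e; apply/eqP; rewrite -subr_eq0; apply/eqP.
  have -> : D (pk y) - D q = D (pk y - q).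
    by rewrite (_ : D (pk y) = D (pk y - q) + D q) ?addrK // -DD subrK.
  by apply: D0; rewrite evD pkE rmorphN hornerN e subrr.
exists (fun y => D (pk y)).
  split=> x y; first by rewrite (DE _ (pk x + pk y)) ?DD // evD !pkE.
  by rewrite (DE _ (pk x * pk y)) ?DM ?evM !pkE.
move=> x; rewrite (DE _ x%:P); last by rewrite map_polyC hornerC.
by rewrite /D (map_derC dP) derivC rmorph0 horner0 mul0r addr0 map_polyC hornerC.
Qed.
End AlgebraicAdjunction.

Lemma irreducible_factor (F : fieldType) (p : {poly F}) : (1 < size p)%N ->
  exists q, irreducible_poly q /\ q %| p.
Proof.
have [m] := ubnP (size p); elim: m p => // m IH p; rewrite ltnS => pm p1.
have [irr|nirr] := pselect (irreducible_poly p); first by exists p.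
have [q [q1 qp nqp]] : exists q : {poly F}, [/\ size q != 1%N, q %| p & ~~ (q %= p)].
  apply: contrapT => H; apply: nirr; split=> // q q1 qp.
  by apply/negPn/negP => nqp; apply: H; exists q.
have p0 : p != 0 by rewrite -size_poly_gt0 (ltn_trans _ p1).
have q0 : q != 0 by apply: dvdpN0 qp p0.
have qs : (size q < size p)%N.
  by rewrite ltn_neqAle (dvdp_leq p0 qp) andbT; apply: contra nqp; rewrite (dvdp_size_eqp qp).
have [||r [ir rq]] := IH q; first exact: leq_trans pm.
  by rewrite ltn_neqAle eq_sym q1 size_poly_gt0.
by exists r; split=> //; apply: dvdp_trans qp.
Qed.

Lemma irr_coprime (F : fieldType) (p q : {poly F}) : irreducible_poly p -> coprimep p q = ~~ (p %| q).
Proof.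
move=> irr; have [p1 ip] := irr; apply/idP/idP => [cop|npq].
  apply: contraTN cop => pq; rewrite coprimep_def; apply/negP => /eqP g1.
  by have := eqp_size (dvdp_gcd_idl pq); rewrite g1 => e; rewrite -e in p1.
rewrite coprimep_def; apply/negPn/negP => g1; case/negP: npq.
by have /eqp_dvdl <- := ip _ g1 (dvdp_gcdl p q); apply: dvdp_gcdr.
Qed.

Lemma adjoin_root (F : fieldType) (p : {poly F}) : irreducible_poly p ->
  exists (L : fieldExtType F) (z : L), [/\ root (map_poly (in_alg L) p) z,
    forall y, exists q, y = (map_poly (in_alg L) q).[z]
  & forall q, (map_poly (in_alg L) q).[z] = 0 -> p %| q].
Proof.
move=> irr; have [L _ [z rz full]] := irredp_FAdjoin irr; exists L, z; split=> //.
  move=> y; have : y \in <<1; z>>%VS by rewrite full memvf.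
  case/Fadjoin_polyP => q /polyOver1P [r ->] ->; by exists r.
move=> q qz; apply/negPn/negP => npq; have cop : coprimep p q by rewrite irr_coprime.
have : coprimep (map_poly (in_alg L) p) (map_poly (in_alg L) q) by rewrite coprimep_map.
by move/coprimep_root/(_ rz); rewrite qz eqxx.
Qed.

Section Trace.
Variables (F : fieldType) (L : fieldExtType F).
(* The trace of the extension L / F commutes with derivations: it sends a closed
   form over L to a closed form over F. *)
Definition ext_trace (x : L) : F := \sum_i coord (vbasis {:L}) i (x * (vbasis {:L})`_i).
Notation b := (vbasis {:L}).
Let bE x : x = \sum_j coord b j x *: b`_j.
Proof. by rewrite -coord_vbasis ?memvf. Qed.
Lemma ext_traceD x y : ext_trace (x + y) = ext_trace x + ext_trace y.
Proof. by rewrite /ext_trace -big_split; apply: eq_bigr => i _; rewrite mulrDl linearD. Qed.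
Lemma ext_traceZ c x : ext_trace (c *: x) = c * ext_trace x.
Proof. by rewrite /ext_trace mulr_sumr; apply: eq_bigr => i _; rewrite -scalerAl linearZ. Qed.
Lemma ext_trace1 : ext_trace 1 = (\dim {:L})%:R.
Proof.
rewrite /ext_trace; under eq_bigr => i _ do
  rewrite mul1r coord_free ?eqxx ?(basis_free (vbasisP _)) //.
by rewrite sumr_const card_ord.
Qed.
(** In a basis D is d plus a matrix, so multiplication by D x has the differentiated matrix of x
    plus a commutator, whose trace is zero. *)
Lemma ext_trace_der (d : F -> F) (D : L -> L) : derivation d -> derivation D ->
  (forall x, D (in_alg L x) = in_alg L (d x)) -> forall x, ext_trace (D x) = d (ext_trace x).
Proof.
move=> dP DP H x; pose co i y := coord b i y.
have DZ c y : D (c *: y) = d c *: y + c *: D y.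
  by rewrite -mulr_algl (derM DP) (H c) !mulr_algl.
have coD i y : co i (D y) = d (co i y) + \sum_j co j y * co i (D b`_j).
  rewrite {1}(bE y) (der_sum DP) /co linear_sum /=.
  under eq_bigr => j _ do rewrite DZ linearD !linearZ.
  rewrite big_split /=; congr (_ + _).
  rewrite (bigD1 i) //= coord_free ?(basis_free (vbasisP _)) // eqxx mulr1 big1 ?addr0 // => j ji.
  by rewrite coord_free ?(basis_free (vbasisP _)) // eq_sym -val_eqE in ji *; rewrite (negPf ji) mulr0.
rewrite /ext_trace (der_sum dP).
have -> : \sum_i coord b i (D x * b`_i) = \sum_i (co i (D (x * b`_i)) - co i (x * D b`_i)).
  by apply: eq_bigr => i _; rewrite (derM DP) /co linearD /= addrK.
rewrite sumrB; under eq_bigr => i _ do rewrite coD.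
rewrite big_split /= -addrA [X in _ + X](_ : _ = 0) ?addr0 //; apply/eqP.
rewrite subr_eq0 exchange_big /=; apply/eqP; apply: eq_bigr => j _.
rewrite {2}(bE (D b`_j)) mulr_sumr /co linear_sum /=; apply: eq_bigr => i _.
by rewrite -scalerAr linearZ /= mulrC.
Qed.
End Trace.

(** * Differential fields over C(x) and descent of multipliers along algebraic extensions *)

Section DifferentialExtensions.
Variables (R : realType) (n : nat).
Local Notation C := (complex R).
Implicit Types K : diff_ext R n.

Lemma de_dP K i : derivation (@de_d _ _ K i).
Proof. by split=> x y; [exact: de_dD | exact: de_dM]. Qed.

Lemma de_natr_neq0 K m : m.+1%:R != 0 :> K.
Proof.
apply/eqP; rewrite -(rmorph_nat (@de_iota _ _ K)) -(rmorph0 (@de_iota _ _ K)).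
move/(@de_iota_inj _ _ K)/eqP; rewrite -mpolyC_nat mpolyC_eq0.
by rewrite Num.Theory.pnatr_eq0.
Qed.

Definition diff_hom K K' (f : K -> K') : Prop :=
  (forall i x, f (de_d i x) = de_d i (f x)) /\ (forall p, f (de_iota K p) = de_iota K' p).

Lemma diff_hom_comp K1 K2 K3 (f : {rmorphism K1 -> K2}) (g : {rmorphism K2 -> K3}) :
  diff_hom f -> diff_hom g -> diff_hom (g \o f).
Proof. by move=> [fd fi] [gd gi]; split=> [i x|p] /=; rewrite ?fd ?gd ?fi ?gi. Qed.

Section Laurent.
Variables (K : diff_ext R n) (a : 'I_n -> K) (m : nat) (aC : closed_form (@de_d _ _ K) a).
Local Notation L := {fraction (pser K)}.
Definition laur_iota : {rmorphism {mpoly C[n]} -> L} :=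
  (@tofrac (pser K)) \o ((@psC K) \o de_iota K).
Lemma laur_iota_inj : injective laur_iota.
Proof. by move=> x y /fr_inj/psC_inj; apply: de_iota_inj. Qed.
Lemma laur_iota_d i p : laur_der (@de_d _ _ K) a m i (laur_iota p) = laur_iota (mderiv i p).
Proof.
rewrite /laur_iota /= laur_der_fr; last exact: de_dP.
by rewrite dpsC ?de_iota_d //; exact: de_dP.
Qed.
Definition laur_ext : diff_ext R n :=
  @DiffExt R n L (laur_der (@de_d _ _ K) a m) laur_iota
    (fun i => (laur_derP a m (@de_dP K) i).1) (fun i => (laur_derP a m (@de_dP K) i).2)
    (laur_derC m (@de_dP K) (@de_comm _ _ K) aC) laur_iota_inj laur_iota_d.
End Laurent.

Definition multiplier_in K (P : 'I_n -> {mpoly C[n]}) : Prop :=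
  has_dlog_multiplier (@de_d _ _ K) (fun j => de_iota K (P j)).

(** A form u over the extension descends to its trace divided by the degree: this is closed, and its
    value at P is still - div P because P and div P lie in K. *)
Lemma diff_adjoin_root K (p : {poly K}) : (1 < size p)%N ->
  exists (K' : diff_ext R n) (f : {rmorphism K -> K'}) (x : K'),
  [/\ diff_hom f, root (map_poly f p) x & forall P, multiplier_in K' P -> multiplier_in K P].
Proof.
move=> /irreducible_factor [q [irr qp]].
have [L [z [rz gen ker]]] := adjoin_root irr.
pose f : {rmorphism K -> L} := in_alg L.
have fI : injective f by apply: fmorph_inj.
have q1 := irr.1.
have sep : (map_poly f q^`()).[z] != 0.
  apply/eqP => /ker; have q'0 : q^`() != 0.
    rewrite -size_poly_gt0; move: q1; case E : (size q) => [|[|s]] // _.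
    apply: (@leq_ltn_trans s) => //; rewrite ltnNge; apply/negP => /leq_sizeP /(_ s (leqnn _)).
    rewrite coef_deriv -mulr_natl => /eqP; rewrite mulf_eq0 (negPf (de_natr_neq0 _ _)) /=.
    rewrite -[s.+1]/(s.+2.-1) -E -lead_coefE lead_coef_eq0; apply/negP; exact: irredp_neq0.
  move/(dvdp_leq q'0); rewrite leqNgt; case/negP; apply: lt_size_deriv; exact: irredp_neq0.
have pz : (map_poly f q).[z] = 0 by apply/eqP.
have /choice [D HD] : forall i, exists D : L -> L, derivation D /\ forall x, D (f x) = f (de_d i x).
  by move=> i; have [D DP H] := alg_der_ext gen ker pz sep (@de_dP K i); exists D.
have DP i : derivation (D i) by case: (HD i).
have Df i x : D i (f x) = f (de_d i x) by case: (HD i).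
have DC i j x : D i (D j x) = D j (D i x).
  apply/eqP; rewrite -subr_eq0; apply/eqP; move: x.
  apply: (alg_der_uniq (iota := f) gen pz sep (derivation_comm (DP i) (DP j))) => x.
  by rewrite !Df de_comm subrr.
pose iot : {rmorphism {mpoly C[n]} -> L} := f \o de_iota K.
have iotI : injective iot by move=> x y /fI; apply: de_iota_inj.
have iotd i x : D i (iot x) = iot (mderiv i x) by rewrite /= Df de_iota_d.
exists (@DiffExt R n L D iot (fun i => (DP i).1) (fun i => (DP i).2) DC iotI iotd), f, z.
split; [by split=> [i x|] //=; rewrite Df | by case/dvdpP: qp => r ->; rewrite rmorphM rootM rz orbT|].
move=> P [u [cl Eu]]; have tr0 : ext_trace (1 : L) != 0.
  by rewrite ext_trace1; have := adim_gt0 (aspacef L); case: (\dim _) => // N _; apply: de_natr_neq0.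
have trd i x := ext_trace_der (@de_dP K i) (DP i) (Df i) x.
pose c := @ext_trace _ L 1; have dc i : de_d i c = 0.
  by rewrite /c ext_trace1 (der_nat (@de_dP K i)).
exists (fun j => ext_trace (u j) / c); split.
  move=> i j; rewrite !(der_div (@de_dP K _)) !dc !mulr0 !mul0r !subr0 -!trd.
  by congr (ext_trace _ / _); apply: cl.
apply: (mulIf tr0); rewrite -/c mulr_suml.
have tr_sum (F : 'I_n -> L) : ext_trace (\sum_i F i) = \sum_i ext_trace (F i).
  apply: (big_morph _ (@ext_traceD _ L)); have := ext_traceZ 0 (1 : L).
  by rewrite scale0r mul0r.
have H (x : K) : f x = x *: 1 by [].
transitivity (ext_trace (\sum_j iot (P j) * u j)).
  rewrite tr_sum; apply: eq_bigr => j _; rewrite -mulrA divfK //.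
  by rewrite /= mulr_algl ext_traceZ.
rewrite [X in ext_trace X]Eu /c -ext_traceZ scaleNr; congr (ext_trace (- _)).
rewrite scaler_suml; apply: eq_bigr => i _.
by rewrite /= Df.
Qed.
End DifferentialExtensions.

(** * Newton-Puiseux *)

Section PolyPowerSeries.
Variable k : fieldType.
Notation PS := (pser k).
Implicit Types P Q : {poly PS}.
(** A polynomial over k[[z]] seen as a power series in z with polynomial coefficients; this is the
    coefficient of z^q. *)
Definition pcoef (q : nat) P : {poly k} := map_poly (fun f : PS => f q) P.
Lemma coef_pcoef q P j : (pcoef q P)`_j = P`_j q.
Proof. by rewrite coef_map_id0. Qed.
Lemma pcoefD q P Q : pcoef q (P + Q) = pcoef q P + pcoef q Q.
Proof. by apply/polyP => j; rewrite coefD !coef_pcoef coefD. Qed.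
Lemma pcoefB q P Q : pcoef q (P - Q) = pcoef q P - pcoef q Q.
Proof. by apply/polyP => j; rewrite coefB !coef_pcoef coefB. Qed.
Lemma pcoefC q (g : {poly k}) P : pcoef q (map_poly (@psC k) g * P) = g * pcoef q P.
Proof.
apply/polyP => j; rewrite coef_pcoef !coefM ps_sum; apply: eq_bigr => i _.
by rewrite coef_map psCM coef_pcoef.
Qed.
Lemma pcoef_inj P Q : (forall q, pcoef q P = pcoef q Q) -> P = Q.
Proof.
move=> H; apply/polyP => j; apply: pserP => q.
by rewrite -!coef_pcoef H.
Qed.
Lemma pcoef_shift q P : pcoef q (psX k *: P) = if q is q'.+1 then pcoef q' P else 0.
Proof.
apply/polyP => j; rewrite coef_pcoef coefZ psX1.
by case: q => [|q]; rewrite ?coef0 ?coef_pcoef.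
Qed.
Lemma pcoefM_agree q P P' Q Q' : (forall s, (s <= q)%N -> pcoef s P = pcoef s P') ->
  (forall s, (s <= q)%N -> pcoef s Q = pcoef s Q') -> pcoef q (P * Q) = pcoef q (P' * Q').
Proof.
move=> EP EQ; apply/polyP => j; rewrite !coef_pcoef !coefM !ps_sum; apply: eq_bigr => i _.
rewrite !psM; apply: eq_bigr => s _; have := ltn_ord s; rewrite ltnS => sq.
by rewrite -!coef_pcoef EP // EQ // leq_subr.
Qed.

(* The corrections to the factors [g0] and [h0] form the fixpoint of a contraction,
   whose linear part g0 V + h0 U is inverted by the Bezout relation. *)
Lemma hensel P (g0 h0 : {poly k}) mu nu : size g0 = mu.+1 -> size h0 = nu.+1 ->
  size P = (mu + nu).+1 -> P \is monic -> g0 \is monic -> h0 \is monic ->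
  coprimep g0 h0 -> pcoef 0 P = g0 * h0 ->
  exists g h, [/\ P = g * h, size g = mu.+1 & g \is monic].
Proof.
move=> sg sh sP mP mg mh /Bezout_eq1_coprimepP [[A B] /= AB] E0.
have P1 : P`_(mu + nu) = 1 by have /monicP := mP; rewrite lead_coefE sP.
(* P = g0 h0 + z Q, where Q has degree below mu + nu because P and g0 h0 are both monic of that
   degree. *)
pose Q := \poly_(j < mu + nu) PSer (fun i => P`_j i.+1).
have PQ : P = map_poly (@psC k) (g0 * h0) + psX k *: Q.
  rewrite -E0; apply/polyP => j; apply: pserP => q; rewrite coefD coefZ psD psX1.
  rewrite coef_map coef_pcoef /= coef_poly; case: q => [|q] /=; first by rewrite addr0.
  rewrite add0r; case: ltnP => // j1; move: j1; rewrite leq_eqVlt => /orP[/eqP <-|j1].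
    by rewrite P1 ps1E.
  by rewrite nth_default // sP.
pose UU (u : bool * nat -> PS) := \poly_(j < mu) u (true, j).
pose VV (u : bool * nat -> PS) := \poly_(j < nu) u (false, j).
(* In degree q the equation P = (g0 + z U)(h0 + z V) reads g0 V_q + h0 U_q = N_q, and N_q involves
   only lower coefficients of U and V. *)
pose N u q := pcoef q (Q - psX k *: (UU u * VV u)).
pose Un u q := (B * N u q) %% g0.
pose Vn u q := (N u q - h0 * Un u q) %/ g0.
pose T u (x : bool * nat) := PSer (fun q => (if x.1 then Un u q else Vn u q)`_x.2).
have [|u uE] := @ps_fixpoint k _ T.
  move=> q u v H [b j] /=; suff e : N u q = N v q by rewrite /Vn /Un e.
  rewrite /N !pcoefB !pcoef_shift; case: q H => // q H; congr (_ - _).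
  by apply: pcoefM_agree => s sq; apply/polyP => i; rewrite !coef_pcoef !coef_poly;
    case: ifP => // _; rewrite H.
have g00 : g0 != 0 by rewrite -size_poly_gt0 sg.
have sU q : (size (Un u q) <= mu)%N by have := ltn_modp (B * N u q) g0; rewrite g00 sg ltnS.
have dvd q : g0 %| N u q - h0 * Un u q.
  have -> : N u q - h0 * Un u q = g0 * (A * N u q + h0 * ((B * N u q) %/ g0)).
    have -> : Un u q = B * N u q - (B * N u q) %/ g0 * g0.
      by rewrite {1}(divp_eq (B * N u q) g0) addrC addKr.
    by rewrite -{1}[N u q]mul1r -AB; ring.
  exact: dvdp_mulIl.
have sN q : (size (N u q) <= mu + nu)%N.
  apply/leq_sizeP => j jq; rewrite coef_pcoef coefB coefZ coef_poly ltnNge jq.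
  have -> : (UU u * VV u)`_j = 0; last by rewrite mulr0 subr0.
  apply: nth_default; apply: leq_trans jq; apply: leq_trans (size_polyMleq _ _) _.
  apply: leq_trans (leq_pred _) _; apply: leq_add; exact: size_poly.
have sV q : (size (Vn u q) <= nu)%N.
  rewrite size_divp // sg /= leq_subLR; apply: leq_trans (size_polyD _ _) _.
  rewrite geq_max sN size_polyN; apply: leq_trans (size_polyMleq _ _) _.
  by rewrite sh addSn /= addnC leq_add2r.
have eU q : pcoef q (UU u) = Un u q.
  apply/polyP => j; rewrite coef_pcoef coef_poly; case: ltnP => jm.
    by rewrite -{1}uE.
  by rewrite nth_default // (leq_trans (sU q)).
have eV q : pcoef q (VV u) = Vn u q.
  apply/polyP => j; rewrite coef_pcoef coef_poly; case: ltnP => jm.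
    by rewrite -{1}uE.
  by rewrite nth_default // (leq_trans (sV q)).
have QE : Q = map_poly (@psC k) g0 * VV u + map_poly (@psC k) h0 * UU u + psX k *: (UU u * VV u).
  apply/eqP; rewrite -subr_eq; apply/eqP; apply: pcoef_inj => q.
  by rewrite [RHS]pcoefD !pcoefC eU eV -/(N u q) [g0 * _]mulrC divpK // subrK.
pose g := map_poly (@psC k) g0 + psX k *: UU u.
have sg' : size (map_poly (@psC k) g0) = mu.+1 by rewrite size_map_inj_poly ?rmorph0 //; apply: psC_inj.
have sX : (size (psX k *: UU u) < mu.+1)%N.
  by rewrite ltnS; apply: leq_trans (size_scale_leq _ _) _; apply: size_poly.
exists g, (map_poly (@psC k) h0 + psX k *: VV u); split.
- by rewrite {1}PQ rmorphM /= QE /g -!mul_polyC; ring.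
- by rewrite size_polyDl sg'.
rewrite monicE lead_coefDl ?sg' // lead_coef_map_inj ?rmorph0 //; last exact: psC_inj.
by rewrite (monicP mg) rmorph1.
Qed.
End PolyPowerSeries.

Section SubstPower.
Variables (k k' : fieldType) (f : {rmorphism k -> k'}) (e : nat).
Hypothesis e0 : (0 < e)%N.
(* [f] on coefficients, and z |-> z^e. *)
Definition ps_subst (g : pser k) : pser k' := PSer (fun q => if (e %| q)%N then f (g (q %/ e)%N) else 0).
Lemma ps_substE g q : ps_subst g q = if (e %| q)%N then f (g (q %/ e)%N) else 0.
Proof. by []. Qed.
Lemma ps_subst_trunc N g q : (q <= N)%N ->
  ps_subst g q = (map_poly f (ps_trunc N g) \Po 'X^e)`_q.
Proof.
move=> qN; rewrite coef_comp_poly_Xn //= coef_map coef_poly ltnS.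
by rewrite (leq_trans (leq_div _ _) qN); case: dvdnP.
Qed.
Lemma ps_substB g h : ps_subst (g - h) = ps_subst g - ps_subst h.
Proof. by apply: pserP => q; rewrite psB /=; case: ifP; rewrite ?rmorphB ?subr0. Qed.
Lemma ps_substM g h : ps_subst (g * h) = ps_subst g * ps_subst h.
Proof.
apply: pserP => q; rewrite psM.
have -> : \sum_(i < q.+1) ps_subst g i * ps_subst h (q - i)%N =
   ((map_poly f (ps_trunc q g) \Po 'X^e) * (map_poly f (ps_trunc q h) \Po 'X^e))`_q.
  rewrite coefM; apply: eq_bigr => i _; have := ltn_ord i; rewrite ltnS => iq.
  by rewrite -!ps_subst_trunc ?leq_subr.
rewrite -rmorphM -rmorphM coef_comp_poly_Xn // coef_map.
rewrite -(@ps_mul_trunc _ q) ?leq_div //; by case: ifP.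
Qed.
Lemma ps_subst1 : ps_subst 1 = 1.
Proof.
apply: pserP => q; rewrite ps_substE !ps1E; case: dvdnP => [[s ->]|H].
  by rewrite mulnK // muln_eq0 [e == _]gtn_eqF // orbF rmorph_nat.
by case: eqP => // q0; case: H; exists 0%N; rewrite q0.
Qed.
Lemma ps_subst_rmorphism : {G : {rmorphism pser k -> pser k'} | G =1 ps_subst}.
Proof. exact: mk_rmorphism ps_substB ps_substM ps_subst1. Qed.
Lemma ps_subst_inj : injective ps_subst.
Proof.
move=> g h H; apply: pserP => q; apply: (fmorph_inj f).
by have := congr1 (fun F : pser k' => F (e * q)%N) H; rewrite /= dvdn_mulr // mulKn.
Qed.
Lemma ps_substC c : ps_subst (psC c) = psC (f c).
Proof.
apply: pserP => q /=; case: dvdnP => [[s ->]|H].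
  by rewrite mulnK // muln_eq0 [e == _]gtn_eqF // orbF; case: eqP; rewrite ?rmorph0.
by case: eqP => // q0; case: H; exists 0%N; rewrite q0.
Qed.
Lemma ps_substX : ps_subst (psX k) = psX k' ^+ e.
Proof.
apply: pserP => q; rewrite -[_ ^+ e]mulr1 psXnE ps1E ps_substE; case: dvdnP => [[s ->]|H].
  rewrite mulnK //; case: s => [|[|s]] //=; rewrite ?rmorph0 ?rmorph1.
  - by case: e e0.
  - by rewrite mul1n leqnn subnn.
  by rewrite mulSn leq_addr addKn muln_eq0 [e == _]gtn_eqF // orbF.
case: ifP => // eq; case: eqP => // /eqP; rewrite subn_eq0 => qe; case: H; exists 1%N.
by rewrite mul1n; apply/eqP; rewrite eqn_leq qe eq.
Qed.
(** If z = y^e and D z = a z^(m+1), then D y = (a / e) y^(m e + 1). *)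
Lemma dps_subst (d : k -> k) (d' : k' -> k') a a' m g : derivation d' ->
  (forall x, f (d x) = d' (f x)) -> a' *+ e = f a ->
  dps d' a' (m * e) (ps_subst g) = ps_subst (dps d a m g).
Proof.
move=> dP' H Ha; apply: pserP => q; rewrite dpsE !ps_substE dpsE; case: dvdnP => [[s ->]|H'].
  rewrite mulnK // leq_pmul2r // rmorphD H; congr (_ + _); case: ifP => ms; rewrite ?rmorph0 //.
  rewrite -mulnBl dvdn_mull // mulnK // natrM !(rmorphM f) rmorph_nat -Ha -[a' *+ e]mulr_natr; ring.
rewrite (der0 dP') add0r; case: ifP => // mq; case: dvdnP; rewrite ?mulr0 // => -[s E].
by case: H'; exists (s + m)%N; rewrite mulnDl -E subnK.
Qed.
End SubstPower.

Lemma coef_exp_XsubC (F : fieldType) (s : F) d :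
  ((('X - s%:P) ^+ d.+1)`_d) = - (d.+1%:R * s).
Proof.
elim: d => [|d IH]; first by rewrite expr1 coefB coefX coefC /= sub0r mul1r.
rewrite exprSr mulrBr coefB coefMX coefMC /= IH.
have := monic_exp d.+1 (monicXsubC s); rewrite monicE lead_coefE size_exp_XsubC => /eqP ->.
by rewrite [d.+2%:R]mulrSr; ring.
Qed.

(** Without subleading coefficient, the only power of a linear polynomial still possible is X^(d+1);
    [split_root] relies on this. *)
Lemma tschirnhaus (F : fieldType) (p : {poly F}) d : size p = d.+2 -> d.+1%:R != 0 :> F ->
  exists (q : {poly F}) (s : F), [/\ q \is monic, size q = d.+2, q`_d = 0
   & forall (E : fieldType) (f : {rmorphism F -> E}) x,
       root (map_poly f q) x -> root (map_poly f p) (x - f s)].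
Proof.
move=> sp d0; have p0 : p != 0 by rewrite -size_poly_gt0 sp.
have l0 : lead_coef p != 0 by rewrite lead_coef_eq0.
pose p1 := (lead_coef p)^-1 *: p; pose s := p1`_d / d.+1%:R.
have sp1 : size p1 = d.+2 by rewrite size_scale ?invr_eq0.
have lp1 : lead_coef p1 = 1 by rewrite lead_coefZ mulVf.
exists (p1 \Po ('X - s%:P)), s; split.
- by rewrite monicE lead_coef_comp ?size_XsubC // lp1 lead_coefXsubC expr1n mulr1.
- by rewrite size_comp_poly2 ?size_XsubC.
- pose r := \poly_(i < d) p1`_i.
  have -> : p1 = 'X^(d.+1) + p1`_d *: 'X^d + r :> {poly F}.
    have cX i N : ('X^N : {poly F})`_i = if i == N then 1 else 0 by rewrite coefXn; case: eqP.
    apply/polyP => i; rewrite !coefD (coefZ p1`_d) !cX coef_poly.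
    case: (ltngtP i d) => [lt|gt|->].
    - by rewrite (ltn_eqF (ltnW lt : (i < d.+1)%N)) mulr0 !add0r.
    - rewrite mulr0 !addr0; case: eqP => [->|/eqP ne]; first by rewrite -lp1 lead_coefE sp1.
      by rewrite nth_default // sp1 ltn_neqAle eq_sym ne.
    by rewrite (ltn_eqF (ltnSn d)) mulr1 add0r addr0.
  rewrite !comp_polyD comp_polyZ !comp_Xn_poly !coefD coef_exp_XsubC coefZ.
  have := monic_exp d (monicXsubC s); rewrite monicE lead_coefE size_exp_XsubC => /eqP -> .
  rewrite [(r \Po _)`_d]nth_default ?size_comp_poly2 ?size_XsubC ?size_poly //.
  by rewrite mulr1 addr0 /s mulrCA mulfV // mulr1 addNr.
move=> E f x; rewrite /root map_comp_poly horner_comp rmorphB /= map_polyX map_polyC !hornerE.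
by rewrite map_polyZ hornerZ mulf_eq0 fmorph_eq0 invr_eq0 (negPf l0).
Qed.

(* The slope of the Newton polygon is [w / e]; the conditions on the reduction of
   [Q] prevent it from being a power of a linear polynomial. *)
Lemma newton_polygon (k : fieldType) (q : {poly {fraction (pser k)}}) d :
  (forall m, m.+1%:R != 0 :> k) -> q \is monic -> size q = d.+2 -> q`_d = 0 ->
  (exists i : 'I_d.+1, q`_i != 0) ->
  exists e (w : int) (Q : {poly pser k}), [/\ (0 < e)%N, Q \is monic, size Q = d.+2,
   (pcoef 0 Q)`_d = 0 & (exists i : 'I_d.+1, (pcoef 0 Q)`_i != 0) /\
   forall F : {rmorphism {fraction (pser k)} -> {fraction (pser k)}},
     (forall g, F (tofrac g) = tofrac (ps_subst idfun e g)) -> forall i, (i <= d.+1)%N ->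
     F q`_i = tofrac Q`_i * tofrac (psX k) ^ (w * (d.+1 - i)%N%:Z)].
Proof.
move=> chark mq sq qd [i0 i0q]; pose D := d.+1; pose zz : {fraction (pser k)} := tofrac (psX k).
have qD : q`_D = 1 by have /monicP := mq; rewrite lead_coefE sq.
have /choice [vu Hvu] : forall i : nat, exists x : int * pser k, q`_i != 0 ->
    q`_i = zz ^ x.1 * tofrac x.2 /\ x.2 0%N != 0.
  move=> i; case: (eqVneq q`_i 0) => [->|qi]; first by exists (0, 0).
  by have [v [u H]] := laur_order qi; exists (v, u).
(* Divisible by every D - i, so that all slopes times e are integers. *)
pose e := (D`!)%N; have e0 : (0 < e)%N by apply: fact_gt0.
have eD (i : 'I_D) : (e %/ (D - i) * (D - i))%N = e.
  by rewrite divnK // dvdn_fact // subn_gt0 ltn_ord leq_subr.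
pose rr (i : 'I_D) : int := (vu i).1 * (e %/ (D - i))%N%:Z.
have [i1 i1q min1] := @Order.TotalTheory.arg_minP _ int _ i0 (fun i : 'I_D => q`_i != 0) rr i0q.
(* For the least slope, q_i(z^e) z^(- w (D - i)) has order [nn i] >= 0, with value 0 at i1: this
   gives integrality and a nonzero lower coefficient of the reduction. *)
pose w := rr i1.
pose nn i := absz (e%:Z * (vu i).1 - w * (D - i)%N%:Z)%R.
pose Q := \poly_(i < D.+1) (if i == D then 1 else if q`_i == 0 then 0 else
    psX k ^+ nn i * ps_subst idfun e (vu i).2).
have rE (i : 'I_D) : e%:Z * (vu i).1 - w * (D - i)%N%:Z = (rr i - w) * (D - i)%N%:Z.
  by rewrite -{1}(eD i) PoszM /rr; ring.
have nnE (i : 'I_D) : q`_i != 0 -> (nn i)%:Z = e%:Z * (vu i).1 - w * (D - i)%N%:Z.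
  move=> qi; rewrite /nn gez0_abs // rE.
  by apply: Num.Theory.mulr_ge0; rewrite // Num.Theory.subr_ge0; apply: min1.
have z0 : zz != 0 by apply: zz_neq0.
have QD : Q`_D = 1 by rewrite coef_poly ltnSn eqxx.
have sQ : size Q = d.+2.
  apply/eqP; rewrite eqn_leq size_poly ltnNge; apply/negP => /leq_sizeP/(_ D (leqnn _)).
  by rewrite QD => /eqP; rewrite oner_eq0.
exists e, w, Q; split=> //.
- by rewrite monicE lead_coefE sQ QD.
- by rewrite coef_pcoef coef_poly (ltnW (ltnSn _)) ltn_eqF ?ltnSn // qd eqxx.
split.
  exists i1; rewrite coef_pcoef coef_poly ltnS (ltnW (ltn_ord i1)) ltn_eqF ?ltn_ord // (negPf i1q).
  have -> : nn i1 = 0%N by rewrite /nn rE subrr mul0r.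
  by rewrite expr0 mul1r ps_substE dvdn0 div0n /= (Hvu _ i1q).2.
move=> F FE i iD; have Fz v : F (zz ^ v) = zz ^ (e%:Z * v).
  by rewrite fmorphXz FE ps_substX // tofracXn exprnP exprz_exp.
rewrite coef_poly ltnS iD; case: eqP => [->|/eqP ne].
  by rewrite subnn mulr0 expr0z mulr1 qD rmorph1 tofrac1.
have {}iD : (i < D)%N by rewrite ltn_neqAle ne.
case: eqP => [->|/eqP qi]; first by rewrite rmorph0 tofrac0 mul0r.
rewrite {1}(Hvu i qi).1 rmorphM /= Fz FE tofracM tofracXn exprnP.
rewrite mulrAC -expfzDr // (nnE (Ordinal iD) qi) /= subrK; congr (_ * _).
Qed.

Lemma root_scale (L E : fieldType) (F : {rmorphism L -> E}) z (w : int) D (q Q : {poly L}) y :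
  z != 0 -> (size q <= D.+1)%N -> (size Q <= D.+1)%N ->
  (forall i, (i <= D)%N -> q`_i = Q`_i * z ^ (w * (D - i)%N%:Z)) ->
  root (map_poly F Q) y -> root (map_poly F q) (F z ^ w * y).
Proof.
move=> z0 sq sQ H /rootP r; apply/rootP.
rewrite (@horner_coef_wide _ D.+1) ?size_map_poly //.
move: r; rewrite (@horner_coef_wide _ D.+1) ?size_map_poly // => r.
transitivity (F z ^ (w * D%:Z) * \sum_(i < D.+1) (map_poly F Q)`_i * y ^+ i); last by rewrite r mulr0.
rewrite mulr_sumr; apply: eq_bigr => i _; have iD : (i <= D)%N by rewrite -ltnS.
rewrite !coef_map H //= rmorphM /= fmorphXz exprMn exprnP exprz_exp -!mulrA.
rewrite [RHS]mulrCA; congr (_ * _); rewrite mulrA -expfzDr ?fmorph_eq0 //; congr (_ ^ _ * _).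
by rewrite -mulrDr -PoszD subnK.
Qed.

(** If q were (X - c)^(d+1), the vanishing subleading coefficient would force c = 0, against the
    nonzero lower coefficient. *)
Lemma split_root (F : fieldType) (q : {poly F}) d c :
  d.+1%:R != 0 :> F -> q \is monic -> size q = d.+2 -> q`_d = 0 ->
  (exists i : 'I_d.+1, q`_i != 0) -> root q c ->
  exists mu nu h, [/\ q = ('X - c%:P) ^+ mu.+1 * h, h \is monic, size h = nu.+2,
    coprimep (('X - c%:P) ^+ mu.+1) h & d = (mu + nu).+1].
Proof.
move=> d0 mq sq qd [i qi] rq; have [m [h rh Eq]] := multiplicity_XsubC q c.
have q0 : q != 0 by rewrite monic_neq0.
have {}rh : ~~ root h c by move: rh; rewrite q0.
have mX : ('X - c%:P) ^+ m \is monic by apply: monic_exp (monicXsubC _).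
have mh : h \is monic by move: mq; rewrite Eq monicMr.
have h0 : h != 0 by apply: monic_neq0.
have szs : (size h + m = d.+2)%N by rewrite -sq Eq size_Mmonic // size_exp_XsubC addnS.
case: m mX Eq szs => [|mu] mX Eq szs; first by move: rq; rewrite Eq expr0 mulr1 (negPf rh).
case E : (size h) szs => [|[|nu]] szs; first by move/eqP: E; rewrite size_poly_eq0 (negPf h0).
  have md : mu = d by lia.
  have h1 : h = 1.
    by move: (size1_polyC (eq_leq E)) mh => ->; rewrite monicE lead_coefC => /eqP ->.
  move: Eq; rewrite h1 mul1r md => Eq; move: qd; rewrite Eq coef_exp_XsubC => /eqP.
  rewrite oppr_eq0 mulf_eq0 (negPf d0) /= => /eqP c0.
  by move: qi; rewrite Eq c0 subr0 coefXn ltn_eqF ?ltn_ord // eqxx.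
exists mu, nu, h; split=> //; last by lia.
- by rewrite mulrC.
by rewrite coprimep_expl // coprimep_sym coprimep_XsubC.
Qed.

Lemma root_map_Xn (F E : fieldType) (f : {rmorphism F -> E}) d : root (map_poly f 'X^(d.+1)) 0.
Proof. by rewrite map_polyXn /root hornerXn expr0n. Qed.

Section GoodFields.
Variables (R : realType) (n : nat) (P : 'I_n -> {mpoly (complex R)[n]}) (Q0 : Prop).
Implicit Types K : diff_ext R n.

Lemma laur_map K K' (f : {rmorphism K -> K'}) (e m : nat) (a : 'I_n -> K) (a' : 'I_n -> K')
   (aC : closed_form (@de_d _ _ K) a) (a'C : closed_form (@de_d _ _ K') a') :
  (0 < e)%N -> diff_hom f -> (forall i, a' i *+ e = f (a i)) ->
  exists F : {rmorphism laur_ext m aC -> laur_ext (m * e) a'C},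
   diff_hom F /\ forall g : pser K, F (tofrac g) = tofrac (ps_subst f e g).
Proof.
move=> e0 [fd fi] Ha; have [g gE] := ps_subst_rmorphism f e0.
pose G : {rmorphism pser K -> laur_ext (m * e) a'C} := @tofrac (pser K') \o g.
have [|F HF0] := @frac_lift _ _ G.
  by move=> x y /fr_inj; rewrite !gE; apply: ps_subst_inj.
have HF h : F (tofrac h) = tofrac (ps_subst f e h) by rewrite HF0 /= gE.
exists F; split=> //; split=> [i|p]; last first.
  by rewrite /= /laur_iota /= HF ps_substC // fi.
have dP := @de_dP _ _ K i; have dP' := @de_dP _ _ K' i.
move=> x; rewrite (derivation_frac_eq (h := F) (dpsP dP (a i) m) (@de_dP _ _ (laur_ext (m * e) a'C) i)) //.
move=> h; rewrite !HF /= laur_der_fr //; last exact: de_dP.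
by rewrite -(dps_subst e0 _ _ dP' (fd i) (Ha i)).
Qed.

(* [Q0] is the conclusion to be reached: a field of level 0 is one from which a
   multiplier can be brought down. *)
Fixpoint good (r : nat) K : Prop :=
  if r is r'.+1 then exists (k : diff_ext R n) (a : 'I_n -> k) (m : nat)
      (aC : closed_form (@de_d _ _ k) a), good r' k /\ K = laur_ext m aC
  else multiplier_in K P -> Q0.

Definition has_root_in (r : nat) K (p : {poly K}) : Prop :=
  exists (K' : diff_ext R n) (f : {rmorphism K -> K'}) (x : K'),
  [/\ good r K', diff_hom f & root (map_poly f p) x].
Definition has_roots (r : nat) : Prop :=
  forall K (p : {poly K}), good r K -> (1 < size p)%N -> has_root_in r p.

Lemma has_roots0 : has_roots 0.
Proof.
move=> K p g /diff_adjoin_root [K' [f [x [fh rx q]]]]; exists K', f, x; split=> // /q; exact: g.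
Qed.

Lemma has_roots_laurent r : has_roots r -> forall d (k : diff_ext R n) (a : 'I_n -> k) m
   (aC : closed_form (@de_d _ _ k) a) (p : {poly laur_ext m aC}),
   good r k -> (1 < size p <= d)%N -> has_root_in r.+1 p.
Proof.
move=> AP; elim=> [|N IH] k a m aC p gk /andP[p1 pN].
  by move: p1; move: pN; rewrite leqn0 => /eqP ->.
pose L := laur_ext m aC.
case E : (size p) p1 pN => [|[|d]] // _ pN.
have [q [s [mq sq qd Hq]]] := tschirnhaus E (de_natr_neq0 L d).
suff [K' [f [x [gK fh rx]]]] : has_root_in r.+1 (q : {poly L}).
  by exists K', f, (x - f s); split=> //; apply: Hq.
clear p E Hq s; pose D := d.+1.
have qD : q`_D = 1 by have /monicP := mq; rewrite lead_coefE sq.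
case: (pselect (exists i : 'I_D, q`_i != 0)) => [[i0 i0q]|H]; last first.
  have Eq : q = 'X^D.
    apply/polyP => i; rewrite coefXn; case: (ltngtP i D) => [iD|iD|->//].
      by apply/eqP/negPn/negP => ne; apply: H; exists (Ordinal iD).
    by rewrite nth_default // sq.
  exists L, idfun, 0; split; [by exists k, a, m, aC | by [] |].
  by rewrite Eq; apply: root_map_Xn.
have charK N := de_natr_neq0 k N.
have [e [w [Q [e0 mQ sQ Qd [Qi HF]]]]] := newton_polygon charK mq sq qd (ex_intro _ i0 i0q).
have ek0 : e%:R != 0 :> k by case: e e0 {HF} => // e' _; apply: de_natr_neq0.
pose a0 i := a i / e%:R.
have a0C : closed_form (@de_d _ _ k) a0.
  move=> i j; rewrite /a0 !(der_div (@de_dP _ _ k _)) !(der_nat (@de_dP _ _ k _)) !mulr0 !mul0r !subr0.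
  by rewrite aC.
have idh : @diff_hom R n k k idfun by [].
have [F0 [F0h F0E]] := @laur_map k k idfun e m a a0 aC a0C e0 idh
  (fun i => etrans (esym (mulr_natr _ _)) (divfK ek0 _)).
have sQ0 : size (pcoef 0 Q) = d.+2.
  apply/eqP; rewrite eqn_leq -{1}sQ size_poly ltnNge; apply/negP => /leq_sizeP/(_ d.+1 (leqnn _)).
  rewrite coef_pcoef; have /monicP := mQ; rewrite lead_coefE sQ => -> /eqP.
  by rewrite ps1E oner_eq0.
have mQ0 : pcoef 0 Q \is monic.
  rewrite monicE lead_coefE sQ0 coef_pcoef; have /monicP := mQ; rewrite lead_coefE sQ => ->.
  by rewrite ps1E.
have [|k' [f [c [gk' fh rc]]]] := AP _ (pcoef 0 Q) gk; first by rewrite sQ0.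
pose a1 i := f (a0 i).
have a1C : closed_form (@de_d _ _ k') a1 by move=> i j; rewrite -!fh.1 a0C.
have [F1 [F1h F1E]] := @laur_map k k' f 1 (m * e) a0 a1 a0C a1C (ltn0Sn 0) fh (fun=> erefl).
have [G GE] := ps_subst_rmorphism f (ltn0Sn 0).
pose Q' := map_poly G Q.
have EQ' : pcoef 0 Q' = map_poly f (pcoef 0 Q).
  by apply/polyP => i; rewrite coef_pcoef !coef_map coef_pcoef /= GE.
have mQ' : Q' \is monic by apply: monic_map.
have sQ' : size Q' = d.+2.
  rewrite size_map_inj_poly ?rmorph0 // => x y; rewrite !GE; exact: ps_subst_inj.
have [mu [nu [h0 [EQ mh sh cop dE]]]] : exists mu nu h, [/\ pcoef 0 Q' = ('X - c%:P) ^+ mu.+1 * h,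
    h \is monic, size h = nu.+2, coprimep (('X - c%:P) ^+ mu.+1) h & d = (mu + nu).+1].
  rewrite EQ'; apply: (split_root (de_natr_neq0 k' d) _ _ _ _ rc).
  - exact: monic_map.
  - by rewrite size_map_poly.
  - by rewrite coef_map Qd; apply: rmorph0.
  by case: Qi => i Qi; exists i; rewrite coef_map fmorph_eq0.
have [|g [h [EQg sg mg]]] := hensel (size_exp_XsubC _ _) sh _ mQ' (monic_exp _ (monicXsubC c)) mh cop EQ.
  by rewrite sQ' dE addnS.
pose fr' : {rmorphism pser k' -> laur_ext (m * e * 1) a1C} := @tofrac (pser k').
have sg' : size (map_poly fr' g) = mu.+2.
  by rewrite size_map_inj_poly ?rmorph0 //; apply: fr_inj.
have [|K' [F2 [x [gK' F2h rx]]]] := IH k' a1 _ a1C (map_poly fr' g) gk'.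
  by rewrite sg' /= -ltnS (leq_trans _ pN) // dE !ltnS leq_addr.
pose F21 : {rmorphism laur_ext (m * e) a0C -> K'} := F2 \o F1.
pose F210 : {rmorphism laur_ext m aC -> K'} := F21 \o F0.
pose fr0 : {rmorphism pser k -> laur_ext (m * e) a0C} := @tofrac (pser k).
exists K', F210, (F21 (fr0 (psX k)) ^ w * x); split=> //.
  exact: diff_hom_comp F0h (diff_hom_comp F1h F2h).
have -> : map_poly F210 q = map_poly F21 (map_poly F0 q) by rewrite -map_poly_comp.
apply: (@root_scale _ _ F21 _ w d.+1 _ (map_poly fr0 Q)).
- exact: zz_neq0.
- by rewrite size_map_poly sq.
- by rewrite size_map_inj_poly ?rmorph0 ?sQ //; apply: fr_inj.
- by move=> i iD; rewrite !coef_map; apply: HF.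
have -> : map_poly F21 (map_poly fr0 Q) = map_poly F2 (map_poly fr' Q').
  by apply/polyP => i; rewrite !coef_map /= F1E GE.
by rewrite EQg !rmorphM rootM rx.
Qed.

Lemma has_roots_all r : has_roots r.
Proof.
elim: r => [|r IH]; first exact: has_roots0.
move=> K p [k [a [m [aC [gk E]]]]]; subst K => p1.
by apply: (has_roots_laurent IH (d := size p)) => //; rewrite p1 leqnn.
Qed.
End GoodFields.

(** * Embedding a Liouvillian tower *)

Section LaurentTranscendental.
Variable k : fieldType.
Lemma horner_zz (p : {poly k}) (f : {rmorphism k -> {fraction (pser k)}}) :
  (forall c, f c = tofrac (psC c)) ->
  (map_poly f p).[tofrac (psX k)] = tofrac (PSer (fun i => p`_i)).
Proof.
move=> fE; rewrite horner_coef size_map_poly.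
transitivity (tofrac (\sum_(i < size p) psC p`_i * psX k ^+ i)).
  rewrite rmorph_sum; apply: eq_bigr => i _.
  by rewrite coef_map /= fE tofracM tofracXn.
congr tofrac; apply: pserP => q; rewrite ps_sum [RHS]/=.
have E i : (psC p`_i * psX k ^+ i) q = if i == q then p`_q else 0.
  rewrite -[psX k ^+ i]mulr1 psCM psXnE ps1E subn_eq0.
  case: (ltngtP i q) => [lt|gt|->]; rewrite ?mulr0 ?mulr1 //.
under eq_bigr => i _ do rewrite E.
case: (ltnP q (size p)) => qs.
  rewrite (bigD1 (Ordinal qs)) //= eqxx big1 ?addr0 // => i iq.
  by rewrite -val_eqE /= in iq; rewrite (negPf iq).
by rewrite nth_default // big1 // => i _; case: eqP.
Qed.

Lemma zz_transcendental (p : {poly k}) (f : {rmorphism k -> {fraction (pser k)}}) :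
  (forall c, f c = tofrac (psC c)) -> (map_poly f p).[tofrac (psX k)] = 0 -> p = 0.
Proof.
move=> fE; rewrite horner_zz // => /eqP; rewrite tofrac_eq0 => /eqP H.
by apply/polyP => i; rewrite coef0; have := congr1 (fun g : pser k => g i) H.
Qed.
End LaurentTranscendental.

(** A relation for z^-1 becomes one for z on reversing the coefficients. *)
Lemma transcendental_inv (k L : fieldType) (f : {rmorphism k -> L}) z :
  z != 0 -> (forall p, (map_poly f p).[z] = 0 -> p = 0) -> forall p, (map_poly f p).[z^-1] = 0 -> p = 0.
Proof.
move=> z0 H p pz; pose N := size p; pose r := \poly_(i < N) p`_(N - i.+1).
have r0 : r = 0.
  apply: H; transitivity (z ^+ N * z^-1 * (map_poly f p).[z^-1]); last by rewrite pz mulr0.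
  rewrite (@horner_coef_wide _ N) ?size_map_poly ?size_poly //.
  rewrite (@horner_coef_wide _ N) ?size_map_poly // mulr_sumr (reindex_inj rev_ord_inj).
  apply: eq_bigr => i _ /=; rewrite !coef_map coef_poly /= ltn_subrL.
  have -> : (0 < N)%N by rewrite (leq_ltn_trans _ (ltn_ord i)).
  have -> : (N - (N - i.+1).+1)%N = i by have := ltn_ord i; lia.
  have aux A B c : B != 0 -> c * A = A * (z * B) * z^-1 * (c / B) :> L.
    by move=> B0; field; rewrite B0.
  by rewrite (aux _ (z ^+ i)) ?expf_neq0 // -exprS -exprD subnK ?ltn_ord // exprVn.
apply/polyP => i; rewrite coef0; case: (ltnP i N) => iN; last by rewrite nth_default.
have := congr1 (fun q : {poly k} => q`_(N - i.+1)) r0; rewrite coef0 coef_poly.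
have -> : (N - i.+1 < N)%N by lia.
by have -> : (N - (N - i.+1).+1)%N = i by lia.
Qed.

(** * Partial isomorphisms of differential fields *)

Section Correspondence.
Variables (R : realType) (n : nat).
Implicit Types E k : diff_ext R n.

(* An isomorphism of differential fields between a subfield of [E] (the domain of
   [G]) and a subfield of [k], as a relation. *)
Record diff_corr E k (G : E -> k -> Prop) : Prop := DiffCorr {
  dc_iota : forall p, G (de_iota E p) (de_iota k p);
  dc_add : forall x y x' y', G x x' -> G y y' -> G (x + y) (x' + y');
  dc_opp : forall x x', G x x' -> G (- x) (- x');
  dc_mul : forall x y x' y', G x x' -> G y y' -> G (x * y) (x' * y');
  dc_inv : forall x x', G x x' -> G x^-1 x'^-1;
  dc_d : forall i x x', G x x' -> G (de_d i x) (de_d i x');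
  dc_inj : forall x', G 0 x' -> x' = 0 }.

Section Basics.
Variables (E k : diff_ext R n) (G : E -> k -> Prop).
Hypothesis GP : diff_corr G.
Lemma dc_0 : G 0 0. Proof. by have := dc_iota GP 0; rewrite !rmorph0. Qed.
Lemma dc_1 : G 1 1. Proof. by have := dc_iota GP 1; rewrite !rmorph1. Qed.
Lemma dc_sum I (s : seq I) (Q : pred I) F F' : (forall i, Q i -> G (F i) (F' i)) ->
  G (\sum_(i <- s | Q i) F i) (\sum_(i <- s | Q i) F' i).
Proof.
by move=> H; elim/big_ind2: _ => //; [exact: dc_0 | move=> *; apply: (dc_add GP)].
Qed.
Lemma dc_prod I (s : seq I) (Q : pred I) F F' : (forall i, Q i -> G (F i) (F' i)) ->
  G (\prod_(i <- s | Q i) F i) (\prod_(i <- s | Q i) F' i).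
Proof.
by move=> H; elim/big_ind2: _ => //; [exact: dc_1 | move=> *; apply: (dc_mul GP)].
Qed.
Lemma dc_exp x x' m : G x x' -> G (x ^+ m) (x' ^+ m).
Proof. by move=> H; elim: m => [|m IH]; [exact: dc_1 | rewrite !exprS; apply: (dc_mul GP)]. Qed.
Lemma dc_inj_r x : G x 0 -> x = 0.
Proof.
move=> H; apply/eqP/negPn/negP => x0; have := dc_mul GP H (dc_inv GP H).
rewrite mulfV // mul0r => H1; have := dc_add GP (dc_opp GP H1) dc_1.
by rewrite addNr oppr0 add0r => /(dc_inj GP)/eqP; rewrite oner_eq0.
Qed.
Lemma dc_eq0 x x' : G x x' -> (x == 0) = (x' == 0).
Proof.
move=> H; apply/eqP/eqP => e; move: H; rewrite e; first exact: (dc_inj GP).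
exact: dc_inj_r.
Qed.
Lemma dc_fun x x' x'' : G x x' -> G x x'' -> x' = x''.
Proof.
move=> H1 H2; apply/eqP; rewrite -subr_eq0; apply/eqP; apply: (dc_inj GP).
by rewrite -(subrr x); apply: (dc_add GP) => //; apply: (dc_opp GP).
Qed.

Definition pcorr (a : {poly E}) (a' : {poly k}) := forall i, G a`_i a'`_i.
Lemma pcorr0 : pcorr 0 0. Proof. by move=> i; rewrite !coef0; apply: dc_0. Qed.
Lemma pcorrC x x' : G x x' -> pcorr x%:P x'%:P.
Proof. by move=> H i; rewrite !coefC; case: eqP => // _; apply: dc_0. Qed.
Lemma pcorrX : pcorr 'X 'X.
Proof. by move=> i; rewrite !coefX; case: eqP => _; [apply: dc_1 | apply: dc_0]. Qed.
Lemma pcorrD a b a' b' : pcorr a a' -> pcorr b b' -> pcorr (a + b) (a' + b').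
Proof. by move=> H1 H2 i; rewrite !coefD; apply: (dc_add GP). Qed.
Lemma pcorrN a a' : pcorr a a' -> pcorr (- a) (- a').
Proof. by move=> H i; rewrite !coefN; apply: (dc_opp GP). Qed.
Lemma pcorrM a b a' b' : pcorr a a' -> pcorr b b' -> pcorr (a * b) (a' * b').
Proof. by move=> H1 H2 i; rewrite !coefM; apply: dc_sum => j _; apply: (dc_mul GP). Qed.
Lemma pcorr_size a a' : pcorr a a' -> size a = size a'.
Proof.
move=> H; apply/eqP; rewrite eqn_leq; apply/andP; split; apply/leq_sizeP => j jq; apply/eqP.
  by rewrite (dc_eq0 (H j)) nth_default.
by rewrite -(dc_eq0 (H j)) nth_default.
Qed.
Lemma pcorr_map_der i a a' : pcorr a a' -> pcorr (map_poly (@de_d _ _ E i) a) (map_poly (@de_d _ _ k i) a').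
Proof. by move=> H j; rewrite !coef_map_der; [apply: (dc_d GP) | exact: de_dP..]. Qed.
Lemma pcorr_deriv a a' : pcorr a a' -> pcorr a^`() a'^`().
Proof.
move=> H j; rewrite !coef_deriv -(mulr_natr a`_j.+1) -(mulr_natr a'`_j.+1); apply: (dc_mul GP) => //.
by have := dc_iota GP (j.+1%:R); rewrite !rmorph_nat.
Qed.
Lemma pcorr_horner a a' x x' : pcorr a a' -> G x x' -> G a.[x] a'.[x'].
Proof.
move=> H Hx; rewrite !horner_coef -(pcorr_size H); apply: dc_sum => i _.
by apply: (dc_mul GP) => //; apply: dc_exp.
Qed.
(** Long division run in parallel on both sides: [G] is only a relation, so quotient and remainder
    must be built within it. *)
Lemma pcorr_dvd b b' : pcorr b b' -> b != 0 -> forall a a', pcorr a a' ->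
  exists q q' r r', [/\ pcorr q q', pcorr r r', a = q * b + r, a' = q' * b' + r' & (size r < size b)%N].
Proof.
move=> Hb b0 a; have [N] := ubnP (size a); elim: N a => // N IH a; rewrite ltnS => aN a' Ha.
case: (ltnP (size a) (size b)) => ab.
  by exists 0, 0, a, a'; split; rewrite ?mul0r ?add0r //; apply: pcorr0.
have a0 : a != 0 by rewrite -size_poly_gt0 (leq_trans _ ab) // size_poly_gt0.
have lb : lead_coef b != 0 by rewrite lead_coef_eq0.
have Hl p p' : pcorr p p' -> G (lead_coef p) (lead_coef p').
  by move=> H; rewrite !lead_coefE -(pcorr_size H).
have HXn m : pcorr ('X^m) ('X^m).
  by move=> i; rewrite !coefXn; case: eqP => _; [apply: dc_1 | apply: dc_0].
pose q := (lead_coef a / lead_coef b)%:P * 'X^(size a - size b).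
pose q' := (lead_coef a' / lead_coef b')%:P * 'X^(size a - size b).
have Hq : pcorr q q'.
  by apply: pcorrM => //; apply: pcorrC; apply: (dc_mul GP); [|apply: (dc_inv GP)]; apply: Hl.
have ca0 : lead_coef a / lead_coef b != 0 by rewrite mulf_neq0 ?invr_eq0 // lead_coef_eq0.
have sq : size (q * b) = size a.
  have sq0 : size q = (size a - size b).+1 by rewrite /q mul_polyC size_scale // size_polyXn.
  by rewrite size_mul // ?sq0 ?addSn /= ?subnK // -size_poly_gt0 sq0.
have lq : lead_coef (q * b) = lead_coef a.
  by rewrite lead_coefM lead_coefM lead_coefC lead_coefXn mulr1 divfK.
have sr : (size (a - q * b)%R < size a)%N.
  have sle : (size (a - q * b)%R <= size a)%N.
    by apply: leq_trans (size_polyD _ _) _; rewrite size_polyN sq maxnn.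
  rewrite ltn_neqAle sle andbT; apply/negP => /eqP e.
  have : lead_coef (a - q * b) = 0.
    have lq' : (q * b)`_(size a).-1 = a`_(size a).-1 by rewrite -{1}sq -!lead_coefE lq.
    by rewrite lead_coefE e coefB lq' subrr.
  move/eqP; rewrite lead_coef_eq0 -size_poly_eq0 e size_poly_eq0; exact/negP.
have [||p [p' [r [r' [Hp Hr E1 E2 sr']]]]] := IH (a - q * b) _ (a' - q' * b').
- exact: leq_trans sr aN.
- by apply: pcorrD => //; apply/pcorrN/pcorrM.
exists (p + q), (p' + q'), r, r'; split=> //; first exact: pcorrD.
  by rewrite mulrDl addrAC -E1 subrK.
by rewrite mulrDl addrAC -E2 subrK.
Qed.
End Basics.

Section Adjoin.
Variables (E k k' : diff_ext R n) (G : E -> k -> Prop) (f : {rmorphism k -> k'}) (t : E) (s : k').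
Hypotheses (GP : diff_corr G) (fP : diff_hom f).

(** The pairs generated under field operations by [G] and (t, s). It is a correspondence when t and
    s satisfy the same polynomial relations and their derivatives correspond. *)
Inductive adj_corr : E -> k' -> Prop :=
| adj_base x y : G x y -> adj_corr x (f y)
| adj_gen : adj_corr t s
| adj_add x y x' y' : adj_corr x x' -> adj_corr y y' -> adj_corr (x + y) (x' + y')
| adj_opp x x' : adj_corr x x' -> adj_corr (- x) (- x')
| adj_mul x y x' y' : adj_corr x x' -> adj_corr y y' -> adj_corr (x * y) (x' * y')
| adj_inv x x' : adj_corr x x' -> adj_corr x^-1 x'^-1.

Lemma adj_horner a a' : pcorr G a a' -> adj_corr a.[t] (map_poly f a').[s].
Proof.
move=> H; rewrite !horner_coef size_map_poly -(pcorr_size GP H).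
have H0 : adj_corr 0 0 by rewrite -(rmorph0 f); apply: adj_base; apply: dc_0.
elim/big_ind2: _ => // [*|i _]; first exact: adj_add.
rewrite coef_map; apply: adj_mul; first exact: adj_base.
elim: (nat_of_ord i) => [|m IH]; first by rewrite !expr0 -(rmorph1 f); apply: adj_base; apply: dc_1.
by rewrite !exprS; apply: adj_mul => //; apply: adj_gen.
Qed.

Hypothesis zero : forall a a', pcorr G a a' -> a.[t] = 0 <-> (map_poly f a').[s] = 0.
Hypothesis der_gen : forall i, adj_corr (de_d i t) (de_d i s).

(** This normal form reduces injectivity of [adj_corr] to the hypothesis [zero] on numerators. *)
Lemma adj_frac x y : adj_corr x y -> exists a a' b b', [/\ pcorr G a a', pcorr G b b',
  b.[t] != 0, x = a.[t] / b.[t] & y = (map_poly f a').[s] / (map_poly f b').[s]].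
Proof.
have H1 : pcorr G 1 1 by apply: pcorrC => //; exact: dc_1.
have Hn b b' : pcorr G b b' -> b.[t] != 0 -> (map_poly f b').[s] != 0.
  by move=> Hb; apply: contra_neq => /(zero Hb).
elim=> {x y}.
- move=> x y H; exists x%:P, y%:P, 1, 1; split=> //; first exact: pcorrC.
  + by rewrite hornerC oner_neq0.
  + by rewrite !hornerC divr1.
  by rewrite map_polyC rmorph1 !hornerC divr1.
- exists 'X, 'X, 1, 1; split=> //; first exact: pcorrX.
  + by rewrite hornerC oner_neq0.
  + by rewrite hornerX hornerC divr1.
  by rewrite map_polyX rmorph1 hornerX hornerC divr1.
- move=> x y x' y' _ [a [a' [b [b' [Ha Hb b0 -> ->]]]]] _ [c [c' [e [e' [Hc He e0 -> ->]]]]].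
  exists (a * e + c * b), (a' * e' + c' * b'), (b * e), (b' * e'); split.
  + by apply: pcorrD => //; apply: pcorrM.
  + exact: pcorrM.
  + by rewrite hornerM mulf_neq0.
  + by rewrite hornerD !hornerM frac_sum.
  by rewrite rmorphD !rmorphM hornerD !hornerM frac_sum ?(Hn _ _ Hb b0) ?(Hn _ _ He e0).
- move=> x x' _ [a [a' [b [b' [Ha Hb b0 -> ->]]]]]; exists (- a), (- a'), b, b'; split=> //.
  + exact: pcorrN.
  + by rewrite hornerN mulNr.
  by rewrite rmorphN hornerN mulNr.
- move=> x y x' y' _ [a [a' [b [b' [Ha Hb b0 -> ->]]]]] _ [c [c' [e [e' [Hc He e0 -> ->]]]]].
  exists (a * c), (a' * c'), (b * e), (b' * e'); split; try exact: pcorrM.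
  + by rewrite hornerM mulf_neq0.
  + by rewrite !hornerM frac_prod.
  by rewrite !rmorphM !hornerM frac_prod ?(Hn _ _ Hb b0) ?(Hn _ _ He e0).
move=> x x' _ [a [a' [b [b' [Ha Hb b0 -> ->]]]]].
have [/eqP a0|a0] := boolP (a.[t] == 0).
  have /(zero Ha) a'0 := a0; exists 0, 0, 1, 1; split=> //; first exact: pcorr0.
  + by rewrite hornerC oner_neq0.
  + by rewrite a0 mul0r invr0 horner0 mul0r.
  by rewrite a'0 mul0r invr0 rmorph0 horner0 mul0r.
by exists b, b', a, a'; split=> //; rewrite invfM invrK mulrC.
Qed.

Lemma adj_corrP : diff_corr adj_corr.
Proof.
split.
- by move=> p; rewrite -fP.2; apply: adj_base; apply: (dc_iota GP).
- exact: adj_add.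
- exact: adj_opp.
- exact: adj_mul.
- exact: adj_inv.
- have dP i := @de_dP _ _ E i; have dP' i := @de_dP _ _ k' i.
  move=> i x x'; elim=> {x x'}.
  + by move=> x y H; rewrite -fP.1; apply: adj_base; apply: (dc_d GP).
  + exact: der_gen.
  + by move=> x y x' y' _ H1 _ H2; rewrite !de_dD; apply: adj_add.
  + by move=> x x' _ H; rewrite (derN (dP i)) (derN (dP' i)); apply: adj_opp.
  + move=> x y x' y' H1 H1' H2 H2'; rewrite !de_dM.
    by apply: adj_add; apply: adj_mul.
  move=> x x' H H'; rewrite (derV (dP i)) (derV (dP' i)) !expr2.
  by apply: adj_mul; [apply: adj_opp | apply: adj_inv; apply: adj_mul].
move=> x' /adj_frac [a [a' [b [b' [Ha Hb b0 E0 ->]]]]].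
have : a.[t] = 0.
  by apply/eqP; move/eqP: E0; rewrite eq_sym mulf_eq0 invr_eq0 (negPf b0) orbF.
by move/(zero Ha) => ->; rewrite mul0r.
Qed.
End Adjoin.
End Correspondence.

Lemma der_inv_square (K : fieldType) (c z : K) : z != 0 -> - (- c * z ^+ 2) / z ^+ 2 = c.
Proof. by move=> z0; rewrite !mulNr opprK mulfK // expf_neq0. Qed.

Section Embedding.
Variables (R : realType) (n : nat) (P : 'I_n -> {mpoly (complex R)[n]}) (Q0 : Prop).
Implicit Types E k : diff_ext R n.
Local Notation good := (@good R n P Q0).

Definition laur_C k (a : 'I_n -> k) m (aC : closed_form (@de_d _ _ k) a) :
  {rmorphism k -> laur_ext m aC} := @tofrac (pser k) \o (@psC k).
Lemma laur_C_hom k (a : 'I_n -> k) m (aC : closed_form (@de_d _ _ k) a) : diff_hom (laur_C m aC).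
Proof.
split=> [i x|p] //=; rewrite /laur_C /= laur_der_fr; last exact: de_dP.
by rewrite dpsC //; apply: de_dP.
Qed.

Definition corr_adjoins E k (G : E -> k -> Prop) (t : E) r : Prop :=
  exists (k' : diff_ext R n) (G' : E -> k' -> Prop), good r k' /\
  [/\ diff_corr G', (forall x x', G x x' -> exists x'', G' x x'') & exists s, G' t s].

(** t is sent to a root s of the counterpart of its minimal polynomial over the domain of [G]; the
    derivatives of t and s are given by that polynomial, so they correspond. *)
Lemma adjoin_corr_algebraic E k (G : E -> k -> Prop) (t : E) r : diff_corr G -> good r k ->
  (exists a a', [/\ pcorr G a a', a != 0 & a.[t] = 0]) -> corr_adjoins G t r.
Proof.
move=> GP gk Halg.
pose S m := `[< exists a a', [/\ pcorr G a a', a != 0, a.[t] = 0 & size a = m]>].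
have exS : exists m, S m.
  by case: Halg => a [a' [H1 H2 H3]]; exists (size a); apply/asboolP; exists a, a'.
case: (ex_minnP exS) => m /asboolP [mu [mu' [Hmu mu0 mut sm]]] minS.
have minmu a a' : pcorr G a a' -> a.[t] = 0 -> (size a < size mu)%N -> a = 0.
  move=> Ha at0; rewrite sm => sa; apply/eqP/negPn/negP => a0; have : S (size a).
    by apply/asboolP; exists a, a'.
  by move/minS; rewrite leqNgt sa.
have smu := pcorr_size GP Hmu.
have smu1 : (1 < size mu)%N.
  rewrite ltnNge; apply/negP => /size1_polyC e; move: mut mu0; rewrite e hornerC => ->.
  by rewrite eqxx.
have [|k' [f [s [gk' fh /rootP rs]]]] := has_roots_all (p := mu') gk; first by rewrite -smu.
have eq0 a a' : pcorr G a a' -> a = 0 -> a' = 0.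
  by move=> /(pcorr_size GP) e a0; apply/eqP; rewrite -size_poly_eq0 -e a0 size_poly0.
have zero1 a a' : pcorr G a a' -> a.[t] = 0 -> (map_poly f a').[s] = 0.
  move=> Ha at0; have [q [q' [p [p' [Hq Hp Ea Ea' sp]]]]] := pcorr_dvd GP Hmu mu0 Ha.
  have p0 : p = 0.
    by apply: minmu Hp _ sp; move: at0; rewrite Ea hornerD hornerM mut mulr0 add0r.
  by rewrite Ea' (eq0 _ _ Hp p0) addr0 rmorphM hornerM rs mulr0.
(* The smallest relation nu at s divides mu. The cofactor cannot vanish at t by minimality of mu, so
   nu does, and every relation at s is a multiple of nu. *)
have zero2 a a' : pcorr G a a' -> (map_poly f a').[s] = 0 -> a.[t] = 0.
  pose S2 m := `[< exists a a', [/\ pcorr G a a', a != 0, (map_poly f a').[s] = 0 & size a = m]>].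
  have exS2 : exists m, S2 m by exists m; apply/asboolP; exists mu, mu'.
  case: (ex_minnP exS2) => m2 /asboolP [nu [nu' [Hnu nu0 nus sm2]]] minS2.
  have minnu b b' : pcorr G b b' -> (map_poly f b').[s] = 0 -> (size b < size nu)%N -> b = 0.
    move=> Hb bs; rewrite sm2 => sb; apply/eqP/negPn/negP => b0; have : S2 (size b).
      by apply/asboolP; exists b, b'.
    by move/minS2; rewrite leqNgt sb.
  have dvd b b' : pcorr G b b' -> (map_poly f b').[s] = 0 -> exists q q', pcorr G q q' /\ b = q * nu.
    move=> Hb bs; have [q [q' [p [p' [Hq Hp Eb Eb' sp]]]]] := pcorr_dvd GP Hnu nu0 Hb.
    exists q, q'; split=> //; rewrite {1}Eb (minnu _ _ Hp _ sp) ?addr0 //.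
    by move: bs; rewrite Eb' rmorphD rmorphM hornerD hornerM nus mulr0 add0r.
  have nut : nu.[t] = 0.
    have [q [q' [Hq Emu]]] := dvd _ _ Hmu rs.
    have q0 : q != 0 by apply: contraNneq mu0 => e; rewrite Emu e mul0r.
    apply/eqP; move: mut; rewrite Emu hornerM => /eqP; rewrite mulf_eq0 => /orP[/eqP qt|//].
    have : ~~ (size q < size mu)%N by apply: contraNN q0 => /(minmu _ _ Hq qt) ->.
    have snu : (0 < size nu)%N by rewrite size_poly_gt0.
    rewrite -leqNgt Emu size_mul // => le.
    have nu1 : (size nu <= 1)%N by move: snu le; case: (size nu) => // z _; by rewrite addnS /= -{2}[size q]addn0 leq_add2l ltnS.
    have nu'1 : (size nu' <= 1)%N by rewrite -(pcorr_size GP Hnu).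
    move: nus; rewrite (size1_polyC nu'1) map_polyC hornerC => /eqP; rewrite fmorph_eq0 => /eqP e.
    have nu'0 : size nu' = 0%N by rewrite (size1_polyC nu'1) e polyC0 size_poly0.
    by move: snu; rewrite (pcorr_size GP Hnu) nu'0.
  by move=> Ha /(dvd _ _ Ha) [q [q' [_ ->]]]; rewrite hornerM nut mulr0.
have zero a a' : pcorr G a a' -> a.[t] = 0 <-> (map_poly f a').[s] = 0.
  by move=> Ha; split; [apply: zero1 | apply: zero2].
have sep : mu^`().[t] != 0.
  apply/eqP => d0; have dd : mu^`() = 0.
    by apply: (minmu _ _ (pcorr_deriv GP Hmu) d0); apply: lt_size_deriv.
  have sz : (size mu).-2.+1 = (size mu).-1 by case: (size mu) smu1 => [|[]].
  have := congr1 (fun p : {poly E} => p`_(size mu).-2) dd.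
  rewrite coef_deriv coef0 -mulr_natl sz => /eqP; rewrite mulf_eq0 -lead_coefE lead_coef_eq0 (negPf mu0) orbF.
  by rewrite -sz (negPf (de_natr_neq0 _ _)).
exists k', (adj_corr G f t s); split=> //; split.
- apply: adj_corrP => // i.
  have dt : de_d i t = - (map_poly (@de_d _ _ E i) mu).[t] / mu^`().[t].
    have idr : forall x : E, de_d i ((idfun : {rmorphism E -> E}) x) = idfun (de_d i x) by [].
    have := derivation_horner mu t (@de_dP _ _ E i) (@de_dP _ _ E i) idr.
    have idm (p : {poly E}) : map_poly (idfun : {rmorphism E -> E}) p = p by apply: map_poly_id.
    rewrite !idm mut (der0 (@de_dP _ _ E i)) => e.
    by apply: (mulfI sep); rewrite mulrCA mulfV // mulr1; apply/eqP; rewrite -addr_eq0 addrC -e.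
  have sep' : (map_poly f mu'^`()).[s] != 0 by apply: contra_neq sep => /(zero _ _ (pcorr_deriv GP Hmu)).
  have ds : de_d i s = - (map_poly f (map_poly (@de_d _ _ k i) mu')).[s] / (map_poly f mu'^`()).[s].
    have := derivation_horner mu' s (@de_dP _ _ k i) (@de_dP _ _ k' i) (fun x => esym (fh.1 i x)).
    rewrite rs (der0 (@de_dP _ _ k' i)) => e.
    by apply: (mulfI sep'); rewrite mulrCA mulfV // mulr1; apply/eqP; rewrite -addr_eq0 addrC -e.
  rewrite dt ds; apply: adj_mul; [apply: adj_opp | apply: adj_inv]; apply: adj_horner => //.
    exact: pcorr_map_der.
  exact: pcorr_deriv.
- by move=> x x' H; exists (f x'); apply: adj_base.
by exists s; apply: adj_gen.
Qed.

Lemma adjoin_corr_laurent E k (G : E -> k -> Prop) (t : E) r (a : 'I_n -> k) m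
   (aC : closed_form (@de_d _ _ k) a) (s : laur_ext m aC) : diff_corr G -> good r k ->
  (forall p p', pcorr G p p' -> p.[t] = 0 -> p = 0) ->
  (forall p : {poly k}, (map_poly (laur_C m aC) p).[s] = 0 -> p = 0) ->
  (forall i, adj_corr G (laur_C m aC) t s (de_d i t) (de_d i s)) ->
  corr_adjoins G t r.+1.
Proof.
move=> GP gk Ht Hs Hd; exists (laur_ext m aC), (adj_corr G (laur_C m aC) t s); split.
  by exists k, a, m, aC.
split; last by exists s; apply: adj_gen.
  apply: adj_corrP => // [|p p' Hp]; first exact: laur_C_hom.
  have sp := pcorr_size GP Hp; split=> [/(Ht _ _ Hp) p0|/Hs p0].
    suff -> : p' = 0 by rewrite rmorph0 horner0.
    by apply/eqP; rewrite -size_poly_eq0 -sp p0 size_poly0.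
  suff -> : p = 0 by rewrite horner0.
  by apply/eqP; rewrite -size_poly_eq0 sp p0 size_poly0.
by move=> x x' H; exists (laur_C m aC x'); apply: adj_base.
Qed.

Lemma laur_C_trans k (a : 'I_n -> k) m (aC : closed_form (@de_d _ _ k) a) (p : {poly k}) :
  (map_poly (laur_C m aC) p).[tofrac (psX k)] = 0 -> p = 0.
Proof. exact: zz_transcendental. Qed.

(** Algebraic or transcendental is decided over the domain of [G], which may exceed the tower field:
    a generator transcendental over the latter can become algebraic once other towers are
    embedded. *)
Lemma adjoin_corr E k (G : E -> k -> Prop) (t : E) r : diff_corr G -> good r k ->
  [\/ (exists a a', [/\ pcorr G a a', a != 0 & a.[t] = 0]), (forall i, exists c, G (de_d i t / t) c)
    | (forall i, exists c, G (de_d i t) c)] ->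
  exists r', corr_adjoins G t r'.
Proof.
move=> GP gk H; have [Halg|Htr] := pselect (exists a a', [/\ pcorr G a a', a != 0 & a.[t] = 0]).
  by exists r; apply: adjoin_corr_algebraic.
have {}Htr p p' : pcorr G p p' -> p.[t] = 0 -> p = 0.
  by move=> Hp pt; apply/eqP/negPn/negP => p0; apply: Htr; exists p, p'.
have dE i := @de_dP _ _ E i; have dk i := @de_dP _ _ k i.
exists r.+1; case: H => [[a [a' [Ha a0 at0]]]|/choice [c Hc]|/choice [c Hc]].
- by move: a0; rewrite (Htr _ _ Ha at0) eqxx.
- have t0 : t != 0.
    apply/eqP => t0; have := Htr _ _ (pcorrX GP); rewrite hornerX => /(_ t0)/eqP.
    by rewrite polyX_eq0.
  have cC : closed_form (@de_d _ _ k) c.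
    move=> i j; apply: (dc_fun GP (x := de_d i (de_d j t / t))); first exact: (dc_d GP).
    have -> : de_d i (de_d j t / t) = de_d j (de_d i t / t).
      rewrite !(der_div (dE _)) de_comm; congr (_ - _ / _); exact: mulrC.
    exact: (dc_d GP).
  apply: (@adjoin_corr_laurent _ _ _ _ _ c 0 cC (tofrac (psX k))) => //; first exact: laur_C_trans.
  move=> i; have -> : de_d i t = de_d i t / t * t by rewrite divfK.
  have -> : @de_d _ _ (laur_ext 0 cC) i (tofrac (psX k)) = laur_C 0 cC (c i) * tofrac (psX k).
    by rewrite [LHS](@D_zz k (@de_d _ _ k i) (c i) 0 (dk i)) /dlogz expr0 mulr1.
  by apply: adj_mul; [apply: adj_base | apply: adj_gen].
(* A primitive t is sent to 1/z, and D (1/z) = c means D z = - c z^2. *)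
have cC : closed_form (@de_d _ _ k) (fun i => - c i).
  move=> i j; rewrite !(derN (dk _)); congr (- _).
  apply: (dc_fun GP (x := de_d i (de_d j t))); first exact: (dc_d GP).
  by rewrite de_comm; exact: (dc_d GP).
pose z : laur_ext 1 cC := tofrac (psX k).
have z0 : z != 0 by apply: zz_neq0.
apply: (@adjoin_corr_laurent _ _ _ _ _ _ 1 cC z^-1) => //.
  by apply: (transcendental_inv z0); apply: laur_C_trans.
move=> i; have -> : de_d i z^-1 = laur_C 1 cC (c i); last by apply: adj_base.
have dz : de_d i z = - laur_C 1 cC (c i) * z ^+ 2.
  rewrite [LHS](@D_zz k (@de_d _ _ k i) (- c i) 1 (dk i)) /dlogz expr1 tofracM rmorphN tofracN.
  by rewrite expr2 mulrA.
by rewrite (derV (@de_dP _ _ (laur_ext 1 cC) i)) dz; apply: der_inv_square.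
Qed.

(** Quantified over every good field and every [G], so that the towers of the several first
    integrals can be embedded one after another in a common field. *)
Definition tower_embeds E (K : E -> Prop) : Prop := forall k (G : E -> k -> Prop) r,
  diff_corr G -> good r k ->
  exists r' (k' : diff_ext R n) (G' : E -> k' -> Prop), [/\ good r' k', diff_corr G',
    forall x x', G x x' -> exists x'', G' x x'' & forall x, K x -> exists x', G' x x'].

Lemma tower_corr E (K : E -> Prop) : liouville_tower_field K -> tower_embeds K.
Proof.
have lift k (G : E -> k -> Prop) (K' : E -> Prop) a : diff_corr G ->
    (forall x, K' x -> exists x', G x x') -> poly_over K' a -> exists a', pcorr G a a'.
  move=> GP HK /(_ _)/HK Ha; have {Ha} /choice [c Hc] : forall i, exists x', G a`_i x' by move=> i; apply: Ha.
  exists (\poly_(i < size a) c i) => i; rewrite coef_poly; case: ltnP => // ia.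
  by rewrite nth_default //; apply: dc_0.
suff step (K' : E -> Prop) (t : E) : tower_embeds K' ->
    [\/ algebraic_over K' t, forall i, K' (de_d i t / t) | forall i, K' (de_d i t)] ->
    tower_embeds (adjoin K' t).
  elim=> {K}.
  - move=> k G r GP gk; exists r, k, G; split=> // [x x' H|x [p [q [q0 e]]]]; first by exists x'.
    exists (de_iota k p / de_iota k q); have qE : de_iota E q != 0.
      by apply: contraNneq q0 => e0; apply/eqP/(@de_iota_inj _ _ E); rewrite e0 rmorph0.
    have -> : x = de_iota E p / de_iota E q by rewrite -e mulfK.
    by apply: (dc_mul GP); [|apply: (dc_inv GP)]; apply: (dc_iota GP).
  - by move=> K t _ IH Ht; apply: step => //; apply: Or31.
  - by move=> K t _ IH _ Ht; apply: step => //; apply: Or32.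
  by move=> K t _ IH _ Ht; apply: step => //; apply: Or33.
move=> IH Ht k G r GP gk; have [r1 [k1 [G1 [gk1 G1P H1 HK]]]] := IH k G r GP gk.
have [|r2 [k2 [G2 [gk2 [G2P H2 [s Hs]]]]]] := @adjoin_corr E k1 G1 t r1 G1P gk1.
  case: Ht => [[a [Ka a0 /rootP at0]]|Ht|Ht].
  - have [a' Ha] := lift _ _ _ _ G1P HK Ka; apply: Or31; by exists a, a'.
  - by apply: Or32 => i; apply: HK.
  by apply: Or33 => i; apply: HK.
exists r2, k2, G2; split=> // [x x' /H1 [y /H2]//|x [a [b [Ka Kb b0 ->]]]].
have HK2 y : K' y -> exists y', G2 y y' by move=> /HK [y' /H2].
have [a' Ha] := lift _ _ _ _ G2P HK2 Ka; have [b' Hb] := lift _ _ _ _ G2P HK2 Kb.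
exists (a'.[s] / b'.[s]); apply: (dc_mul G2P); [|apply: (dc_inv G2P)]; exact: pcorr_horner.
Qed.
End Embedding.

(** * From first integrals to a multiplier form *)

Section Descent.
Variables (R : realType) (n : nat) (P : 'I_n -> {mpoly (complex R)[n]}) (Q0 : Prop).
Implicit Types E k : diff_ext R n.
Hypothesis P0 : exists j, P j != 0.

Lemma de_iota_neq0 k (p : {mpoly (complex R)[n]}) : p != 0 -> de_iota k p != 0.
Proof. by apply: contraNneq => e; apply/eqP/(@de_iota_inj _ _ k); rewrite e rmorph0. Qed.

Lemma good_descent r k : good P Q0 r k ->
  solvable_forms_span (@de_d _ _ k) (fun j => de_iota k (P j)) -> Q0.
Proof.
elim: r k => [|r IH] k.
  move=> H span; apply/H/solvable_forms_span_multiplier => //; first exact: de_dP.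
  - exact: de_comm.
  by case: P0 => j /(de_iota_neq0 k); exists j.
move=> [k' [a [m [aC [gk' ->]]]]] span; apply: (IH k' gk').
apply: (@solvable_forms_span_laurent k' n (@de_d _ _ k') a m (@de_dP _ _ k') (@de_comm _ _ k') aC _ _ span).
by case: P0 => j /(de_iota_neq0 k'); exists j.
Qed.

Lemma base_corr E k : exists G : E -> k -> Prop, diff_corr G.
Proof.
exists (fun x y => exists p q, [/\ q != 0, x = de_iota E p / de_iota E q & y = de_iota k p / de_iota k q]).
have [dE dk] := (fun i => @de_dP _ _ E i, fun i => @de_dP _ _ k i).
have nE q := @de_iota_neq0 E q; have nk q := @de_iota_neq0 k q.
split.
- by move=> p; exists p, 1; rewrite !rmorph1 !divr1 oner_neq0.
- move=> _ _ _ _ [p [q [q0 -> ->]]] [p' [q' [q'0 -> ->]]]; exists (p * q' + p' * q), (q * q').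
  by rewrite mulf_neq0 // !rmorphD !rmorphM /= !frac_sum ?nE ?nk.
- by move=> _ _ [p [q [q0 -> ->]]]; exists (- p), q; rewrite !rmorphN !mulNr.
- move=> _ _ _ _ [p [q [q0 -> ->]]] [p' [q' [q'0 -> ->]]]; exists (p * p'), (q * q').
  by rewrite mulf_neq0 // !rmorphM /= !frac_prod ?nE ?nk.
- move=> _ _ [p [q [q0 -> ->]]]; have [->|p0] := eqVneq p 0.
    by exists 0, 1; rewrite !rmorph0 !mul0r !invr0 oner_neq0.
  by exists q, p; rewrite !invfM !invrK ![_^-1 * _]mulrC.
- move=> i _ _ [p [q [q0 -> ->]]].
  exists (mderiv i p * q - p * mderiv i q), (q * q); rewrite mulf_neq0 //.
  rewrite !(der_div (dE i)) !(der_div (dk i)) !de_iota_d !rmorphB !rmorphM /=.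
  have aux (F : fieldType) (u v u' v' : F) : v != 0 -> u' / v - u * v' / v ^+ 2 = (u' * v - u * v') / (v * v).
    by move=> v0; field.
  by rewrite !aux ?nE ?nk.
move=> _ [p [q [q0 /esym/eqP e ->]]]; move: e; rewrite mulf_eq0 invr_eq0 (negPf (nE _ q0)) orbF.
have [->|/nE/negPf->//] := eqVneq p 0.
by rewrite !rmorph0 mul0r.
Qed.

Lemma liouvillian_corr E (H : 'I_n.-1 -> E) : (forall j, liouvillian (H j)) ->
  forall k, good P Q0 0 k -> exists r (k' : diff_ext R n) (G : E -> k' -> Prop),
  [/\ good P Q0 r k', diff_corr G & forall j, exists h, G (H j) h].
Proof.
move=> HL k gk; suff [r [k' [G [g GP h]]]] : exists r (k' : diff_ext R n) (G : E -> k' -> Prop),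
  [/\ good P Q0 r k', diff_corr G & forall j, j \in enum 'I_n.-1 -> exists h, G (H j) h].
  by exists r, k', G; split=> // j; apply: h; rewrite mem_enum.
elim: (enum _) => [|j s [r [k' [G [g GP h]]]]].
  by have [G GP] := base_corr E k; exists 0%N, k, G.
have [K [tK Kj]] := HL j; have [r2 [k2 [G2 [g2 G2P H2 HK]]]] := tower_corr tK GP g.
exists r2, k2, G2; split=> // i; rewrite inE => /orP[/eqP->|/h [y /H2]//].
exact: HK.
Qed.

Lemma corr_det E k (G : E -> k -> Prop) m (A : 'M[E]_m) (A' : 'M[k]_m) : diff_corr G ->
  (forall i j, G (A i j) (A' i j)) -> G (\det A) (\det A').
Proof.
move=> GP H; apply: (dc_sum GP) => s _; apply: (dc_mul GP).
  by apply: (dc_exp GP); apply: (dc_opp GP); apply: (dc_1 GP).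
exact: (dc_prod GP).
Qed.

(** The images of the dH_j are families with zero connection. Their rank n - 1 is transported
    through a nonvanishing minor, so their common kernel is a line, spanned by P. *)
Lemma integrable_span E (H : 'I_n.-1 -> E) k (G : E -> k -> Prop) : diff_corr G ->
  (forall j, exists h, G (H j) h) -> (forall j, first_integral P (H j)) -> functionally_independent H ->
  solvable_forms_span (@de_d _ _ k) (fun j => de_iota k (P j)).
Proof.
move=> GP /choice [h Hh] Hint Hrk v Hk.
have W j : \sum_i de_iota k (P i) * de_d i (h j) = 0.
  apply: (dc_inj GP); rewrite -(Hint j).2; apply: (dc_sum GP) => i _.
  by apply: (dc_mul GP); [apply: (dc_iota GP) | apply: (dc_d GP)].
have Hv j : \sum_i de_d i (h j) * v i = 0.
  have dk i := @de_dP _ _ k i.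
  pose w i (_ : unit) := de_d i (h j); apply: (Hk unit (fun=> 0%N) (fun _ _ _ => 0) w _ tt).
  have covE i (u : unit -> k) b : cov (@de_d _ _ k) (fun _ _ _ => 0) i u b = de_d i (u b).
    by rewrite /cov big1 ?subr0 // => c _; rewrite mul0r.
  by split=> // [a b u c|a b c|b]; rewrite ?covE ?W // de_comm.
pose M : 'M[E]_(n.-1, n) := \matrix_(j, i) de_d i (H j).
pose M' : 'M[k]_(n.-1, n) := \matrix_(j, i) de_d i (h j).
have fM : row_full M^T by rewrite /row_full mxrank_tr; apply/eqP.
pose f := fullrankfun fM; have := fullrowsub_unit fM; rewrite unitmxE unitfE.
rewrite (dc_eq0 GP (corr_det (A' := rowsub f M'^T) GP _)); last first.
  by move=> i j; rewrite !mxE; apply: (dc_d GP).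
rewrite -unitfE -unitmxE => uM.
have rM : \rank M' = n.-1.
  apply/eqP; rewrite eqn_leq rank_leq_row /=.
  by have := mxrankS (rowsub_sub f M'^T); rewrite mxrank_unit // mxrank_tr.
pose Pv : 'rV[k]_n := \row_i de_iota k (P i).
have Pv0 : Pv != 0.
  by case: P0 => j /(de_iota_neq0 k); apply: contraNneq => /rowP/(_ j); rewrite !mxE => ->.
have kerE (u : 'rV[k]_n) : (u <= kermx M'^T)%MS = [forall j, \sum_i de_d i (h j) * u 0 i == 0].
  apply/sub_kermxP/forallP => [/rowP e j|e]; last apply/rowP => j.
    by have := e j; rewrite !mxE => e'; apply/eqP; apply: etrans e'; apply: eq_bigr => i _; rewrite !mxE mulrC.
  by rewrite !mxE; apply: etrans (eqP (e j)); apply: eq_bigr => i _; rewrite !mxE mulrC.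
have PK : (Pv <= kermx M'^T)%MS.
  rewrite kerE; apply/forallP => j; apply/eqP; apply: etrans (W j).
  by apply: eq_bigr => i _; rewrite mxE mulrC.
have n0 : (0 < n)%N by case: P0 => j _; apply: leq_ltn_trans (ltn_ord j).
have KP : (kermx M'^T <= Pv)%MS.
  rewrite -(mxrank_leqif_sup PK) mxrank_ker mxrank_tr rM rank_rV Pv0.
  by move: n0; case: (n) => // n' _; rewrite subSnn.
pose vv : 'rV[k]_n := \row_i v i.
have : (vv <= Pv)%MS.
  apply: submx_trans KP; rewrite kerE; apply/forallP => j; apply/eqP; apply: etrans (Hv j).
  by apply: eq_bigr => i _; rewrite mxE.
by case/sub_rVP => c /rowP e; exists c => j; have := e j; rewrite !mxE.
Qed.
End Descent.

Lemma liouvillian_integrable_multiplier (R : realType) (n : nat) (P : 'I_n -> {mpoly (complex R)[n]})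
   (k : diff_ext R n) : (exists j, P j != 0) -> liouvillian_integrable P -> multiplier_in k P.
Proof.
move=> P0 [E [H [HL Hint Hrk]]].
(* With this choice of [Q0], k itself has level 0, by the identity. *)
have [r [k' [G [gk' GP HG]]]] := liouvillian_corr (P := P) (Q0 := multiplier_in k P) HL (k := k) id.
exact: good_descent P0 _ _ gk' (integrable_span P0 GP HG Hint Hrk).
Qed.

(** * Closed rational 1-forms *)

Section PolyCharZero.
Variable k : fieldType.
Hypothesis chark : forall m, m.+1%:R != 0 :> k.
Implicit Types p q r D G H : {poly k}.

Lemma poly_primitive p : exists q, q^`() = p.
Proof.
exists (\poly_(i < (size p).+1) (p`_i.-1 / i%:R)); apply/polyP => i.
rewrite coef_deriv coef_poly ltnS; case: ltnP => ip; last by rewrite mul0rn nth_default.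
by rewrite -[_ *+ i.+1]mulr_natr divfK.
Qed.
Lemma deriv_eq0 p : p^`() = 0 -> p = (p`_0)%:P.
Proof.
move=> H; apply/polyP => -[|i]; rewrite coefC //=; have := congr1 (fun q : {poly k} => q`_i) H.
by rewrite coef_deriv coef0 -mulr_natr => /eqP; rewrite mulf_eq0 (negPf (chark i)) orbF => /eqP.
Qed.
Lemma irr_deriv p : irreducible_poly p -> ~~ (p %| p^`()).
Proof.
move=> irr; have [p1 _] := irr; have p0 := irredp_neq0 irr; apply/negP => H.
have [e|d0] := eqVneq p^`() 0; first by move: p1; rewrite (deriv_eq0 e) ltnNge size_polyC leq_b1.
by have := dvdp_leq d0 H; rewrite leqNgt lt_size_deriv.
Qed.
Lemma irr_multiplicity p G : irreducible_poly p -> G != 0 ->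
  exists e H, G = p ^+ e * H /\ ~~ (p %| H).
Proof.
move=> irr; have p0 := irredp_neq0 irr; have p1 := irr.1.
have [N] := ubnP (size G); elim: N G => // N IH G; rewrite ltnS => GN G0.
have [/dvdpP [H EG]|npG] := boolP (p %| G); last by exists 0%N, G; rewrite expr0 mul1r.
have H0 : H != 0 by apply: contraNneq G0 => e; rewrite EG e mul0r.
have [|e [H' [EH npH']]] := IH H _ H0.
  apply: leq_trans GN; rewrite EG size_mul // -subn1 -addnBA ?(ltnW p1) //.
  by rewrite -addn1 leq_add2l subn_gt0.
by exists e.+1, H'; rewrite EG EH exprSr mulrAC.
Qed.
Lemma irr_mul p q r : irreducible_poly p -> ~~ (p %| q) -> (p %| q * r) = (p %| r).
Proof. by move=> irr npq; rewrite Gauss_dvdpr // irr_coprime. Qed.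
Lemma deriv_powM p e H : (p ^+ e.+1 * H)^`() = p ^+ e * (e.+1%:R *: p^`() * H + p * H^`()).
Proof.
rewrite derivM deriv_exp /= exprS -mulr_natl scaler_nat -mulr_natl; ring.
Qed.
Lemma squarefree_irr D p : coprimep D D^`() -> irreducible_poly p -> ~~ (p ^+ 2 %| D).
Proof.
move=> cop irr; apply/negP => /dvdpP [H]; rewrite mulrC => ED.
have : p %| gcdp D D^`().
  by rewrite dvdp_gcd ED deriv_powM expr2 expr1 -!mulrA !dvdp_mulIl.
move: cop; rewrite coprimep_def => /size_poly1P [c c0 ->] /dvdp_leq; rewrite polyC_eq0 => /(_ c0).
by rewrite size_polyC c0 leqNgt irr.1.
Qed.

Notation fr := (@tofrac {poly k}).
Notation K := {fraction {poly k}}.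
Notation dX := (fder (@deriv k)).
Lemma derivation_deriv : derivation (@deriv k).
Proof. by split=> p q; rewrite ?derivD ?derivM. Qed.
Let dXP : derivation dX := fderP derivation_deriv.

Lemma fr_mul_eq p q : fr p = fr q -> p = q.
Proof. by move=> /eqP; rewrite tofrac_eq => /eqP. Qed.

Lemma fraction_coprime (x : K) : exists F G, [/\ G != 0, coprimep F G & x = fr F / fr G].
Proof.
have [[A B] /= [B0 ->]] := frac_ex x; pose g := gcdp A B.
have g0 : g != 0 by rewrite gcdp_eq0 negb_and B0 orbT.
have EA : A = A %/ g * g by rewrite divpK // dvdp_gcdl.
have EB : B = B %/ g * g by rewrite divpK // dvdp_gcdr.
have B'0 : B %/ g != 0 by apply: contraNneq B0 => e; rewrite EB e mul0r.
exists (A %/ g), (B %/ g); split=> //; first by rewrite coprimep_div_gcd // B0 orbT.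
by rewrite {1}EA {1}EB !tofracM -mulf_div mulfV ?mulr1 // fr0.
Qed.

Lemma dX_frac F G : G != 0 -> dX (fr F / fr G) * fr G ^+ 2 = fr (F^`() * G - F * G^`()).
Proof.
move=> G0; rewrite (fderE derivation_deriv) // tofracB !tofracM.
have aux (L : fieldType) (a b c d : L) : b != 0 -> (a / b - c * d / b ^+ 2) * b ^+ 2 = a * b - c * d.
  by move=> b0; field.
exact/aux/fr0.
Qed.

Lemma dX_const (x : K) : dX x = 0 -> exists c, x = fr c%:P.
Proof.
have [F [G [G0 cop ->]]] := fraction_coprime x => H.
have : F^`() * G - F * G^`() = 0 by apply: fr_mul_eq; rewrite -dX_frac // H mul0r tofrac0.
move/eqP; rewrite subr_eq0 => /eqP E.
have GG : G %| G^`() by rewrite -(Gauss_dvdpr _ (q := F)) 1?coprimep_sym // -E dvdp_mulIr.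
have G'0 : G^`() = 0.
  apply/eqP/negPn/negP => d0; have := dvdp_leq d0 GG; rewrite leqNgt; exact/negP/negPn/lt_size_deriv.
have F'0 : F^`() = 0.
  by apply/eqP; move/eqP: E; rewrite G'0 mulr0 mulf_eq0 (negPf G0) orbF.
have g0 : G`_0 != 0 by apply: contraNneq G0 => e; rewrite (deriv_eq0 G'0) e.
exists (F`_0 / G`_0); rewrite {1}(deriv_eq0 F'0) {1}(deriv_eq0 G'0).
apply: (mulIf (fr0 _ (a := (G`_0)%:P))); first by rewrite polyC_eq0.
by rewrite divfK ?fr0 ?polyC_eq0 // -tofracM -polyCM divfK.
Qed.

(* An exact fraction has no simple pole. *)
Lemma residue_exact D E (S : K) : D != 0 -> coprimep D D^`() -> fr E / fr D = dX S -> D %| E.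
Proof.
move=> D0 copD; have [F [G [G0 cop ->]]] := fraction_coprime S => H.
have EG : E * G ^+ 2 = D * (F^`() * G - F * G^`()).
  apply: fr_mul_eq; rewrite (tofracM E) tofracXn (tofracM D) -dX_frac // -H.
  by rewrite mulrA [fr D * _]mulrC divfK ?fr0.
have [G1|G1] := leqP (size G) 1%N; last first.
  have [p [irr pG]] := irreducible_factor G1.
  (* A pole of S of order e + 1 at p gives its derivative a pole of order e + 2 >= 2, whereas D is
     squarefree. *)
  have [[|e] [H' [EG' npH]]] := irr_multiplicity irr G0.
    by case/negP: npH; rewrite expr0 mul1r in EG'; rewrite -EG'.
  have p0 := irredp_neq0 irr.
  have npF : ~~ (p %| F).
    rewrite -irr_coprime //; apply: coprimep_dvdr pG _.
    by rewrite coprimep_sym.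
  case/negP: (squarefree_irr copD irr); pose X := F^`() * p * H' - F * (e.+1%:R *: p^`() * H' + p * H'^`()).
  have E2 : E * (p ^+ e.+2 * H' ^+ 2) = D * X.
    apply: (mulfI (expf_neq0 e p0)); apply: etrans (_ : E * G ^+ 2 = _).
      by rewrite EG' !exprS; ring.
    by rewrite EG EG' deriv_powM /X !exprS; ring.
  have npX : ~~ (p %| X).
    have -> : X = p * (F^`() * H' - F * H'^`()) + - (e.+1%:R *: (F * (p^`() * H'))).
      by rewrite /X -!mul_polyC; ring.
    rewrite dvdp_addr ?dvdp_mulIl // dvdpNr dvdpZr ?chark // !irr_mul //; exact: irr_deriv.
  have : p ^+ 2 %| D * X.
    by rewrite -E2 mulrCA -[e.+2]addn2 exprD -mulrA; rewrite dvdp_mull // dvdp_mulIl.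
  by rewrite mulrC Gauss_dvdpr // coprimep_expl // irr_coprime.
have /size_poly1P [g g0 Eg] : size G == 1%N by rewrite eqn_leq G1 size_poly_gt0.
have Gd : G^`() = 0 by rewrite Eg derivC.
move: EG; rewrite Gd mulr0 subr0 expr2 mulrA mulrA => /(mulIf G0) EG.
have : D %| E * G by rewrite EG dvdp_mulIl.
by rewrite Eg mulrC mul_polyC dvdpZr.
Qed.

(** While some irreducible p divides D at least twice, subtracting the derivative of a fraction B /
    p^(e+1) lowers its multiplicity by one. *)
Lemma hermite_reduction (x : K) : exists (S : K) A D,
  [/\ D != 0, coprimep D D^`() & x = dX S + fr A / fr D].
Proof.
have [[A D] /= [D0 ->]] := frac_ex x; clear x.
have [N] := ubnP (size D); elim: N A D D0 => // N IH A D D0; rewrite ltnS => DN.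
have [cop|ncop] := boolP (coprimep D D^`()).
  by exists 0, A, D; split=> //; rewrite (der0 dXP) add0r.
have g1 : (1 < size (gcdp D D^`()))%N.
  rewrite ltn_neqAle eq_sym -coprimep_def ncop size_poly_gt0 gcdp_eq0 negb_and D0; exact: isT.
have [p [irr pg]] := irreducible_factor g1.
have p0 := irredp_neq0 irr; have [pD pD'] : p %| D /\ p %| D^`().
  by split; apply: dvdp_trans pg _; rewrite ?dvdp_gcdl ?dvdp_gcdr.
have [[|[|e]] [H [ED npH]]] := irr_multiplicity irr D0.
- by case/negP: npH; rewrite expr0 mul1r in ED; rewrite -ED.
- move: pD'; rewrite ED deriv_powM expr0 mul1r scale1r dvdp_addl ?dvdp_mulIl // irr_mul ?irr_deriv //.
  by rewrite (negPf npH).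
have H0 : H != 0 by apply: contraNneq D0 => h0; rewrite ED h0 mulr0.
have cop : coprimep (p^`() * H) p.
  by rewrite coprimep_sym irr_coprime // irr_mul ?irr_deriv.
have /Bezout_eq1_coprimepP [[u v] /= uv] := cop.
have D20 : p ^+ e.+1 * H != 0 by rewrite mulf_neq0 ?expf_neq0.
(* By Bezout for p' H and p, this B makes A + (e + 1) B p' H divisible by p, with quotient C. *)
pose B := - (e.+1%:R^-1)%:P * A * u; pose C := A * v.
have EA : A = - (e.+1%:R%:P * B * (p^`() * H)) + C * p.
  have e1 : e.+1%:R%:P * (e.+1%:R^-1)%:P = 1 :> {poly k} by rewrite -polyCM mulfV.
  rewrite /B /C -[A in LHS]mulr1 -uv.
  have -> : - (e.+1%:R%:P * (- e.+1%:R^-1%:P * A * u) * (p^`() * H)) = (e.+1%:R%:P * e.+1%:R^-1%:P) * (A * u * (p^`() * H)) :> {poly k} by ring.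
  by rewrite e1; ring.
have [|S [A2 [D2 [D20' cop2 E2]]]] := IH (C - B^`() * H) (p ^+ e.+1 * H) D20.
  have ED' : D = p * (p ^+ e.+1 * H) by rewrite ED [p ^+ e.+2]exprS mulrA.
  apply: leq_trans DN; rewrite ED' (size_mul p0 D20).
  have := irr.1; have : (0 < size (p ^+ e.+1 * H)%R)%N by rewrite size_poly_gt0.
  by move: (size p) (size (p ^+ e.+1 * H)%R) => x y; clear; lia.
exists (fr B / fr (p ^+ e.+1) + S), A2, D2; split=> //.
rewrite (derD dXP) -addrA -E2 (fderE derivation_deriv) ?expf_neq0 // EA ED.
have -> : (p ^+ e.+1)^`() = e.+1%:R%:P * (p^`() * p ^+ e).
  by rewrite deriv_exp /= polyC_natr mulr_natl.
rewrite !(tofracXn, tofracD, tofracM, tofracN).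
have aux (L : fieldType) (n b p' h c q b' : L) : q != 0 -> h != 0 ->
  (- (n * b * (p' * h)) + c * q) / (q ^+ e.+2 * h) =
  b' / q ^+ e.+1 - b * (n * (p' * q ^+ e)) / (q ^+ e.+1) ^+ 2 + (c - b' * h) / (q ^+ e.+1 * h).
  move=> q0 h0; rewrite !exprS; have qe : q ^+ e != 0 by rewrite expf_neq0.
  by move: (q ^+ e) qe => Q Q0; field; rewrite h0 q0 Q0.
by apply: aux; apply: fr0.
Qed.
End PolyCharZero.

Section LogarithmicPart.
Variables (k : fieldType) (C : closedFieldType) (cst : {rmorphism C -> k}).
Implicit Types (D L : {poly k}).
Notation fr := (@tofrac {poly k}).

(* If the residues of L D'/D, the values of [L] at the roots of [D], all lie in
   [s], then this fraction is a sum of logarithmic derivatives up to a polynomial. *)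
Lemma log_part (s : seq C) D L : D != 0 -> coprimep D D^`() ->
  D %| \prod_(l <- s) (L - (cst l)%:P) ->
  exists (ls : seq (C * {poly k})) (Z : {poly k}), (forall x, x \in ls -> x.2 != 0) /\
   fr (L * D^`()) / fr D = \sum_(x <- ls) fr (cst x.1)%:P * (fr x.2^`() / fr x.2) + fr Z.
Proof.
elim: s D => [|l s IH] D D0 cop.
  rewrite big_nil dvdp1 => /size_poly1P [c _ ->]; exists [::], 0; split=> //.
  by rewrite derivC mulr0 tofrac0 mul0r big_nil addr0.
(* D1 gathers the roots of D with residue l. Since L = l + Y D1, the fraction is l dlog D1, plus the
   polynomial Y D1', plus the same problem for D2, which is prime to L - l. *)
rewrite big_cons => dvd; pose D1 := gcdp D (L - (cst l)%:P); pose D2 := D %/ D1.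
have ED : D = D1 * D2 by rewrite mulrC divpK // dvdp_gcdl.
have D10 : D1 != 0 by apply: contraNneq D0 => e; rewrite ED e mul0r.
have D20 : D2 != 0 by apply: contraNneq D0 => e; rewrite ED e mulr0.
have [c12 c22] : coprimep D1 D2 /\ coprimep D2 D2^`().
  move: cop; rewrite ED derivM coprimepMl => /andP[_].
  by rewrite coprimep_addl_mul coprimepMr => /andP[c1 c2]; rewrite coprimep_sym c1.
have copl : coprimep D2 (L - (cst l)%:P).
  apply/coprimepP => q q2 ql; move/coprimepP: c12; apply=> //.
  by rewrite dvdp_gcd ql andbT ED dvdp_mull.
have [|ls [Z [ls0 E]]] := IH D2 D20 c22.
  by rewrite -(Gauss_dvdpr _ copl); apply: dvdp_trans dvd; rewrite ED dvdp_mulIr.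
have /dvdpP [Y EY] : D1 %| L - (cst l)%:P by apply: dvdp_gcdr.
exists ((l, D1) :: ls), (Z + Y * D1^`()); split=> [x|].
  by rewrite inE => /orP[/eqP->//|/ls0].
rewrite big_cons /= [fr (Z + _)]tofracD addrA -[_ + fr Z]addrA -E.
have -> : L = (cst l)%:P + Y * D1 by rewrite -EY addrC subrK.
rewrite ED derivM !(tofracD, tofracM).
have aux (F : fieldType) (c y a b a' b' : F) : a != 0 -> b != 0 ->
  (c + y * a) * (a' * b + a * b') / (a * b) = c * (a' / a) + (c + y * a) * b' / b + y * a'.
  by move=> a0 b0; field; rewrite a0 b0.
by apply: aux; apply: fr0.
Qed.

(** The powers 1, ..., L^(N-1) are N vectors in k[X]/(D), of dimension N - 1. *)
Lemma poly_annihilator D L : D != 0 -> exists nu : {poly k}, nu != 0 /\ D %| nu \Po L.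
Proof.
move=> D0; set N := size D; have N0 : (0 < N)%N by rewrite size_poly_gt0.
pose M : 'M[k]_(N, N.-1) := \matrix_(i, j) ((L ^+ i) %% D)`_j.
have : kermx M != 0.
  by rewrite kermx_eq0 /row_free; apply: contraTneq (rank_leq_col M) => ->; rewrite -ltnNge ltn_predL.
case/rowV0Pn => v /sub_kermxP vM v0.
exists (\poly_(i < N) (if insub i is Some j then v 0 j else 0)); split.
  apply: contraNneq v0 => e; apply/eqP/rowP => j; rewrite mxE.
  by have := congr1 (fun p : {poly k} => p`_j) e; rewrite coef0 coef_poly ltn_ord valK.
rewrite poly_def linear_sum /= /dvdp.
have modS (F : 'I_N -> {poly k}) : (\sum_i F i) %% D = \sum_i (F i %% D).
  by apply: (big_morph (fun p => p %% D) (modpD D) (mod0p D)).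
rewrite modS; apply/eqP; apply/polyP => j; rewrite coef_sum coef0.
case: (ltnP j N.-1) => jN.
  have := congr1 (fun w : 'rV_N.-1 => w 0 (Ordinal jN)) vM; rewrite !mxE => E.
  apply: etrans E; apply: eq_bigr => i _; rewrite valK comp_polyZ comp_Xn_poly modpZl coefZ.
  by rewrite mxE.
rewrite big1 // => i _; rewrite nth_default //; apply: leq_trans jN.
by rewrite -ltnS prednK // ltn_modp.
Qed.
End LogarithmicPart.

Section ConstantResidues.
Variables (k : fieldType) (C : closedFieldType) (cst : {rmorphism C -> k}).
Variables (I : Type) (d : I -> k -> k).
Hypothesis dP : forall i, derivation (d i).
Hypothesis const : forall x, (forall i, d i x = 0) -> exists c, x = cst c.

Lemma map_der_comp i (p q : {poly k}) : map_poly (d i) (p \Po q) =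
  map_poly (d i) p \Po q + (p^`() \Po q) * map_poly (d i) q.
Proof.
have mP := map_der_derivation (dP i).
elim/poly_ind: p => [|p c IH].
  by rewrite comp_poly0 (der0 mP) deriv0 !comp_poly0 mul0r addr0.
rewrite comp_polyD comp_polyM comp_polyX comp_polyC !(derD mP) !(derM mP) IH (map_derX (dP i)) !(map_derC (dP i)).
rewrite mulr0 addr0 derivD derivM derivX mulr1 derivC addr0 !comp_polyD !comp_polyM comp_polyX comp_polyC; ring.
Qed.

(* The hypothesis says that [L] is constant modulo [D] for the extension of [d] to
   k[X]/(D); hence its minimal polynomial over k has constant coefficients. *)
Lemma constant_residues D L : D != 0 -> coprimep D D^`() ->
  (forall i, D %| D^`() * map_poly (d i) L - L^`() * map_poly (d i) D) ->
  exists s : seq C, D %| \prod_(l <- s) (L - (cst l)%:P).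
Proof.
move=> D0 cop H.
pose S m := `[< exists nu : {poly k}, [/\ nu != 0, D %| nu \Po L & size nu = m]>].
have exS : exists m, S m.
  by have [nu [nu0 dvd]] := poly_annihilator L D0; exists (size nu); apply/asboolP; exists nu.
case: (ex_minnP exS) => m /asboolP [nu [nu0 Dnu sm]] minS.
pose mu := (lead_coef nu)^-1 *: nu.
have l0 : lead_coef nu != 0 by rewrite lead_coef_eq0.
have lmu : lead_coef mu = 1 by rewrite lead_coefZ mulVf.
have smu : size mu = m by rewrite size_scale ?invr_eq0.
have Dmu : D %| mu \Po L by rewrite comp_polyZ dvdpZr ?invr_eq0.
(* Differentiating mu(L) = 0 modulo D shows that the polynomial with differentiated coefficients
   also annihilates L. As mu is monic it is smaller, hence zero by minimality. *)
have mu_const i : map_poly (d i) mu = 0.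
  have mP := map_der_derivation (dP i).
  have [Y EY] : exists Y, mu \Po L = Y * D by apply/dvdpP.
  have E1 := map_der_comp i mu L; have E2 := deriv_comp mu L.
  have dvd : D %| map_poly (d i) mu \Po L.
    rewrite -(Gauss_dvdpr _ cop).
    have -> : D^`() * (map_poly (d i) mu \Po L) = D * (D^`() * map_poly (d i) Y - map_poly (d i) D * Y^`())
       - (mu^`() \Po L) * (D^`() * map_poly (d i) L - L^`() * map_poly (d i) D).
      have -> : map_poly (d i) mu \Po L = map_poly (d i) (mu \Po L) - (mu^`() \Po L) * map_poly (d i) L.
        by rewrite E1 addrK.
      have E3 : (mu^`() \Po L) * L^`() = Y^`() * D + Y * D^`() by rewrite -E2 EY derivM.
      rewrite EY (derM mP) [X in _ = _ - X]mulrBr [(_ \Po _) * (L^`() * _)]mulrA E3; ring.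
    by apply: dvdp_sub; [apply: dvdp_mulIl | apply: dvdp_mull].
  apply/eqP/negPn/negP => n0; have : S (size (map_poly (d i) mu)).
    by apply/asboolP; exists (map_poly (d i) mu).
  move/minS; rewrite leqNgt; case/negP; rewrite -smu.
  have sle : (size (map_poly (d i) mu) <= size mu)%N.
    apply/leq_sizeP => j js; rewrite coef_map_der // nth_default ?(der0 (dP i)) //.
  rewrite ltn_neqAle sle andbT; apply: contraNneq n0 => e.
  by rewrite -lead_coef_eq0 lead_coefE e coef_map_der // -lead_coefE lmu (der1 (dP i)).
have /choice [c Hc] : forall j, exists c, mu`_j = cst c.
  by move=> j; apply: const => i; rewrite -coef_map_der // mu_const coef0.
pose q := \poly_(j < size mu) c j.
have Eq : mu = map_poly cst q.
  apply/polyP => j; rewrite coef_map coef_poly; case: ltnP => js; first by rewrite Hc.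
  by rewrite nth_default //; apply/esym/rmorph0.
(* C is algebraically closed, so mu splits into factors X - l with l constant. *)
have [s Es] := closed_field_poly_normal q.
have lq : lead_coef q = 1.
  by apply: (fmorph_inj cst); rewrite -lead_coef_map -Eq lmu rmorph1.
exists s; move: Dmu; rewrite Eq Es lq scale1r rmorph_prod /=.
congr (_ %| _); rewrite (big_morph (fun p => p \Po L) (fun x y => comp_polyM x y L) (comp_polyC 1 L)).
by apply: eq_bigr => l _; rewrite rmorphB /= map_polyX map_polyC comp_polyB comp_polyX comp_polyC.
Qed.
End ConstantResidues.

(* The condition [u i = 0] when [d i = 0] excludes the constant forms. *)
Definition closed_forms_log (k : fieldType) (C : closedFieldType) (cst : C -> k) (d : nat -> k -> k) : Prop :=
  forall u : nat -> k, (forall i j, d i (u j) = d j (u i)) ->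
  (forall i, (forall x, d i x = 0) -> u i = 0) ->
  exists (S : k) (s : seq (C * k)), (forall x, x \in s -> x.2 != 0) /\
    forall i, u i = d i S + \sum_(x <- s) cst x.1 * (d i x.2 / x.2).

Lemma dlog_closed (k : fieldType) (d e : k -> k) x : derivation d -> derivation e ->
  (forall x, d (e x) = e (d x)) -> d (e x / x) = e (d x / x).
Proof. by move=> dP eP H; rewrite (der_div dP) (der_div eP) H [e x * _]mulrC. Qed.

Lemma fder_ext (R : idomainType) (d e : R -> R) : d =1 e -> fder d =1 fder e.
Proof. by move=> H x; rewrite /fder !H. Qed.

Section ClosedFormsStep.
Variables (k : fieldType) (C : closedFieldType) (cst : {rmorphism C -> k}) (d : nat -> k -> k) (t : nat).
Hypothesis chark : forall m, m.+1%:R != 0 :> k.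
Hypothesis dP : forall i, derivation (d i).
Hypothesis dC : forall i j x, d i (d j x) = d j (d i x).
Hypothesis const : forall x, (forall i, d i x = 0) -> exists c, x = cst c.
Hypothesis cst0 : forall i c, d i (cst c) = 0.
Hypothesis dt : forall x, d t x = 0.
Notation fr := (@tofrac {poly k}).
Notation K := {fraction {poly k}}.

(** The new variable X plays x_t: as d t vanishes on k, index t acts as d/dX, and the other indices
    act on coefficients. *)
Definition rat_pder i : {poly k} -> {poly k} := pder (d i) (i == t)%:R.
Definition rat_der i : K -> K := fder (rat_pder i).
Definition rat_cst : {rmorphism C -> K} := fr \o (polyC \o cst).
Lemma rat_pderP i : derivation (rat_pder i). Proof. exact: pderP. Qed.
Lemma rat_derP i : derivation (rat_der i). Proof. exact/fderP/rat_pderP. Qed.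
Lemma rat_der_fr i p : rat_der i (fr p) = fr (rat_pder i p).
Proof. exact/fder_tofrac/rat_pderP. Qed.
Lemma rat_der_frac i a b : b != 0 ->
  rat_der i (fr a / fr b) = fr (rat_pder i a) / fr b - fr a * fr (rat_pder i b) / fr b ^+ 2.
Proof. exact/fderE/rat_pderP. Qed.
Lemma rat_pder_t p : rat_pder t p = p^`().
Proof.
rewrite /rat_pder /pder eqxx mul1r [map_poly _ _](_ : _ = 0) ?add0r //.
by apply/polyP => i; rewrite coef_map_der // coef0.
Qed.
Lemma rat_pder_neq i p : i != t -> rat_pder i p = map_poly (d i) p.
Proof. by move=> /negPf it; rewrite /rat_pder /pder it mul0r addr0. Qed.
Lemma rat_der_t x : rat_der t x = fder (@deriv k) x.
Proof. exact/fder_ext/rat_pder_t. Qed.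
Lemma rat_der_comm i j x : rat_der i (rat_der j x) = rat_der j (rat_der i x).
Proof.
apply: fder_comm => [||p]; try exact: rat_pderP.
have mm a b q : map_poly (d a) (map_poly (d b) q) = map_poly (d b) (map_poly (d a) q).
  by apply/polyP => l; rewrite !coef_map_der.
have [->|it] := eqVneq i t; have [->|jt] := eqVneq j t => //.
- by rewrite !rat_pder_t !(rat_pder_neq _ jt) map_der_deriv.
- by rewrite !rat_pder_t !(rat_pder_neq _ it) map_der_deriv.
by rewrite !(rat_pder_neq _ it, rat_pder_neq _ jt).
Qed.
Lemma rat_der_cst i c : rat_der i (rat_cst c) = 0.
Proof. by rewrite rat_der_fr /rat_pder pderC // cst0 tofrac0. Qed.
Lemma rat_der_C i c : rat_der i (fr c%:P) = fr (d i c)%:P.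
Proof. by rewrite rat_der_fr /rat_pder pderC. Qed.
Lemma rat_der_zero i : i != t -> (forall x, d i x = 0) -> forall x, rat_der i x = 0.
Proof.
move=> it di0 x; have r0 p : rat_pder i p = 0.
  by rewrite rat_pder_neq //; apply/polyP => l; rewrite coef_map_der // coef0.
by rewrite /rat_der /fder !r0 tofrac0 mulr0 !mul0r subrr.
Qed.
Lemma rat_const x : (forall i, rat_der i x = 0) -> exists c, x = rat_cst c.
Proof.
move=> H; have [c Ec] : exists c, x = fr c%:P by apply: (dX_const chark); rewrite -rat_der_t.
have [|c' Ec'] := const (x := c); last by exists c'; rewrite Ec Ec'.
move=> i; have := H i; rewrite Ec rat_der_C => /eqP.
by rewrite tofrac_eq0 polyC_eq0 => /eqP.
Qed.
Lemma rat_char m : m.+1%:R != 0 :> K.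
Proof. by rewrite -(rmorph_nat fr) tofrac_eq0 -polyC_natr polyC_eq0. Qed.

(** By closedness, the derivative of u t along x_i is exact in X, so it has no residues. Hence the
    residues of u t, the values of L at the roots of D, are constant. *)
Lemma closed_form_der_part (u : nat -> K) : (forall i j, rat_der i (u j) = rat_der j (u i)) ->
  exists (S : K) (ls : seq (C * {poly k})), (forall x, x \in ls -> x.2 != 0) /\
  u t = rat_der t S + \sum_(x <- ls) rat_cst x.1 * (rat_der t (fr x.2) / fr x.2).
Proof.
move=> cl; have [S [A [D [D0 cop Eu]]]] := hermite_reduction chark (u t).
have DP i := rat_derP i.
have /Bezout_eq1_coprimepP [[a b] /= ab] := cop.
have [L [M EA]] : exists L M, A = L * D^`() + M * D.
  by exists (A * b), (A * a); rewrite -[A in LHS]mulr1 -ab; ring.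
have Hres i : D %| D^`() * map_poly (d i) L - L^`() * map_poly (d i) D.
  have [->|it] := eqVneq i t.
    have m0 p : map_poly (d t) p = 0 by apply/polyP => l; rewrite coef_map_der // coef0.
    by rewrite !m0 !mulr0 subrr dvdp0.
  have mP := map_der_derivation (dP i); pose e := map_poly (d i).
  have ee p : e p = rat_pder i p by rewrite rat_pder_neq.
  have [M1 EM1] := poly_primitive chark (e M).
  (* Chosen so that its X-derivative is (D' d_i L - L' d_i D) / D, a fraction with only simple
     poles; being exact it has none. *)
  pose w := u i - rat_der i S - fr (L * e D) / fr D - fr M1.
  apply: (@residue_exact k chark D _ w) => //.
  have dXP : derivation (fder (@deriv k)) := fderP (derivation_deriv k).
  have dM1 : fder (@deriv k) (fr M1) = fr (e M).
    by rewrite (fder_tofrac (derivation_deriv k)); congr fr; exact: EM1.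
  rewrite /w 3!(derB dXP) dM1 (fderE (derivation_deriv k) _ D0).
  have -> : fder (@deriv k) (u i) = rat_der i (fder (@deriv k) S) + rat_der i (fr A / fr D).
    by rewrite -rat_der_t cl Eu (derD (DP i)).
  rewrite -!rat_der_t (rat_der_comm i t S) (rat_der_frac i A D0) -!ee EA.
  rewrite /e (derD mP) !(derM mP) derivM (map_der_deriv (dP i)) !(tofracB, tofracD, tofracM).
  have aux (F : fieldType) (s l1 l d1 x eL ed1 eM m ed : F) : x != 0 ->
    (d1 * eL - l1 * ed) / x = s + ((eL * d1 + l * ed1 + (eM * x + m * ed)) / x - (l * d1 + m * x) * ed / x ^+ 2)
     - s - ((l1 * ed + l * ed1) / x - l * ed * d1 / x ^+ 2) - eM.
    by move=> x0; field.
  by apply: aux; apply: fr0.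
have [s Ds] := constant_residues dP const D0 cop Hres.
have [ls [Z [ls0 EL]]] := log_part D0 cop Ds.
have [M2 EM2] := poly_primitive chark (M + Z).
exists (S + fr M2), ls; split=> //.
have EAD : fr A / fr D = fr (L * D^`()) / fr D + fr M.
  by rewrite EA tofracD mulrDl [fr (M * D)]tofracM mulfK ?fr0.
rewrite (derD (DP t)) rat_der_fr rat_pder_t EM2 Eu -rat_der_t EAD EL tofracD.
have -> : \sum_(x <- ls) rat_cst x.1 * (rat_der t (fr x.2) / fr x.2) =
    \sum_(x <- ls) fr (cst x.1)%:P * (fr x.2^`() / fr x.2).
  by apply: eq_bigr => x _; rewrite rat_der_fr rat_pder_t.
by move: (rat_der t S) (fr M) (fr Z) (\sum_(_ <- _) _) => p q r v; ring.
Qed.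

(** Subtracting the part found for u t leaves a closed form v with v t = 0. Then every v i has zero
    X-derivative, so v is a closed form over k. *)
Lemma closed_forms_log_step : closed_forms_log cst d -> closed_forms_log rat_cst rat_der.
Proof.
have := closed_form_der_part; have := rat_der_zero; have := rat_der_t; have := rat_der_C.
have := rat_der_cst; have := rat_der_comm; have := rat_derP.
move: rat_der => D DP DC Dcst DfC Dt Dz Dpart IH u cl u0; have [S [ls [ls0 Et]]] := Dpart u cl.
pose lg i := \sum_(x <- ls) rat_cst x.1 * (D i (fr x.2) / fr x.2).
pose v i := u i - (D i S + lg i).
have vcl i j : D i (v j) = D j (v i).
  rewrite /v !(derB (DP _)) !(derD (DP _)) (cl i j) (DC i j S); congr (_ - (_ + _)).
  rewrite !(der_sum (DP _)); apply: eq_bigr => x _.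
  rewrite (derM (DP i)) (derM (DP j)) !Dcst !mul0r !add0r; congr (_ * _).
  exact: dlog_closed _ (DP i) (DP j) (DC i j).
have vt : v t = 0 by rewrite /v Et subrr.
have /choice [c Hc] : forall i, exists c, v i = fr c%:P.
  by move=> i; apply: (dX_const chark); rewrite -Dt vcl vt (der0 (DP i)).
have inj x y : fr x%:P = fr y%:P -> x = y.
  by move=> /eqP; rewrite tofrac_eq => /eqP/polyC_inj.
have [||S2 [s2 [s20 E2]]] := IH c.
- by move=> i j; apply: inj; rewrite -!DfC -!Hc vcl.
- move=> i di0; apply: inj; rewrite -Hc tofrac0.
  have [->//|it] := eqVneq i t.
  have Di0 := Dz i it di0.
  rewrite /v u0 // Di0 /lg big1 ?addr0 ?subr0 // => x _.
  by rewrite Di0 mul0r mulr0.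
exists (S + fr S2%:P), ([seq (x.1, fr x.2) | x <- ls] ++ [seq (x.1, fr x.2%:P) | x <- s2]); split.
  move=> x; rewrite mem_cat => /orP[] /mapP [y ys ->] /=; first by rewrite tofrac_eq0 ls0.
  by rewrite tofrac_eq0 polyC_eq0 s20.
move=> i; have -> : u i = v i + (D i S + lg i) by rewrite /v subrK.
rewrite Hc E2 (derD (DP i)) big_cat !big_map /= DfC polyCD tofracD.
have -> : fr (\sum_(x <- s2) cst x.1 * (d i x.2 / x.2))%:P =
    \sum_(x <- s2) rat_cst x.1 * (D i (fr x.2%:P) / fr x.2%:P).
  pose F : {rmorphism k -> K} := fr \o polyC.
  rewrite -[LHS]/(F _) rmorph_sum; apply: eq_bigr => x _.
  by rewrite DfC -[fr x.2%:P]/(F _) -[fr (d i x.2)%:P]/(F _) rmorphM fmorph_div.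
rewrite -/(lg i); move: (fr (d i S2)%:P) (D i S) (lg i) (\sum_(_ <- _) _) => p q r s; ring.
Qed.
End ClosedFormsStep.

(** * Iterated rational function fields *)

Section RationalFunctionTower.
Variable C : closedFieldType.
Hypothesis charC : forall m, m.+1%:R != 0 :> C.

(* C(x_0, ..., x_(j-1)), with derivations [d/dx_i] for all i : nat, which vanish
   for i >= j; likewise [ratf_var j i] is [0] for i >= j. *)
Fixpoint ratf (j : nat) : fieldType := if j is j'.+1 then {fraction {poly ratf j'}} else C.
Fixpoint ratf_der (j : nat) : nat -> ratf j -> ratf j :=
  match j with
  | 0 => fun _ _ => 0
  | j'.+1 => rat_der (@ratf_der j') j'
  end.
Fixpoint ratf_cst (j : nat) : {rmorphism C -> ratf j} :=
  match j with
  | 0 => idfun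
  | j'.+1 => rat_cst (ratf_cst j')
  end.
Fixpoint ratf_var (j i : nat) : ratf j :=
  match j with
  | 0 => 0
  | j'.+1 => if i == j' then tofrac 'X else tofrac (ratf_var j' i)%:P
  end.

Lemma ratf_props j : [/\ forall m, m.+1%:R != 0 :> ratf j,
   forall i, derivation (@ratf_der j i),
   forall a b x, @ratf_der j a (ratf_der b x) = ratf_der b (ratf_der a x),
   forall x, (forall i, @ratf_der j i x = 0) -> exists c, x = ratf_cst j c
  & forall i c, ratf_der i (ratf_cst j c) = 0] /\
  (forall i x, (j <= i)%N -> @ratf_der j i x = 0) /\ closed_forms_log (ratf_cst j) (@ratf_der j).
Proof.
elim: j => [|j [[ch dP dC const cst0] [ge0 cl]]] /=.
  split; [split=> //|split=> //].
  - by move=> i; split=> x y; rewrite /= ?mul0r ?mulr0 addr0.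
  - by move=> x _; exists x.
  (* Over C all derivations vanish, so the admissible forms are zero. *)
  move=> u _ u0; exists 0, [::]; split=> // i; rewrite big_nil u0 // addr0 //.
have dt x : @ratf_der j j x = 0 by apply: ge0.
split; [split|split].
- exact: rat_char.
- by move=> i; apply: rat_derP.
- exact: rat_der_comm.
- exact: rat_const.
- by move=> i c; apply: rat_der_cst.
- move=> i x ji; apply: rat_der_zero => //; first by rewrite gtn_eqF.
  by move=> y; apply: ge0; apply: ltnW.
exact: closed_forms_log_step.
Qed.

Lemma ratf_der_var j i l : (l < j)%N -> ratf_der i (ratf_var j l) = (i == l)%:R.
Proof.
elim: j => // j IH; rewrite ltnS leq_eqVlt => lj /=.
have [[ch dP dC const cst0] [ge0 cl]] := ratf_props j.
case: (eqVneq l j) lj => [->|lj] /= lt; rewrite rat_der_fr //; last first.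
  rewrite /rat_pder pderC // IH //.
  exact: (rmorph_nat (@tofrac {poly ratf j} \o polyC)).
by rewrite /rat_pder pderX // rmorph_nat.
Qed.

Lemma ratf_gen j (M : fieldType) (g : {rmorphism ratf j -> M}) (S : M -> Prop) :
  (forall x y, S x -> S y -> S (x + y)) -> (forall x y, S x -> S y -> S (x * y)) ->
  (forall x, S x -> S x^-1) -> (forall c, S (g (ratf_cst j c))) ->
  (forall i, (i < j)%N -> S (g (ratf_var j i))) -> forall x, S (g x).
Proof.
move=> SD SM SV; elim: j g => [|j IH] g Sc Sv; first exact: Sc.
pose g' : {rmorphism ratf j -> M} := g \o (@tofrac _ \o polyC).
have Sg' : forall x, S (g' x).
  apply: IH => [c|i ij]; first exact: Sc.
  by have := Sv i (ltnW ij); rewrite /= ltn_eqF.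
have Sp (p : {poly ratf j}) : S (g (tofrac p)).
  elim/poly_ind: p => [|p c IHp]; first by rewrite -polyC0; apply: Sg'.
  rewrite tofracD tofracM rmorphD rmorphM; apply: SD; last exact: Sg'.
  by apply: SM => //; have := Sv j (ltnSn j); rewrite /= eqxx.
apply: frac_ind => a b _; rewrite fmorph_div; apply: SM => //; exact: SV.
Qed.
End RationalFunctionTower.

Section RationalExtension.
Variables (R : realType) (n : nat).
Local Notation C := (complex R).
Local Notation MP := {mpoly C[n]}.
Implicit Types p q : MP.

Lemma mpoly_gen (Q : MP -> Prop) : (forall c, Q c%:MP) -> (forall i, Q 'X_i) ->
  (forall p q, Q p -> Q q -> Q (p + q)) -> (forall p q, Q p -> Q q -> Q (p * q)) -> forall p, Q p.
Proof.
move=> QC QX QD QM; elim/mpolyind => [|c m p _ _ Qp]; first by rewrite -mpolyC0.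
apply: QD => //; rewrite -mul_mpolyC; apply: (QM) => //; rewrite mpolyXE_id.
elim/big_rec: _ => [|i q _ Qq]; first by rewrite -mpolyC1.
apply: (QM) => //; elim: (m i) => [|N IH]; first by rewrite expr0 -mpolyC1.
by rewrite exprS; apply: QM.
Qed.

Lemma mderiv_eq0 p : (forall i, mderiv i p = 0) -> p = (p@_0)%:MP.
Proof.
move=> H; apply/mpolyP => m; rewrite mcoeffC.
have [->|m0] := eqVneq m 0%MM; first by rewrite mulr1.
rewrite mulr0; have [i mi] : exists i, m i != 0%N.
  apply: contrapT => H'; case/eqP: m0; apply/mnmP => i; rewrite mnm0E.
  by apply/eqP/negPn/negP => mi; apply: H'; exists i.
have := mcoeff_deriv i (m - U_(i))%MM p; rewrite H mcoeff0 submK; last by rewrite lep1mP.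
move=> /esym/eqP; rewrite -mulr_natr mulf_eq0 Num.Theory.pnatr_eq0 orbF => /eqP //.
Qed.

Lemma msize_mderiv i p N : (msize p <= N.+1)%N -> (msize (mderiv i p) <= N)%N.
Proof.
move=> pN; rewrite msizeE; apply/bigmax_leqP_seq => m; rewrite mcoeff_msupp mcoeff_deriv => mp _.
have : (m + U_(i))%MM \in msupp p by rewrite mcoeff_msupp; apply: contraNneq mp => ->; rewrite mul0rn.
by move/msize_mdeg_lt/leq_trans/(_ pN); rewrite mdegD mdeg1 addn1 ltnS.
Qed.

Lemma charC m : m.+1%:R != 0 :> C.
Proof. by rewrite Num.Theory.pnatr_eq0. Qed.

Local Notation F := (ratf C n).
Definition rat_iota : {rmorphism MP -> F} := mmap (ratf_cst C n) (fun i : 'I_n => ratf_var C n i).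
Local Notation props := (ratf_props charC n).
Lemma rat_dP i : derivation (@ratf_der C n i). Proof. by case: props => [[]]. Qed.
Lemma rat_iotaC c : rat_iota c%:MP = ratf_cst C n c. Proof. exact: mmapC. Qed.
Lemma rat_iotaX i : rat_iota 'X_i = ratf_var C n i.
Proof. by rewrite /rat_iota /= mmapX mmap1U. Qed.
Lemma rat_iota_d (i : 'I_n) p : ratf_der i (rat_iota p) = rat_iota (mderiv i p).
Proof.
have [[ch _ dC const cst0] [ge0 cl]] := props; have dP := rat_dP i.
elim/mpoly_gen: p => [c|j|p q Hp Hq|p q Hp Hq].
- by rewrite rat_iotaC cst0 mderivC rmorph0.
- rewrite rat_iotaX ratf_der_var //; last exact: charC.
  rewrite mderivX mnm1E; have [->|ij] := eqVneq j i.
    have -> : (U_(i) - U_(i))%MM = 0%MM by apply/mnmP => l; rewrite mnmBE subnn mnm0E.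
    by rewrite !eqxx mpolyX0 scale1r; apply/esym/rmorph1.
  by rewrite -val_eqE /= eq_sym in ij *; rewrite (negPf ij) scale0r; apply/esym/rmorph0.
- by rewrite rmorphD (derD dP) Hp Hq mderivD rmorphD.
by rewrite rmorphM (derM dP) Hp Hq mderivM rmorphD !rmorphM.
Qed.
(** Induction on the degree: the derivatives of a polynomial in the kernel lie in the kernel, so
    they vanish and the polynomial is constant. *)
Lemma rat_iota_inj : injective rat_iota.
Proof.
suff H N p : (msize p <= N)%N -> rat_iota p = 0 -> p = 0.
  move=> p q e; apply/eqP; rewrite -subr_eq0; apply/eqP.
  by apply: (H (msize (p - q))) => //; rewrite rmorphB e subrr.
elim: N p => [|N IH] p pN ip; first by apply/eqP; rewrite -msize_poly_eq0 -leqn0.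
have Ep : p = (p@_0)%:MP.
  apply: mderiv_eq0 => i; apply: IH; first exact: msize_mderiv.
  by rewrite -rat_iota_d ip (der0 (rat_dP i)).
move: ip; rewrite Ep rat_iotaC => /eqP; rewrite fmorph_eq0 => /eqP ->.
by rewrite mpolyC0.
Qed.
Definition rat_ext : diff_ext R n :=
  @DiffExt R n F (fun i => @ratf_der C n i) rat_iota (fun i => (rat_dP i).1) (fun i => (rat_dP i).2)
   (fun i j => let: conj (And5 _ _ H _ _) _ := props in H i j) rat_iota_inj rat_iota_d.

Lemma rat_ext_gen (x : rat_ext) : exists p q, q != 0 /\ x = de_iota rat_ext p / de_iota rat_ext q.
Proof.
have nz q : q != 0 -> rat_iota q != 0 := @de_iota_neq0 R n rat_ext q.
pose S (y : F) := exists p q, q != 0 /\ y = rat_iota p / rat_iota q.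
move: x; apply: (@ratf_gen C n F idfun S) => [x y|x y|x|c|i].
- move=> [p [q [q0 ->]]] [p' [q' [q'0 ->]]]; exists (p * q' + p' * q), (q * q').
  by rewrite mulf_neq0 // rmorphD !rmorphM /= frac_sum ?nz.
- move=> [p [q [q0 ->]]] [p' [q' [q'0 ->]]]; exists (p * p'), (q * q').
  by rewrite mulf_neq0 // !rmorphM /= frac_prod ?nz.
- move=> [p [q [q0 ->]]]; have [->|p0] := eqVneq p 0.
    by exists 0, 1; rewrite !rmorph0 !mul0r invr0 oner_neq0.
  by exists q, p; rewrite p0 invfM invrK mulrC.
- by exists c%:MP, 1; rewrite oner_neq0 rmorph1 divr1 /= rat_iotaC.
by move=> ilt; exists 'X_(Ordinal ilt), 1; rewrite oner_neq0 rmorph1 divr1 /= rat_iotaX.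
Qed.

(** With a denominator of least degree, a nonconstant common factor could be cancelled to reach a
    smaller one. *)
Lemma rat_ext_coprime (x : rat_ext) :
  exists g h, [/\ h != 0, mcoprime g h & x = de_iota rat_ext g / de_iota rat_ext h].
Proof.
pose S m := `[< exists g h : MP, [/\ h != 0, x = rat_iota g / rat_iota h & msize h = m]>].
have exS : exists m, S m.
  by have [p [q [q0 E]]] := rat_ext_gen x; exists (msize q); apply/asboolP; exists p, q.
case: (ex_minnP exS) => m /asboolP [g [h [h0 E sh]]] minS; exists g, h; split=> // c a b Eg Eh.
have [c0 b0] : c != 0 /\ b != 0 by apply/andP; rewrite -negb_or -mulf_eq0 -Eh.
have := minS (msize b); have -> : S (msize b).
  apply/asboolP; exists a, b; split=> //; rewrite E Eg Eh !rmorphM.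
  by rewrite -mulf_div mulfV ?mul1r // (de_iota_neq0 rat_ext).
move/(_ isT); rewrite -sh Eh msizeM // /mconst; have : (0 < msize b)%N by rewrite lt0n msize_poly_eq0.
by move: (msize b) (msize c) => y z; clear; lia.
Qed.

Lemma msize_irreducible_factors p : p != 0 -> exists s : seq MP,
  (forall f, f \in s -> mirreducible f) /\ exists c, p = c%:MP * \prod_(f <- s) f.
Proof.
have [N] := ubnP (msize p); elim: N p => // N IH p; rewrite ltnS => pN p0.
have [cp|ncp] := pselect (mconst p).
  by exists [::]; split=> //; exists p@_0; rewrite big_nil mulr1 -msize1_polyC.
have [irr|nirr] := pselect (mirreducible p).
  exists [:: p]; split; first by move=> f; rewrite inE => /eqP ->.
  by exists 1; rewrite big_seq1 mul1r.
have [a [b [E na nb]]] : exists a b, [/\ p = a * b, ~ mconst a & ~ mconst b].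
  apply: contrapT => H; apply: nirr; split=> // a b E.
  have [ca|na] := pselect (mconst a); first by left.
  right; apply: contrapT => nb; apply: H; by exists a, b.
have [a0 b0] : a != 0 /\ b != 0 by apply/andP; rewrite -negb_or -mulf_eq0 -E.
have sz : (msize a < msize p)%N /\ (msize b < msize p)%N.
  move: na nb; rewrite E msizeM // /mconst => /negP + /negP; rewrite -!ltnNge.
  by move: (msize a) (msize b) => y z; clear; lia.
have [s1 [irr1 [c1 E1]]] := IH a (leq_trans sz.1 pN) a0.
have [s2 [irr2 [c2 E2]]] := IH b (leq_trans sz.2 pN) b0.
exists (s1 ++ s2); split; first by move=> f; rewrite mem_cat => /orP[/irr1|/irr2].
exists (c1 * c2); rewrite big_cat E {1}E1 {1}E2 mpolyCM /=.
by move: (\prod_(_ <- _) _) (\prod_(_ <- _) _) => y z; ring.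
Qed.
End RationalExtension.

Lemma dlog_mul_identity (K : fieldType) (a b c a' : K) :
  a != 0 -> a' * c + a * (b * c) = (a' / a + b) * (a * c).
Proof. by move=> a0; field. Qed.
Lemma dlog_inv_identity (K : fieldType) (a a' : K) : a != 0 -> - a' / a ^+ 2 / a^-1 = - (a' / a).
Proof. by move=> a0; rewrite invrK; field. Qed.

(** * The Darboux multiplier *)

Section DarbouxMultiplier.
Variables (R : realType) (n : nat).
Local Notation C := (complex R).
Local Notation MP := {mpoly C[n]}.
Local Notation E0 := (rat_ext R n).
Local Notation io := (de_iota E0).
Local Notation dlg i x := (@de_d R n E0 i x / x).

Lemma dlog_prod (K : fieldType) (D : K -> K) (I : Type) (s : seq I) (f a : I -> K) :
  derivation D -> (forall i, D (f i) = a i * f i) ->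
  D (\prod_(i <- s) f i) = (\sum_(i <- s) a i) * \prod_(i <- s) f i.
Proof.
move=> DP H; elim: s => [|i s IH]; first by rewrite !big_nil (der1 DP) mul0r.
by rewrite !big_cons (derM DP) H IH; ring.
Qed.

(** Factor numerator and denominator; constant factors have zero logarithmic derivative. *)
Lemma dlog_irreducible (x : E0) : x != 0 -> exists s : seq (C * MP),
  (forall y, y \in s -> mirreducible y.2) /\
  forall i, dlg i x = \sum_(y <- s) io y.1%:MP * dlg i (io y.2).
Proof.
have nz q : q != 0 -> io q != 0 := @de_iota_neq0 R n E0 q.
have dE i := @de_dP R n E0 i.
have dpoly p : p != 0 -> exists s : seq MP, (forall f, f \in s -> mirreducible f) /\
    forall i, dlg i (io p) = \sum_(f <- s) dlg i (io f).
  move=> p0; have [s [irr [c Ec]]] := msize_irreducible_factors p0.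
  exists s; split=> // i; have c0 : c%:MP != 0 :> MP by apply: contraNneq p0 => e; rewrite Ec e mul0r.
  have q0 : \prod_(f <- s) f != 0 by apply: contraNneq p0 => e; rewrite Ec e mulr0.
  rewrite Ec rmorphM (dlogM (dE i)) ?nz // de_iota_d mderivC rmorph0 mul0r add0r.
  have fs f : f \in s -> io f != 0.
    move=> fs; apply: nz; apply: contraNneq q0 => f0.
    by rewrite (perm_big _ (perm_to_rem fs)) big_cons mulf_eq0 f0 eqxx.
  have pz : \prod_(f <- s) io f != 0 by rewrite -rmorph_prod nz.
  apply: (mulIf pz); rewrite rmorph_prod divfK //; elim: s fs {irr Ec q0 pz} => [|f s IH] fs.
    by rewrite !big_nil (der1 (dE i)) mul0r.
  rewrite !big_cons (derM (dE i)) IH => [|g gs]; last by apply: fs; rewrite inE gs orbT.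
  have := fs f (mem_head _ _); move: (io f) (\sum_(_ <- _) _) (\prod_(_ <- _) _) => a b c' a0.
  by move: (de_d i a) => a'; apply: dlog_mul_identity.
have [p [q [q0 ->]]] := rat_ext_gen x; move=> x0.
have p0 : p != 0 by apply: contraNneq x0 => ->; rewrite rmorph0 mul0r.
have [s1 [irr1 E1]] := dpoly p p0; have [s2 [irr2 E2]] := dpoly q q0.
exists ([seq (1, f) | f <- s1] ++ [seq (-1, f) | f <- s2]); split.
  by move=> y; rewrite mem_cat => /orP[] /mapP [f fs ->]; [apply: irr1 | apply: irr2].
move=> i; rewrite (dlogM (dE i)) ?invr_eq0 ?nz // big_cat !big_map /= E1; congr (_ + _).
  by apply: eq_bigr => f _; rewrite mpolyC1 rmorph1 mul1r.
have -> : dlg i (io q)^-1 = - dlg i (io q).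
  rewrite (derV (dE i)); have := nz _ q0; move: (io q) (de_d i (io q)) => a a' a0.
  exact: dlog_inv_identity.
rewrite E2 -sumrN; apply: eq_bigr => f _.
by rewrite mpolyCN mpolyC1 rmorphN rmorph1 mulN1r.
Qed.

Lemma dlog_sum_irreducible (s : seq (C * E0)) : (forall y, y \in s -> y.2 != 0) ->
  exists s' : seq (C * MP), (forall y, y \in s' -> mirreducible y.2) /\
  forall i, \sum_(y <- s) io y.1%:MP * dlg i y.2 = \sum_(y <- s') io y.1%:MP * dlg i (io y.2).
Proof.
elim: s => [|[c x] s IH] s0; first by exists [::]; split=> // i; rewrite !big_nil.
have [s1 [irr1 E1]] := dlog_irreducible (s0 _ (mem_head _ _)).
have [|s2 [irr2 E2]] := IH; first by move=> y ys; apply: s0; rewrite inE ys orbT.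
exists ([seq (c * y.1, y.2) | y <- s1] ++ s2); split.
  by move=> y; rewrite mem_cat => /orP[/mapP [z zs ->]|/irr2//]; exact: (irr1 z zs).
move=> i; rewrite big_cons big_cat big_map /= E1 E2 mulr_sumr; congr (_ + _).
by apply: eq_bigr => y _; rewrite mpolyCM rmorphM; apply: mulrA.
Qed.

(** Adds up the exponents of repeated factors, which yields the pairwise distinct f_i of a Darboux
    function. *)
Lemma merge_terms (K : fieldType) (g : {rmorphism C -> K}) (s : seq (C * MP)) (G : MP -> K) :
  \sum_(y <- s) g y.1 * G y.2 =
  \sum_(f <- undup [seq y.2 | y <- s]) g (\sum_(y <- s | y.2 == f) y.1) * G f.
Proof.
under [RHS]eq_bigr => f _ do rewrite rmorph_sum mulr_suml big_mkcond.
rewrite exchange_big /= big_seq [RHS]big_seq; apply: eq_bigr => y ys.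
have us := undup_uniq [seq y.2 | y <- s].
have yin : y.2 \in undup [seq y.2 | y <- s] by rewrite mem_undup map_f.
rewrite (perm_big _ (perm_to_rem yin)) big_cons eqxx big1_seq /= ?addr0 // => f fr.
by rewrite mem_rem_uniq // inE eq_sym in fr; case/andP: fr => /negPf ->.
Qed.

(** Each exponential of a primitive of a closed form is realised as the variable z of a Laurent
    extension with m = 0. *)
Lemma adjoin_exponentials N : forall (k : diff_ext R n) (a : nat -> 'I_n -> k),
  (forall j, closed_form (@de_d _ _ k) (a j)) ->
  exists (k' : diff_ext R n) (f : {rmorphism k -> k'}) (t : nat -> k'), diff_hom f /\
  forall j, (j < N)%N -> t j != 0 /\ forall i, de_d i (t j) = f (a j i) * t j.
Proof.
elim: N => [|N IH] k a aC; first by exists k, idfun, (fun=> 0).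
have [k1 [f1 [t1 [h1 H1]]]] := IH k a aC.
have cC : closed_form (@de_d _ _ k1) (fun i => f1 (a N i)) by move=> i j; rewrite -!h1.1 aC.
pose f2 := laur_C 0 cC; have h2 : diff_hom f2 := laur_C_hom 0 cC.
exists (laur_ext 0 cC), (f2 \o f1), (fun j => if j == N then tofrac (psX k1) else f2 (t1 j)).
split=> [|j]; first exact: diff_hom_comp.
rewrite ltnS leq_eqVlt; case: eqVneq => [->|jN] /= lt.
  split=> [|i]; first exact: zz_neq0.
  rewrite [LHS](@D_zz k1 (@de_d _ _ k1 i) (f1 (a N i)) 0 (@de_dP _ _ k1 i)).
  by rewrite /dlogz expr0 mulr1.
have [t0 dt] := H1 j lt; split=> [|i]; first by rewrite -[X in X != 0]/(f2 (t1 j)) fmorph_eq0.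
by rewrite -[LHS]h2.1 dt rmorphM.
Qed.

Theorem darboux_of_multiplier (P : 'I_n -> MP) : multiplier_in E0 P -> has_darboux_jacobian_multiplier P.
Proof.
move=> [u [ucl Eu]]; have dE i := @de_dP R n E0 i.
(* The rational tower indexes derivations by all of nat, so the form is extended by 0 beyond n,
   where the derivations vanish too. *)
pose u' (i : nat) : E0 := if insub i is Some j then u j else 0.
have u'E (i : 'I_n) : u' i = u i by rewrite /u' valK.
have [[ch dP dC const cst0] [ge0 clog]] := ratf_props (@charC R) n.
have [||S [s0 [s0nz Es]]] := clog u'.
- have z i x : (n <= i)%N -> @ratf_der C n i x = 0 by apply: ge0.
  have u0 i : (n <= i)%N -> u' i = 0 by move=> ni; rewrite /u' insubF // ltnNge ni.
  move=> i j; case: (ltnP i n) => [ilt|ni]; last by rewrite (z i) // (u0 i) // (der0 (dP _)).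
  case: (ltnP j n) => [jlt|nj]; last by rewrite (z j) // (u0 j) // (der0 (dP _)).
  by have := ucl (Ordinal ilt) (Ordinal jlt); rewrite -!u'E.
- move=> i di0; rewrite /u'; case: insubP => // j ilt ij.
  have := di0 (ratf_var C n i); rewrite (ratf_der_var (@charC R)) // eqxx => /eqP.
  by rewrite oner_eq0.
have {s0 s0nz Es} [s [irrs Es]] : exists s : seq (C * MP), (forall y, y \in s -> mirreducible y.2) /\
    forall i, u i = @de_d R n E0 i S + \sum_(y <- s) io y.1%:MP * dlg i (io y.2).
  have [s [irr E]] := dlog_sum_irreducible s0nz; exists s; split=> // i.
  rewrite -E -u'E Es; congr (_ + _); apply: eq_bigr => y _.
  by rewrite [io _]rat_iotaC.
have [g [h [h0 cop ES]]] := rat_ext_coprime S.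
pose fs := undup [seq y.2 | y <- s]; pose l f := \sum_(y <- s | y.2 == f) y.1.
pose cio : {rmorphism C -> E0} := io \o (@mpolyC n C).
have Es' i : u i = @de_d R n E0 i S + \sum_(f <- fs) io (l f)%:MP * dlg i (io f).
  by rewrite Es (merge_terms cio _ (fun f => dlg i (io f))).
pose r := size fs; pose ff (i : 'I_r) := nth 0 fs i.
have irrf i : mirreducible (ff i).
  have : ff i \in fs by apply: mem_nth.
  by rewrite mem_undup => /mapP [y ys ->]; apply: irrs.
(* Index 0 is the exponent S of the exponential factor; index j + 1 is the factor f_j^(l_j). *)
pose a (j : nat) (i : 'I_n) : E0 := if j is j'.+1 then
   io (l (nth 0 fs j'))%:MP * dlg i (io (nth 0 fs j')) else @de_d R n E0 i S.
have aC j : closed_form (@de_d _ _ E0) (a j).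
  case: j => [|j] i i'; first exact: (@de_comm R n E0 i i' S).
  have d0 b c : @de_d R n E0 b (io c%:MP) = 0 by rewrite de_iota_d mderivC rmorph0.
  rewrite /a (derM (dE i)) (derM (dE i')) !d0 !mul0r !add0r; congr (_ * _).
  exact: dlog_closed _ (dE i) (dE i') (@de_comm R n E0 i i').
have [k [q [t [hq Ht]]]] := adjoin_exponentials r.+1 aC.
have dk i := @de_dP R n k i.
pose Ex := t 0%N; pose Fx (i : 'I_r) := t i.+1; pose J := Ex * \prod_(i < r) Fx i.
exists k, J; split.
  exists g, h, r, ff, (fun i => l (ff i)), Ex, Fx; split; [split=> //|split=> //].
  - by move=> i j /eqP; rewrite nth_uniq ?undup_uniq // => /eqP/val_inj.
  - have [t0 dt] := Ht 0%N (ltn0Sn _); split=> // i; rewrite dt mulrC; congr (_ * _).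
    by rewrite /= ES hq.1 fmorph_div !hq.2.
  move=> i; have [t0 dt] := Ht i.+1 (ltn_ord i); split=> // j.
  rewrite dt /= rmorphM fmorph_div hq.1 !hq.2 -/(Fx i) -/(ff i).
  by move: (de_iota k _) (de_d j _) (de_iota k _)^-1 (Fx i) => x y z w; ring.
have dJ i : de_d i J = q (u i) * J.
  have dF j : de_d i (Fx j) = q (a j.+1 i) * Fx j by case: (Ht j.+1 (ltn_ord j)).
  have [_ dt] := Ht 0%N (ltn0Sn _); rewrite /J (derM (dk i)) dt.
  rewrite (dlog_prod _ (dk i) dF) Es' rmorphD rmorph_sum -/Ex.
  rewrite (big_nth 0) big_mkord.
  by move: (\sum_(_ < _) _) (\prod_(_ < _) _) (q _) => x y z; ring.
rewrite /jacobian_multiplier.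
(* As dJ = u J, the divergence of J P is J (u(P) + div P). *)
transitivity (J * q (\sum_j io (P j) * u j + \sum_j de_d j (io (P j)))).
  rewrite rmorphD !rmorph_sum mulrDr !mulr_sumr -big_split; apply: eq_bigr => j _ /=.
  rewrite (derM (dk j)) dJ -(hq.2 (P j)) -hq.1 rmorphM.
  by move: (q (u j)) (q (io _)) (q _) => x y z; ring.
by rewrite Eu /diverg addNr rmorph0 mulr0.
Qed.
End DarbouxMultiplier.

Theorem theorem1p2 (R : realType) (n : nat) (hn : (2 <= n)%N)
    (P : 'I_n -> {mpoly (complex R)[n]}) :
  liouvillian_integrable P -> has_darboux_jacobian_multiplier P.
Proof.
move=> H; apply: darboux_of_multiplier.
have [P0|P0] := pselect (exists j, P j != 0); first exact: liouvillian_integrable_multiplier.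
(* For P = 0 the zero form satisfies both conditions on u. *)
have {}P0 j : P j = 0 by apply/eqP/negPn/negP => Pj; apply: P0; exists j.
exists (fun=> 0); split=> [i j|]; first by rewrite !(der0 (@de_dP R n _ _)).
rewrite /diverg !big1 ?oppr0 // => j _; first by rewrite P0 rmorph0 (der0 (@de_dP R n _ _)).
by rewrite mulr0.
Qed.
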